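(* Let $0\le t\le T$, let $\mathfrak h$ be a finite-dimensional Hilbert space with conjugation $\Theta$, and let $V_T\in\bigwedge_{\mathrm{even}}\mathfrak h$. Let $(X_t)_t$ be a norm-compatible Grassmann Brownian martingale indexed by $\mathfrak h$ with differentiable covariance $(G_t)_t$. Assume that $\Psi$ solves the following forward-backward equation for $s\in[t,T]$: $$\Psi_s(v)=\sum_i\int_t^s\langle\!\langle v,\dot G_rv_i\rangle\!\rangle_\Theta\,\omega_r\big((\partial_{v_i}V_T)(\Psi_T)\big)\mathrm dr+X_{t,s}(v),\qquad v\in\mathfrak h$$ (so that $\Psi_t=0$), where $(v_i)$ is an orthonormal basis of $\mathfrak h$. Then for any $P\in\bigwedge\mathfrak h$ $$\omega_t(P(\Psi_s))=\frac{\omega_t\big(P(X_{t,s})e^{V_T(X_{t,T})}\big)}{\omega_t\big(e^{V_T(X_{t,T})}\big)},\qquad\forall s\in[t,T].$$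
   Context: Non-commutative probability. A non-commutative probability space is a unital $C^*$-algebra $\mathcal M$ of operators on a separable Hilbert space with a state $\omega$. A filtered one (FNPS) $(\mathcal M,\omega,(\mathcal M_t)_t)$ has in addition sub-$C^*$-algebras $\mathcal M_t\subseteq\mathcal M_{t'}\subseteq\mathcal M$ for $t\le t'$; it is equipped with a conditional expectation: positive linear maps $\omega_t:\mathcal M\to\mathcal M_t$ with $\omega_t(\mathbb 1)=\mathbb 1$, $\omega_t(N_1MN_2)=N_1\omega_t(M)N_2$ for $N_1,N_2\in\mathcal M_t$, $\omega\circ\omega_t=\omega$, and $\omega_s\circ\omega_t=\omega_s$ for $s\le t$. A conjugation $\Theta$ on $\mathfrak h$ is antilinear with $\langle f,g\rangle=\langle\Theta g,\Theta f\rangle$, $\Theta^2=\mathrm{Id}$; $\langle\!\langle f,g\rangle\!\rangle_\Theta=\langle\Theta f,g\rangle$ (inner products linear in the second argument); $A\in\mathcal B(\mathfrak h)$ is $\Theta$-antisymmetric if $\Theta A^*\Theta=-A$. A Grassmann field indexed by $\mathfrak h$ is a linear map $\psi:\mathfrak h\to\mathcal M$ with $\psi(f)\psi(g)+\psi(g)\psi(f)=0$; it extends to an algebra homomorphism of the exterior algebra $\bigwedge\mathfrak h$, and $F(\psi):=\psi(F)$ for $F\in\bigwedge\mathfrak h$. Grassmann fields $\psi_1,\psi_2$ are compatible if $\psi_1(f)\psi_2(g)+\psi_2(g)\psi_1(f)=0$ for all $f,g$. A Grassmann process is a family of pairwise compatible Grassmann fields; it is adapted if $\psi_t(f)\in\mathcal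 M_t$. Grassmann Brownian martingale (GBM) with covariance $(G_t)_t$ ($\Theta$-antisymmetric operators): adapted centred Gaussian Grassmann process $(X_t)$ (all moments given by the anticommuting Wick/Pfaffian rule) with $\omega(X_t(f)X_s(g))=\langle\!\langle f,G_{t\wedge s}g\rangle\!\rangle_\Theta$ and with independent increments: for $s\le t$, $A_1\in\mathcal M_t$ and $A_2$ in the $C^*$-algebra generated by $\{X_\tau(f)-X_t(f):\tau>t,f\in\mathfrak h\}$, $\omega_s(A_1A_2)=\omega_s(A_2A_1)=\omega_s(A_1)\omega_s(A_2)=\omega_s(A_2)\omega_s(A_1)$; in particular $\omega_s((X_t-X_s)(f))=0$ for $s\le t$. $X_{s,t}:=X_t-X_s$. It is norm-compatible if for any decomposition $\dot G_t=C_t^*C_tU_t$, $U_t$ unitary, it can be realised so that $\|X_t(f)\|^2\le c_X\int_0^t(\|C_sU_sf\|^2+\|C_s\Theta f\|^2)\mathrm ds$ for some $c_X>0$. Grassmann calculus. $\bigwedge_{\mathrm{even}}\mathfrak h=\bigoplus_n\mathfrak h^{\wedge2n}$. $\partial_{v_j}$ is the linear operator on $\bigwedge\mathfrak h$ with $\partial_{v_j}1=0$ and $\partial_{v_j}(v_iF)+v_i\partial_{v_j}F=\delta_{ij}F$. $e^{V}$ is defined by its power series. A solution $\Psi=(\Psi_s)_{s\in[t,T]}$ is an adapted Grassmann process, compatible with $X$. In shorthand, the equation reads $\mathrm d\Psi_s=\dot G_s\omega_s(\mathrm DV_T(\Psi_T))\mathrm ds+\mathrm dX_s$, $\Psi_t=0$,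 with $(\dot G_s\mathrm DV)(v)=\sum_i\langle\!\langle v,\dot G_sv_i\rangle\!\rangle_\Theta\partial_{v_i}V$.
   Formalization: Independent increments also includes ω_t(A)=ω(A)1 for A in the C*-algebra generated by the increments after t; with the displayed equalities alone the formula fails if ω ignores a direct summand where X has covariance cG. The integral in the norm bound is taken finite. *)

(* Defs.v *)
From HB Require Import structures.
From mathcomp Require Import all_boot all_order all_algebra ring.
Set Implicit Arguments.
Unset Strict Implicit.
Unset Printing Implicit Defensive.
Import Order.TTheory GRing.Theory Num.Theory.
Local Open Scope ring_scope.

(* The exterior algebra on n generators, an element F being given by its
   coefficients F S on the monomials e_S = e_{i_1} ... e_{i_k} with
   S = {i_1 < ... < i_k}. One has e_S e_T = ext_sign S T e_{S :|: T}; the sign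
   vanishes when S and T intersect. *)
Definition ext_sign1 (K : comNzRingType) n (i j : 'I_n) : K :=
  if i == j then 0 else (-1) ^+ (j < i)%N.
Definition ext_sign (K : comNzRingType) n (S T : {set 'I_n}) : K :=
  \prod_(i in S) \prod_(j in T) ext_sign1 K i j.

Definition extalg (K : comNzRingType) n := {ffun {set 'I_n} -> K^o}.
#[warnings="-redundant-canonical-projection"]
HB.instance Definition _ (K : comNzRingType) n :=
  GRing.Lmodule.copy (extalg K n) {ffun {set 'I_n} -> K^o}.

Section Ext.
Variables (K : comNzRingType) (n : nat).
Implicit Types (F G H : extalg K n) (S T U W : {set 'I_n}).
Local Notation sg := (@ext_sign K n).

Definition ext_mono U : extalg K n := [ffun S => (S == U)%:R].
Definition ext_mul F G : extalg K n :=
  [ffun U => \sum_(S : {set 'I_n}) \sum_(T : {set 'I_n} | S :|: T == U)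
     sg S T * F S * G T].

Lemma ext_sign_inter S T : S :&: T != set0 -> sg S T = 0.
Proof.
case/set0Pn => i; rewrite inE => /andP[iS iT].
by rewrite /ext_sign (bigD1 i) //= (bigD1 i) //= /ext_sign1 eqxx !mul0r.
Qed.

Lemma ext_sign0l S : sg set0 S = 1.
Proof. by rewrite /ext_sign big_set0. Qed.
Lemma ext_sign0r S : sg S set0 = 1.
Proof. by rewrite /ext_sign big1 // => i _; rewrite big_set0. Qed.

Lemma ext_signUl S T U : S :&: T = set0 -> sg (S :|: T) U = sg S U * sg T U.
Proof.
move=> d; rewrite /ext_sign (eq_bigl [predU S & T]) ?bigU //=; last by move=> i; rewrite !inE.
by rewrite -setI_eq0 d.
Qed.
Lemma ext_signUr S T U : S :&: T = set0 -> sg U (S :|: T) = sg U S * sg U T.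
Proof.
move=> d; rewrite /ext_sign -big_split /=; apply: eq_bigr => i _.
rewrite (eq_bigl [predU S & T]) ?bigU //=; last by move=> j; rewrite !inE.
by rewrite -setI_eq0 d.
Qed.

Lemma ext_sign_assoc S T U : sg S T * sg (S :|: T) U = sg T U * sg S (T :|: U).
Proof.
have [dST|nST] := eqVneq (S :&: T) set0; last first.
  rewrite ext_sign_inter // mul0r (@ext_sign_inter S) ?mulr0 //.
  by apply: contraNneq nST => e; rewrite -subset0 -e setIS // subsetUl.
have [dTU|nTU] := eqVneq (T :&: U) set0; last first.
  rewrite (@ext_sign_inter (S :|: T)) ?mulr0; last first.
    by apply: contraNneq nTU => e; rewrite -subset0 -e setSI // subsetUr.
  by rewrite (@ext_sign_inter T) // mul0r.
by rewrite ext_signUl // ext_signUr //; ring.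
Qed.

Lemma ext_mulA : associative ext_mul.
Proof.
move=> F G H; apply/ffunP => U; rewrite !ffunE.
transitivity (\sum_S \sum_T \sum_(W | S :|: T :|: W == U)
    sg S T * sg (S :|: T) W * F S * G T * H W).
  apply: eq_bigr => S _.
  under eq_bigr => Y _ do rewrite ffunE mulr_sumr.
  under eq_bigr => Y _ do under eq_bigr => T _ do rewrite mulr_sumr.
  rewrite exchange_big /=; apply: eq_bigr => T _.
  rewrite (exchange_big_dep (fun W => S :|: T :|: W == U)) /=; last first.
    by move=> Y W /eqP<- /eqP<-; rewrite setUA.
  apply: eq_bigr => W /eqP eU; rewrite (big_pred1 (T :|: W)); last first.
    by move=> Y /=; rewrite [T :|: W == Y]eq_sym andb_idl // => /eqP->; rewrite setUA eU.
  by rewrite ext_sign_assoc; ring.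
symmetry.
under eq_bigr => Y _ do under eq_bigr => W _ do
  rewrite ffunE mulr_sumr mulr_suml.
under eq_bigr => Y _ do rewrite exchange_big /=.
rewrite exchange_big /=; apply: eq_bigr => S _.
under eq_bigr => Y _ do under eq_bigr => W _ do rewrite mulr_sumr mulr_suml.
under eq_bigr => Y _ do rewrite (exchange_big_dep xpredT) //=.
rewrite exchange_big /=; apply: eq_bigr => T _.
rewrite (exchange_big_dep (fun W => S :|: T :|: W == U)) /=; last first.
  by move=> Y W _ /andP[/eqP<- /eqP<-].
apply: eq_bigr => W /eqP eU; rewrite (big_pred1 (S :|: T)); last first.
  move=> Y /=; rewrite [S :|: T == Y]eq_sym andbC andb_idr // => /eqP->.
  by rewrite eU.
by ring.
Qed.

Lemma ext_mulDl : left_distributive ext_mul +%R.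
Proof.
move=> F G H; apply/ffunP => U; rewrite !ffunE -big_split; apply: eq_bigr => S _.
by rewrite -big_split; apply: eq_bigr => T _; rewrite ffunE /=; ring.
Qed.

Lemma ext_mulDr : right_distributive ext_mul +%R.
Proof.
move=> F G H; apply/ffunP => U; rewrite !ffunE -big_split; apply: eq_bigr => S _.
by rewrite -big_split; apply: eq_bigr => T _; rewrite ffunE /=; ring.
Qed.

Lemma ext_mul_monoE T F U :
  ext_mul (ext_mono T) F U = \sum_(S | T :|: S == U) sg T S * F S.
Proof.
rewrite ffunE (bigD1 T) //= [X in _ + X]big1 ?addr0; last first.
  by move=> S nS; rewrite big1 // => W _; rewrite ffunE (negPf nS) mulr0 mul0r.
by apply: eq_bigr => S _; rewrite ffunE eqxx mulr1.
Qed.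

Lemma ext_mul1l : left_id (ext_mono set0) ext_mul.
Proof.
move=> F; apply/ffunP => U; rewrite ext_mul_monoE (big_pred1 U).
  by rewrite ext_sign0l mul1r.
by move=> S /=; rewrite set0U.
Qed.

Lemma ext_mul1r : right_id (ext_mono set0) ext_mul.
Proof.
move=> F; apply/ffunP => U; rewrite ffunE (bigD1 U) //= (bigD1 set0) ?setU0 //=.
rewrite ffunE eqxx ext_sign0r mul1r mulr1 !big1 ?addr0 //.
  move=> S nSU; rewrite big1 // => T /eqP eU; rewrite ffunE.
  case: eqVneq => [T0|_]; last by rewrite mulr0.
  by rewrite -eU T0 setU0 eqxx in nSU.
by move=> T /andP[_ nT]; rewrite ffunE (negPf nT) mulr0.
Qed.

Lemma ext_1_neq0 : ext_mono set0 != 0.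
Proof.
by apply/eqP => /ffunP/(_ set0)/eqP; rewrite !ffunE eqxx oner_eq0.
Qed.

Lemma ext_scalerAl (a : K) F G : a *: ext_mul F G = ext_mul (a *: F) G.
Proof.
apply/ffunP => U; rewrite !ffunE scaler_sumr; apply: eq_bigr => S _.
rewrite scaler_sumr; apply: eq_bigr => T _; rewrite ffunE /GRing.scale /=; ring.
Qed.

Lemma ext_scalerAr (a : K) F G : a *: ext_mul F G = ext_mul F (a *: G).
Proof.
apply/ffunP => U; rewrite !ffunE scaler_sumr; apply: eq_bigr => S _.
rewrite scaler_sumr; apply: eq_bigr => T _; rewrite ffunE /GRing.scale /=; ring.
Qed.

HB.instance Definition _ := GRing.Zmodule_isNzRing.Build (extalg K n)
  ext_mulA ext_mul1l ext_mul1r ext_mulDl ext_mulDr ext_1_neq0.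
HB.instance Definition _ :=
  GRing.Lmodule_isLalgebra.Build K (extalg K n) ext_scalerAl.
HB.instance Definition _ :=
  GRing.Lalgebra_isAlgebra.Build K (extalg K n) ext_scalerAr.

Lemma ext_mulE F G U : (F * G) U =
  \sum_(S : {set 'I_n}) \sum_(T : {set 'I_n} | S :|: T == U) sg S T * F S * G T.
Proof. exact: ffunE. Qed.

Definition ext_gen (i : 'I_n) : extalg K n := ext_mono [set i].
(* Left derivative, determined by linearity, ext_deriv1 and ext_deriv_gen. *)
Definition ext_deriv (j : 'I_n) F : extalg K n :=
  [ffun S => sg [set j] S * F (j |: S)].

Lemma ext_sign_sqr i S : i \notin S -> sg [set i] S * sg [set i] S = 1.
Proof.
move=> iS; rewrite /ext_sign !big_set1 -big_split big1 //= => j jS.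
rewrite /ext_sign1; case: eqVneq => [ij|_]; first by rewrite ij jS in iS.
by rewrite -expr2 sqrr_sign.
Qed.

Lemma ext_sign_mem j S : j \in S -> sg [set j] S = 0.
Proof.
move=> jS; apply: ext_sign_inter; apply/set0Pn; exists j.
by rewrite !inE eqxx.
Qed.

Lemma ext_sign_swap i j : i != j -> sg [set j] [set i] = - sg [set i] [set j].
Proof.
move=> ij; rewrite /ext_sign !big_set1 /ext_sign1 eq_sym (negPf ij).
by rewrite -val_eqE /= in ij; case: ltngtP ij => // _ _; rewrite ?opprK.
Qed.

Lemma ext_gen_mulE i F U :
  (ext_gen i * F) U = if i \in U then sg [set i] (U :\ i) * F (U :\ i) else 0.
Proof.
rewrite [LHS]ext_mul_monoE; case: ifPn => iU; last first.
  by rewrite big1 // => S /eqP eU; rewrite -eU !inE eqxx in iU.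
rewrite (bigD1 (U :\ i)) /=; last by rewrite setD1K.
rewrite big1 ?addr0 // => S /andP[/eqP eU nS].
have [iS|iS] := boolP (i \in S); first by rewrite ext_sign_mem ?mul0r.
by rewrite -eU setU1K ?eqxx in nS.
Qed.

Lemma ext_deriv_is_linear j : linear (ext_deriv j).
Proof.
by move=> a F G; apply/ffunP => S; rewrite !ffunE /GRing.scale /=; ring.
Qed.
HB.instance Definition _ j := GRing.isLinear.Build K (extalg K n) (extalg K n)
  *:%R (ext_deriv j) (ext_deriv_is_linear j).

Lemma ext_deriv1 j : ext_deriv j 1 = 0.
Proof.
apply/ffunP => S; rewrite !ffunE (_ : _ == set0 = false) ?mulr0 //.
by apply/negbTE/set0Pn; exists j; rewrite !inE eqxx.
Qed.

Lemma ext_deriv_gen i j F :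
  ext_deriv j (ext_gen i * F) + ext_gen i * ext_deriv j F = (i == j)%:R *: F.
Proof.
apply/ffunP => U; rewrite ffunE [ext_deriv j _ U]ffunE !ext_gen_mulE !inE.
rewrite [RHS]ffunE /GRing.scale /= ffunE.
have [->|ij] /= := eqVneq i j.
  rewrite mul1r; have [jU|jU] := boolP (j \in U).
    rewrite ext_sign_mem // mul0r add0r mulrA ext_sign_sqr ?setD11 //.
    by rewrite mul1r setD1K.
  by rewrite addr0 setU1K // mulrA ext_sign_sqr // mul1r.
rewrite mul0r; have [iU|iU] := boolP (i \in U); last by rewrite mulr0 addr0.
have [jU|jU] := boolP (j \in U).
  rewrite ext_sign_mem // (@ext_sign_mem j (U :\ i)) ?mul0r ?mulr0 ?addr0 //.
  by rewrite !inE eq_sym ij.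
have e : (j |: U) :\ i = j |: (U :\ i).
  by apply/setP => k; rewrite !inE; case: (eqVneq k j) => [->|]; rewrite ?orbF //= eq_sym ij.
have e1 : sg [set j] U = sg [set j] [set i] * sg [set j] (U :\ i).
  rewrite -[in LHS](setD1K iU) ext_signUr //.
  by apply/setP => k; rewrite !inE; case: eqVneq.
have e2 : sg [set i] (j |: U :\ i) = sg [set i] [set j] * sg [set i] (U :\ i).
  rewrite ext_signUr //.
  by apply/setP => k; rewrite !inE; case: eqVneq => // ->; rewrite (negPf jU) andbF.
have s2 : sg [set i] [set j] * sg [set i] [set j] = 1.
  by rewrite ext_sign_sqr // inE.
rewrite e e1 e2 (ext_sign_swap ij).
by ring: s2.
Qed.


Lemma ext_gen_anticomm i j : ext_gen i * ext_gen j + ext_gen j * ext_gen i = 0.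
Proof.
apply/ffunP => U; rewrite [LHS]ffunE !ext_gen_mulE [RHS]ffunE !ffunE.
have [->|ij] := eqVneq i j.
  case: ifP => jU; last by rewrite addr0.
  rewrite (_ : U :\ j == [set j] = false) ?mulr0 ?addr0 //.
  by apply/negbTE/eqP => /setP/(_ j); rewrite !inE eqxx.
have sE k l : k != l -> (k \in U) && (U :\ k == [set l]) = (U == [set k; l]).
  move=> kl; apply/andP/eqP => [[kU /eqP e]|->]; first by rewrite -e setD1K.
  by rewrite !inE eqxx setU1K ?inE.
have ji : j != i by rewrite eq_sym.
have h1 := sE _ _ ij; have h2 := sE _ _ ji; rewrite [[set j; i]]setUC in h2.
have [eU|nU] := eqVneq U [set i; j].
  move: h1 h2; rewrite (introT eqP eU) => /andP[-> e1] /andP[-> e2].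
  have Ui : U :\ i = [set j].
    exact/eqP.
  have Uj : U :\ j = [set i].
    exact/eqP.
  by rewrite Ui Uj !eqxx !mulr1 (ext_sign_swap ij) addrN.
rewrite (negPf nU) in h1 h2.
by case: ifP h1 => /= [_ ->|_ _]; case: ifP h2 => /= [_ ->|_ _];
  rewrite ?mulr0 ?addr0.
Qed.

End Ext.

Section Eval.
Variables (K : comNzRingType) (n : nat) (A : algType K) (x : 'I_n -> A).
(* The product is taken in increasing order of the indices; ext_eval is the
   algebra morphism sending the generators to the x i, see ext_eval_gen and
   ext_eval_is_monoid_morphism. *)
Definition ext_eval (F : extalg K n) : A :=
  \sum_(S : {set 'I_n}) F S *: \prod_(i in S) x i.

Hypothesis xsq : forall i, x i * x i = 0.
Hypothesis xac : forall i j, x i * x j + x j * x i = 0.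
Local Notation ord_lt := (relpre (@nat_of_ord n) ltn).

Lemma ord_lt_trans : transitive ord_lt.
Proof. by move=> a b c; apply: ltn_trans. Qed.

Lemma ext_eval_gen_mono (s : seq 'I_n) (T : {set 'I_n}) i :
  sorted ord_lt s -> i \in s ->
  x i * \prod_(j <- s | j \in T) x j =
  (\prod_(j <- s | j \in T) ext_sign1 K i j) *:
     \prod_(j <- s | j \in i |: T) x j.
Proof.
elim: s => [//|k s IH] /= ks; have := ks.
rewrite (path_sortedE ord_lt_trans) => /andP[/allP k_lt s_sorted].
rewrite inE; case: (eqVneq i k) => [ik _|ik /= iS].
  subst k; rewrite !big_cons in_setU1 eqxx /=.
  have eT : \prod_(j <- s | j \in i |: T) x j = \prod_(j <- s | j \in T) x j.
    rewrite [LHS]big_seq_cond [RHS]big_seq_cond; apply: eq_bigl => j; rewrite in_setU1.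
    have [js|//] := boolP (j \in s); case: eqVneq => //= ji.
    by have := k_lt j js; rewrite ji /= ltnn.
  rewrite eT; case: ifP => iT.
    by rewrite mulrA xsq mul0r /ext_sign1 eqxx mul0r scale0r.
  rewrite [X in X *: _]big_seq_cond [X in X *: _]big1 ?scale1r // => j /andP[js jT].
  have lt_ij := k_lt j js; rewrite /= in lt_ij; rewrite /ext_sign1.
  case: eqVneq => [ij|_]; first by rewrite ij ltnn in lt_ij.
  by rewrite ltnNge (ltnW lt_ij).
have lt_ki := k_lt i iS; rewrite /= in lt_ki.
rewrite !big_cons in_setU1 (eq_sym k) (negPf ik) /=.
case: ifP => kT; last exact: IH.
rewrite mulrA; have /eqP := xac i k; rewrite addr_eq0 => /eqP->.
rewrite mulNr -mulrA IH // {2}/ext_sign1 (negPf ik) lt_ki expr1 mulN1r scaleNr.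
by rewrite scalerAr.
Qed.


Lemma ext_eval_mono (S T : {set 'I_n}) :
  (\prod_(i in S) x i) * (\prod_(i in T) x i) =
  ext_sign K S T *: \prod_(i in S :|: T) x i.
Proof.
have full_sorted : sorted ord_lt (index_enum 'I_n).
  have := iota_ltn_sorted 0 n; rewrite -val_enum_ord sorted_map enumT.
  by rewrite /index_enum unlock.
pose c s := \prod_(i <- s | i \in S) \prod_(j in T) ext_sign1 K i j.
suff gen s : sorted ord_lt s -> (\prod_(i <- s | i \in S) x i) * (\prod_(i in T) x i) =
    c s *: \prod_(i in [set i in s | i \in S] :|: T) x i.
  rewrite gen //; congr (_ *: _); apply: eq_bigl => i.
  by rewrite !inE mem_index_enum.
elim: s => [_|k s IH /=].
  rewrite /c !big_nil mul1r scale1r; apply: eq_bigl => i.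
  by rewrite !inE.
rewrite (path_sortedE ord_lt_trans) => /andP[/allP k_lt s_sorted].
rewrite /c !big_cons; case: ifP => kS; last first.
  rewrite IH //; congr (_ *: _); apply: eq_bigl => i; rewrite !inE.
  by case: eqVneq => // ->; rewrite kS andbF.
rewrite -mulrA IH // -scalerAr ext_eval_gen_mono ?mem_index_enum // scalerA.
rewrite -/(c s); set S' := [set i in s | i \in S].
rewrite (_ : \prod_(j in S' :|: T) _ = ext_sign K [set k] (S' :|: T)); last first.
  by rewrite /ext_sign big_set1.
rewrite (_ : \prod_(j in T) _ = ext_sign K [set k] T); last first.
  by rewrite /ext_sign big_set1.
have -> : \prod_(j in k |: (S' :|: T)) x j =
    \prod_(i in [set i in k :: s | i \in S] :|: T) x i.
  apply: eq_bigl => i; rewrite !inE; case: eqVneq => [->|//] /=.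
  by rewrite kS.
congr (_ *: _); have [d|] := eqVneq (S' :&: T) set0.
  rewrite ext_signUr // (_ : ext_sign K [set k] S' = 1) ?mul1r 1?mulrC //.
  rewrite /ext_sign big_set1 big1 // => j; rewrite inE => /andP[js _].
  have := k_lt j js; rewrite /= /ext_sign1 => lt_kj.
  case: eqVneq => [kj|_]; first by rewrite kj ltnn in lt_kj.
  by rewrite ltnNge (ltnW lt_kj).
case/set0Pn => i; rewrite !inE => /andP[/andP[i_s iS] iT].
suff -> : c s = 0 by rewrite mul0r mulr0.
rewrite /c (big_rem i) //= iS (bigD1 i) //= /ext_sign1 eqxx.
by rewrite !mul0r.
Qed.

Lemma ext_eval_gen i : ext_eval (ext_gen K i) = x i.
Proof.
rewrite /ext_eval (bigD1 [set i]) //= ffunE eqxx scale1r big_set1.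
by rewrite big1 ?addr0 // => S nS; rewrite ffunE (negPf nS) scale0r.
Qed.

Lemma ext_eval_is_monoid_morphism : monoid_morphism ext_eval.
Proof.
split.
  rewrite /ext_eval (bigD1 set0) //= ffunE eqxx scale1r big_set0.
  by rewrite big1 ?addr0 // => S nS; rewrite ffunE (negPf nS) scale0r.
move=> F G; rewrite /ext_eval mulr_suml.
under [RHS]eq_bigr => S _ do rewrite mulr_sumr.
under [LHS]eq_bigr => U _ do rewrite ext_mulE scaler_suml.
rewrite exchange_big /=; apply: eq_bigr => S _.
under eq_bigr => U _ do rewrite scaler_suml.
rewrite (exchange_big_dep xpredT) //=; apply: eq_bigr => T _.
rewrite (big_pred1 (S :|: T)); last by move=> U; rewrite /= eq_sym.
by rewrite -scalerAl -scalerAr ext_eval_mono !scalerA; congr (_ *: _); ring.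
Qed.
End Eval.

Definition ext_even (K : comNzRingType) n (F : extalg K n) : Prop :=
  forall S : {set 'I_n}, odd #|S| -> F S = 0.

From mathcomp Require Import complex.
From mathcomp Require Import all_classical all_reals all_analysis.
Import numFieldNormedType.Exports.
Local Open Scope classical_set_scope.

HB.mixin Record isHilbert (R : realType) H & CompleteNormedModule R[i] H := {
  ip : H -> H -> R[i];
  ip_scalar : forall f, scalar (ip f);
  ip_conj : forall f g, ip g f = (ip f g)^*;
  ip_norm : forall f, `|f| ^+ 2 = ip f f }.
#[short(type="hilbertType")]
HB.structure Definition Hilbert (R : realType) :=
  {H of isHilbert R H & CompleteNormedModule R[i] H}.

(* The norm is a field here, and the library's normed-module structure is
   derived from it below, because no structure can join GRing.Algebra and
   NormedModule. *)
HB.mixin Record isCStarAlgebra (R : realType) A & GRing.Algebra R[i] A := {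
  cnorm : A -> R[i];
  cnormD : forall a b, cnorm (a + b) <= cnorm a + cnorm b;
  cnormZ : forall (z : R[i]) a, cnorm (z *: a) = `|z| * cnorm a;
  cnorm0_eq0 : forall a, cnorm a = 0 -> a = 0;
  cnorm_complete : forall u : nat -> A,
    (forall e : R[i], 0 < e -> exists N : nat, forall m k : nat,
      (N <= m)%N -> (N <= k)%N -> cnorm (u m - u k) < e) ->
    exists a, forall e : R[i], 0 < e -> exists N : nat, forall m : nat,
      (N <= m)%N -> cnorm (a - u m) < e;
  cnormM : forall a b, cnorm (a * b) <= cnorm a * cnorm b;
  star : A -> A;
  starD : {morph star : a b / a + b};
  starZ : forall (z : R[i]) a, star (z *: a) = z^* *: star a;
  starM : forall a b, star (a * b) = star b * star a;
  starK : involutive star;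
  cnorm_star : forall a, cnorm (star a * a) = cnorm a ^+ 2 }.
#[short(type="cstarAlgType")]
HB.structure Definition CStarAlgebra (R : realType) :=
  {A of isCStarAlgebra R A & GRing.Algebra R[i] A}.

HB.instance Definition _ (R : realType) (A : cstarAlgType R) :=
  Lmodule_isNormed.Build R[i] (CStarAlgebra.sort A)
    (@cnormD R A) (@cnormZ R A) (@cnorm0_eq0 R A).

Section CStar.
Variables (R : realType) (A : cstarAlgType R).

Definition sub_cstar (B : set A) : Prop :=
  [/\ B 1, forall (z : R[i]) a b, B a -> B b -> B (z *: a + b),
      forall a b, B a -> B b -> B (a * b), forall a, B a -> B (star a)
    & closed B].

Definition cstar_generated (E : set A) : set A :=
  [set a | forall B, sub_cstar B -> E `<=` B -> B a].

Definition cstar_ge0 (a : A) : Prop := exists b : A, a = star b * b.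

Definition cstar_exp (a : A) : A :=
  limn (series (fun k => (k`!%:R : R[i])^-1 *: a ^+ k)).

(* An isometric unital representation, i.e. a realisation of A as a norm-closed
   self-adjoint algebra of bounded operators on H. *)
Record operator_rep (H : hilbertType R) := OperatorRep {
  rep :> A -> H -> H;
  rep_linear_op : forall x, linear (rep^~ x);
  rep_linear : forall a, linear (rep a);
  rep1 : forall x, rep 1 x = x;
  repM : forall a b x, rep (a * b) x = rep a (rep b x);
  rep_star : forall a x y, ip x (rep a y) = ip (rep (star a) x) y;
  rep_norm : forall (a : A) (c : R[i]), 0 <= c ->
    `|a| <= c <-> forall x, `|rep a x| <= c * `|x| }.

End CStar.

Record nc_prob_space (R : realType) := NCProbSpace {
  nc_hilbert : hilbertType R;
  nc_separable : exists2 D : set nc_hilbert, countable D & dense D;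
  nc_alg :> cstarAlgType R;
  nc_rep : operator_rep nc_alg nc_hilbert;
  nc_state : {scalar nc_alg};
  nc_state_ge0 : forall a, cstar_ge0 a -> 0 <= nc_state a;
  nc_state1 : nc_state 1 = 1 }.

Record fnps (R : realType) := FNPS {
  fnps_space :> nc_prob_space R;
  filt : R -> set fnps_space;
  filt_sub : forall t, 0 <= t -> sub_cstar (filt t);
  filt_mono : forall s t, 0 <= s <= t -> filt s `<=` filt t;
  cexp : R -> {linear fnps_space -> fnps_space};
  cexp_in : forall t a, 0 <= t -> filt t (cexp t a);
  cexp_ge0 : forall t a, 0 <= t -> cstar_ge0 a -> cstar_ge0 (cexp t a);
  cexp1 : forall t, 0 <= t -> cexp t 1 = 1;
  cexp_bimod : forall t a b c, 0 <= t -> filt t a -> filt t c ->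
    cexp t (a * b * c) = a * cexp t b * c;
  state_cexp : forall t a, 0 <= t ->
    nc_state fnps_space (cexp t a) = nc_state fnps_space a;
  cexp_tower : forall s t a, 0 <= s <= t -> cexp s (cexp t a) = cexp s a }.

Section Operators.
Variables (R : realType) (h : hilbertType R).

Definition conjugation (Theta : h -> h) : Prop :=
  [/\ forall (z : R[i]) f g, Theta (z *: f + g) = z^* *: Theta f + Theta g,
      forall f g, ip f g = ip (Theta g) (Theta f) & involutive Theta].

Definition theta_form (Theta : h -> h) (f g : h) : R[i] := ip (Theta f) g.

Definition adjoint_of (B C : h -> h) : Prop :=
  forall f g, ip (B f) g = ip f (C g).

Definition theta_antisym (Theta C : h -> h) : Prop :=
  exists2 B : {linear h -> h}, adjoint_of B C &
    forall f, Theta (B (Theta f)) = - C f.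

Definition unitary (U : h -> h) : Prop :=
  (forall f g, ip (U f) (U g) = ip f g) /\ (forall g, exists f, U f = g).

Definition orthonormal_basis n (v : 'I_n -> h) : Prop :=
  (forall i j, ip (v i) (v j) = (i == j)%:R) /\
  (forall f, f = \sum_i ip (v i) f *: v i).

(* In finite dimension this strong derivative is the derivative in operator
   norm; it is one-sided at r = 0. *)
Definition has_derivative (G : R -> h -> h) (C : h -> h) (r : R) : Prop :=
  forall f,
    (fun e : R => (e^-1)%:C%C *: (G (r + e) f - G r f)) @
      within [set e | 0 <= r + e] 0^' --> C f.

Definition is_decomposition (D C U : h -> h) : Prop :=
  unitary U /\
  exists2 B : {linear h -> h}, adjoint_of B C & forall f, D f = B (C (U f)).

End Operators.

Section Integral.
Variable R : realType.
Local Notation mu := (@lebesgue_measure R).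

Definition cintegrable (a b : R) (f : R -> R[i]) : Prop :=
  mu.-integrable `[a, b] (EFin \o (@complex.Re R \o f)) /\
  mu.-integrable `[a, b] (EFin \o (@complex.Im R \o f)).

Definition cintegral (a b : R) (f : R -> R[i]) : R[i] :=
  (Rintegral mu `[a, b] (@complex.Re R \o f) +i*
   Rintegral mu `[a, b] (@complex.Im R \o f))%C.

(* I is the Pettis (weak) integral of f over [a, b]. *)
Definition is_integral (E : normedModType R[i]) (a b : R) (f : R -> E) (I : E)
    : Prop :=
  forall phi : {scalar E}, continuous (phi : E -> R[i]^o) ->
    cintegrable a b (phi \o f) /\ phi I = cintegral a b (phi \o f).

End Integral.

(* Pfaffian of the matrix (c x_i x_j)_{i < j}, by expansion along the first
   entry of s; it vanishes when size s is odd. The argument k bounds size s. *)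
Fixpoint pfaffian_rec (K : comNzRingType) T (c : T -> T -> K) (k : nat)
    (s : seq T) : K :=
  match k, s with
  | _, [::] => 1
  | 0%N, _ :: _ => 0
  | k'.+1, x :: s' =>
      \sum_(j < size s') (-1) ^+ j * c x (nth x s' j) *
        pfaffian_rec c k' (take j s' ++ drop j.+1 s')
  end.
Definition pfaffian (K : comNzRingType) T (c : T -> T -> K) (s : seq T) : K :=
  pfaffian_rec c (size s) s.

Section Grassmann.
Variables (R : realType) (A : fnps R) (h : hilbertType R).
Local Notation omega := (nc_state A).

Definition compatible (psi phi : h -> A) : Prop :=
  forall f g, psi f * phi g + phi g * psi f = 0.

Definition grassmann_field (psi : {linear h -> A}) : Prop := compatible psi psi.

Definition grassmann_process (J : set R) (X : R -> {linear h -> A}) : Prop :=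
  (forall s, J s -> grassmann_field (X s)) /\
  (forall s t, J s -> J t -> compatible (X s) (X t)).

Definition adapted (J : set R) (X : R -> {linear h -> A}) : Prop :=
  forall s f, J s -> filt s (X s f).

Definition incr (X : R -> {linear h -> A}) (s t : R) (f : h) : A :=
  X t f - X s f.

Definition future (X : R -> {linear h -> A}) (t : R) : set A :=
  cstar_generated [set a | exists2 u, t < u & exists f, a = incr X t u f].

Record is_gbm (Theta : h -> h) (G : R -> {linear h -> h})
    (X : R -> {linear h -> A}) : Prop := IsGBM {
  gbm_antisym : forall t, 0 <= t -> theta_antisym Theta (G t);
  gbm_process : grassmann_process [set t | 0 <= t] X;
  gbm_adapted : adapted [set t | 0 <= t] X;
  gbm_gaussian : forall s : seq (R * h), (forall p, p \in s -> 0 <= p.1) ->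
    omega (\prod_(p <- s) X p.1 p.2) =
    pfaffian (fun p q => omega (X p.1 p.2 * X q.1 q.2)) s;
  gbm_cov : forall s t f g, 0 <= s -> 0 <= t ->
    omega (X t f * X s g) = theta_form Theta f (G (Num.min t s) g);
  gbm_indep : forall s t a1 a2, 0 <= s <= t -> filt t a1 -> future X t a2 ->
    [/\ cexp A s (a1 * a2) = cexp A s a1 * cexp A s a2,
        cexp A s (a2 * a1) = cexp A s a1 * cexp A s a2
      & cexp A s a1 * cexp A s a2 = cexp A s a2 * cexp A s a1];
  (* Independence of the increments after t from filt t, in the sense that
     conditioning them on filt t amounts to applying the state; together with
     gbm_gaussian it gives cexp s (incr X s t f) = 0 for s <= t. *)
  gbm_cexp_future : forall t a, 0 <= t -> future X t a ->
    cexp A t a = omega a *: 1 }.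

(* The integrability clause says that the integral in the bound is finite. *)
Definition norm_compatible (Theta : h -> h) (Gdot : R -> {linear h -> h})
    (X : R -> {linear h -> A}) : Prop :=
  forall C U : R -> {linear h -> h},
    (forall r, 0 <= r -> is_decomposition (Gdot r) (C r) (U r)) ->
    exists2 c : R, 0 < c & forall t f, 0 <= t ->
      let b r := `|C r (U r f)| ^+ 2 + `|C r (Theta f)| ^+ 2 in
      cintegrable 0 t b /\ `|X t f| ^+ 2 <= c%:C%C * cintegral 0 t b.

Section FBSDE.
Variables (n : nat) (v : 'I_n -> h).

(* F(psi), through the identification of the monomials in the generators with
   the basis v_{i_1} /\ ... /\ v_{i_k} of the exterior algebra of h *)
Definition grassmann_eval (F : extalg R[i] n) (psi : h -> A) : A :=
  ext_eval (psi \o v) F.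

Record fbsde_solution (Theta : h -> h) (Gdot : R -> {linear h -> h})
    (X : R -> {linear h -> A}) (V : extalg R[i] n) (t T : R)
    (Psi : R -> {linear h -> A}) : Prop := FBSDESolution {
  sol_process : grassmann_process `[t, T] Psi;
  sol_adapted : adapted `[t, T] Psi;
  sol_compatible : forall s r : R, t <= s <= T -> 0 <= r ->
    compatible (Psi s) (X r);
  sol_eq : forall (s : R) f, t <= s <= T ->
    exists2 I : 'I_n -> A,
      forall i, is_integral t s
        (fun r => theta_form Theta f (Gdot r (v i)) *:
           cexp A r (grassmann_eval (ext_deriv i V) (Psi T))) (I i)
    & Psi s f = \sum_i I i + incr X t s f }.

End FBSDE.
End Grassmann.

(* Main.v *)
From HB Require Import structures.
Require Import Defs.
From mathcomp Require Import all_boot all_order all_algebra ring lra.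
From mathcomp Require Import complex.
From mathcomp Require Import all_classical all_reals all_analysis measurable_realfun.
Set Implicit Arguments.
Unset Strict Implicit.
Unset Printing Implicit Defensive.
Import Order.TTheory GRing.Theory Num.Theory.
Import numFieldNormedType.Exports.
Local Open Scope ring_scope.


(** Why the theorem holds.

    Let E be the exponential of V without its scalar part; V minus its scalar part is
    nilpotent, so that E is a finite sum, and the exponential of the scalar part cancels
    in the quotient. For a covariance C let S_C be the heat operator
    exp (1/2 \sum_ij C_ij d_j d_i) of the exterior algebra. It computes Gaussian
    expectations: if x is a Gaussian increment in the future of s and y lies in its past,
    then omega_s (F (y + x)) = (S_C F) (y), with C the covariance of x (cexp_heat, by Wick's
    rule). Put Z_r = S_(r,T) E, the weight that remains at time r. The quotient in the
    theorem is then the scalar part of S_(t,s) (P Z_s) divided by that of Z_t, and what has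
    to be shown is that for u <= s
      omega_u (P (Psi_s)) = (S_(u,s) (P Z_s) / Z_u) (Psi_u)           (cexp_solution);
    at u = t the solution vanishes and scalar parts remain. In other words, the solution
    is the Gaussian process tilted by Z, a Doob transform.

    One recognises a Doob transform by its drift: the factor b_r = omega_r (dV (Psi_T)) of
    the equation has to be the logarithmic derivative of Z_r at Psi_r. Granting this up
    to an error eta, the increments of the solution over a short interval [u, w] are
    expanded to first order around Psi_u + X_(u,w); the outcome agrees with the tilted
    heat flow up to second order in the length e of the interval, plus e eta (one_step).
    Lengths are measured by a clock, the integral of the covariance rates, as these are
    only integrable. Summing over a partition whose mesh on the clock tends to zero leaves
    an error of order eta times the length of the interval (transport_error). This takes
    the place of Ito's formula.

    That b is the logarithmic derivative is clear at T, where no conditional expectation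
    is left, and is carried backwards. If it holds at s, transport_error applied to the
    logarithmic derivative of Z_s bounds the deviation of b on [u, s] by a constant times
    the length of [u, s] times the deviation itself, so that the deviation vanishes as
    soon as the interval is short (drift_matched_step). How short depends on a lower bound
    for the scalar part of Z_r. Such a bound is uniform: the inverse of Z_r (Psi_r) is
    omega_r (1/E (Psi_T)), whose norm is bounded because conditional expectations are
    contractions (rn_cexp), and an invertible element and its scalar part differ by a
    nilpotent (scalar_lower_bound). Finitely many steps reach t (drift_matched_all).

    The analysis behind this is the following. Norm compatibility, applied to polar
    decompositions of the derivative of the covariance, makes the covariance rates
    integrable and the process bounded (norm_compatible_bounds). The covariance, being
    differentiable everywhere with an integrable derivative, is then the integral of its
    rate (FTC_right_derivative). The integrals of the equation are weak ones and are
    estimated by their matrix coefficients (pettis_estimate). *)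


(** * The exterior algebra: derivatives, heat operator, inverses *)

Section ExtTheory.
Import mathcomp.boot.finset mathcomp.boot.fintype.
Variables (K : comNzRingType) (n : nat).
Implicit Types (F G H B : extalg K n) (S T : {set 'I_n}).
Local Notation sg := (@ext_sign K n).
Local Notation x_ := (ext_gen K).
Local Notation mono := (@ext_mono K n).

Lemma ext_sum_mono F : F = \sum_S F S *: mono S.
Proof.
apply/ffunP => U; rewrite sum_ffunE (bigD1 U) //= big1 ?addr0.
  by rewrite !ffunE eqxx /GRing.scale /= mulr1.
by move=> S nS; rewrite !ffunE eq_sym (negPf nS) /GRing.scale /= mulr0.
Qed.

Lemma ext_gen_mulD1 i S : i \in S ->
  mono S = sg [set i] (S :\ i) *: (x_ i * mono (S :\ i)).
Proof.
move=> iS; apply/ffunP => U; rewrite ffunE [RHS]ffunE ext_gen_mulE /GRing.scale /=.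
rewrite ffunE; have [eU|nU] := eqVneq U S.
  by rewrite eU iS eqxx mulr1 ext_sign_sqr ?setD11.
case: ifPn => iU; last by rewrite mulr0.
rewrite (_ : _ == _ = false) ?mulr0 //; apply/negbTE; apply: contra nU => /eqP e.
by rewrite -(setD1K iU) e setD1K.
Qed.

Lemma ext_deriv_mono j S :
  ext_deriv j (mono S) = (if j \in S then sg [set j] (S :\ j) else 0) *: mono (S :\ j).
Proof.
apply/ffunP => U; rewrite !ffunE /GRing.scale /=.
have [jU|jU] := boolP (j \in U).
  rewrite ext_sign_mem // mul0r (_ : U == _ = false) ?mulr0 //.
  by apply/negbTE; apply: contraTneq jU => ->; rewrite !inE eqxx.
case: ifPn => jS.
  have [->|nU] := eqVneq U (S :\ j); first by rewrite setD1K // eqxx.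
  rewrite (_ : _ == _ = false) ?mulr0 //; apply/negbTE; apply: contra nU => /eqP <-.
  by rewrite setU1K.
rewrite mul0r (_ : _ == _ = false) ?mulr0 //; apply/negbTE.
by apply: contra jS => /eqP <-; rewrite !inE eqxx.
Qed.

(** Every monomial is, up to sign, a product of generators, so that a property stable
    under linear combinations may be checked one generator at a time. *)
Lemma ext_ind (P : extalg K n -> Prop) :
  (forall a F G, P F -> P G -> P (a *: F + G)) -> P 1 ->
  (forall i F, P F -> P (x_ i * F)) -> forall F, P F.
Proof.
move=> Plin P1 Pgen.
have P0 : P 0 by have := Plin (-1) _ _ P1 P1; rewrite scaleN1r addNr.
have PZ a F : P F -> P (a *: F) by move=> PF; have := Plin a _ _ PF P0; rewrite addr0.
have PD F G : P F -> P G -> P (F + G).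
  by move=> PF PG; have := Plin 1 _ _ PF PG; rewrite scale1r.
have Pm m S : (#|S| <= m)%N -> P (mono S).
  elim: m S => [|m IH] S Sm.
    by move: Sm; rewrite leqn0 cards_eq0 => /eqP->.
  have [->//|/set0Pn[i iS]] := eqVneq S set0.
  rewrite (ext_gen_mulD1 iS); apply/PZ/Pgen/IH.
  by move: Sm; rewrite (cardsD1 i) iS.
move=> F; rewrite (ext_sum_mono F).
by elim/big_ind: _ => // S _; apply/PZ/(Pm #|S|).
Qed.

(** Induction on the degree: multiplication by generators produces all the monomials,
    and the derivatives in the rule lower the degree. The heat operator is recognised as
    a conditional expectation in this way. *)
Lemma ext_linear_uniq (W : lmodType K) (C : 'I_n -> 'I_n -> K) (y : 'I_n -> W -> W)
    (T1 T2 : extalg K n -> W) : linear T1 -> linear T2 -> T1 1 = T2 1 ->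
  (forall k F, T1 (x_ k * F) = y k (T1 F) + \sum_j C k j *: T1 (ext_deriv j F)) ->
  (forall k F, T2 (x_ k * F) = y k (T2 F) + \sum_j C k j *: T2 (ext_deriv j F)) ->
  T1 =1 T2.
Proof.
move=> l1 l2 e1 r1 r2.
have z1 : T1 0 = 0 by have := l1 (-1) 0 0; rewrite scaleN1r addNr => ->; rewrite scaleN1r addNr.
have z2 : T2 0 = 0 by have := l2 (-1) 0 0; rewrite scaleN1r addNr => ->; rewrite scaleN1r addNr.
have s1 a F : T1 (a *: F) = a *: T1 F by have := l1 a F 0; rewrite z1 !addr0.
have s2 a F : T2 (a *: F) = a *: T2 F by have := l2 a F 0; rewrite z2 !addr0.
have a1 F G : T1 (F + G) = T1 F + T1 G by have := l1 1 F G; rewrite !scale1r.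
have a2 F G : T2 (F + G) = T2 F + T2 G by have := l2 1 F G; rewrite !scale1r.
have Tm m S : (#|S| <= m)%N -> T1 (mono S) = T2 (mono S).
  elim: m S => [|m IH] S Sm.
    by move: Sm; rewrite leqn0 cards_eq0 => /eqP->.
  have [->//|/set0Pn[i iS]] := eqVneq S set0.
  rewrite (ext_gen_mulD1 iS) s1 s2 r1 r2.
  have le : (#|S :\ i| <= m)%N by move: Sm; rewrite (cardsD1 i) iS.
  rewrite IH //; congr (_ *: (_ + _)); apply: eq_bigr => j _.
  rewrite ext_deriv_mono s1 s2 IH //; apply: leq_trans le; apply: subset_leq_card.
  exact: subsetDl.
move=> F; rewrite (ext_sum_mono F).
apply: (big_ind (fun G => T1 G = T2 G)); first by rewrite z1 z2.
  by move=> G H eG eH; rewrite a1 a2 eG eH.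
by move=> S _; rewrite s1 s2 (Tm #|S|).
Qed.

(** The parity automorphism. Evenness is used in the form ext_par F = F, which is stable
    under the algebraic operations. *)
Definition ext_par F : extalg K n := [ffun S : {set 'I_n} => (-1) ^+ #|S| * F S].

Lemma ext_par_is_linear : linear ext_par.
Proof.
by move=> a F G; apply/ffunP => S; rewrite !ffunE /GRing.scale /=; ring.
Qed.
HB.instance Definition _ := GRing.isLinear.Build K (extalg K n) (extalg K n)
  *:%R ext_par ext_par_is_linear.

Lemma ext_par1 : ext_par 1 = 1.
Proof.
apply/ffunP => S; rewrite !ffunE; case: eqVneq => [->|_]; last by rewrite mulr0.
by rewrite cards0 expr0 mulr1.
Qed.

Lemma ext_par_gen i F : ext_par (x_ i * F) = - (x_ i * ext_par F).
Proof.
apply/ffunP => S; rewrite [LHS]ffunE [RHS]ffunE !ext_gen_mulE.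
case: ifPn => iS; last by rewrite mulr0 oppr0.
by rewrite ffunE (cardsD1 i S) iS exprS; ring.
Qed.

Lemma ext_par_geni i : ext_par (x_ i) = - x_ i.
Proof. by have := ext_par_gen i 1; rewrite ext_par1 !mulr1. Qed.

Lemma ext_parM F G : ext_par (F * G) = ext_par F * ext_par G.
Proof.
move: F; apply: ext_ind => [a F H eF eH||i F eF].
- by rewrite mulrDl -scalerAl !linearP /= eF eH mulrDl -scalerAl.
- by rewrite ext_par1 !mul1r.
- by rewrite -mulrA !ext_par_gen eF mulNr mulrA.
Qed.

Lemma ext_parK F : ext_par (ext_par F) = F.
Proof. by apply/ffunP => S; rewrite !ffunE mulrA -expr2 sqrr_sign mul1r. Qed.

Lemma ext_gen_anti i j : x_ i * x_ j = - (x_ j * x_ i) :> extalg K n.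
Proof. by apply/eqP; rewrite -addr_eq0 ext_gen_anticomm. Qed.

Lemma ext_mul_gen F i : F * x_ i = x_ i * ext_par F.
Proof.
move: F; apply: ext_ind => [a F H eF eH||j F eF].
- by rewrite mulrDl -scalerAl eF eH linearP /= mulrDr -scalerAr.
- by rewrite ext_par1 mul1r mulr1.
- by rewrite ext_par_gen -mulrA eF mulrA ext_gen_anti mulrN mulNr mulrA.
Qed.

Lemma ext_deriv_genM i j F :
  ext_deriv j (x_ i * F) = (i == j)%:R *: F - x_ i * ext_deriv j F.
Proof. by rewrite -ext_deriv_gen addrK. Qed.

Lemma ext_deriv_par j F : ext_deriv j (ext_par F) = - ext_par (ext_deriv j F).
Proof.
apply/ffunP => S; rewrite !ffunE; have [jS|jS] := boolP (j \in S).
  by rewrite ext_sign_mem // !mul0r mulr0 oppr0.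
by rewrite cardsU1 jS /= add1n exprS; ring.
Qed.

Lemma ext_derivM j F G :
  ext_deriv j (F * G) = ext_deriv j F * G + ext_par F * ext_deriv j G.
Proof.
move: F; apply: ext_ind => [a F H eF eH||i F eF].
- rewrite mulrDl -scalerAl linearP /= eF eH !linearP /= !mulrDl -!scalerAl scalerDr.
  by rewrite addrACA.
- by rewrite mul1r ext_deriv1 mul0r add0r ext_par1 mul1r.
- rewrite -mulrA ext_deriv_genM eF ext_deriv_genM ext_par_gen mulrBl -scalerAl.
  by rewrite mulrDr opprD mulNr addrA !mulrA.
Qed.

Lemma ext_derivZ j (a : K) F : ext_deriv j (a *: F) = a *: ext_deriv j F.
Proof. exact: linearZ. Qed.

Lemma ext_derivC i j F : ext_deriv i (ext_deriv j F) = - ext_deriv j (ext_deriv i F).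
Proof.
move: F; apply: ext_ind => [a F H eF eH||k F eF].
- by rewrite !linearP /= eF eH.
- by rewrite !ext_deriv1 !linear0.
- rewrite !ext_deriv_genM !raddfB /= !linearZ /= !ext_deriv_genM eF mulrN.
  by rewrite scalerN !opprK opprD addrCA.
Qed.

Lemma ext_even_par F : ext_even F -> ext_par F = F.
Proof.
move=> eF; apply/ffunP => S; rewrite !ffunE -signr_odd.
by case: (boolP (odd #|S|)) => [/eF->|_]; rewrite ?mulr0 // expr0 mul1r.
Qed.

Lemma ext_evenC B F : ext_par B = B -> F * B = B * F.
Proof.
move=> eB; move: F; apply: ext_ind => [a F H eF eH||i F eF].
- by rewrite mulrDl mulrDr -scalerAl -scalerAr eF eH.
- by rewrite mul1r mulr1.
- by rewrite -mulrA eF !mulrA ext_mul_gen eB.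
Qed.

Lemma ext_oddC B F : ext_par B = - B -> F * B = B * ext_par F.
Proof.
move=> oB; move: F; apply: ext_ind => [a F H eF eH||i F eF].
- by rewrite mulrDl linearP /= mulrDr -scalerAl -scalerAr eF eH.
- by rewrite ext_par1 mul1r mulr1.
- by rewrite -mulrA eF ext_par_gen mulrN !mulrA (ext_mul_gen B) oB mulrN mulNr opprK.
Qed.

Lemma ext_even_deriv j B : ext_par B = B -> ext_par (ext_deriv j B) = - ext_deriv j B.
Proof. by move=> eB; rewrite -[in RHS]eB ext_deriv_par opprK. Qed.

Lemma ext_derivM_even j F B : ext_par B = B ->
  ext_deriv j (F * B) = ext_deriv j F * B + ext_deriv j B * F.
Proof.
move=> eB; rewrite ext_derivM; congr (_ + _).
by rewrite ext_oddC ?ext_even_deriv // ext_parK.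
Qed.

Lemma ext_deriv_oddM j A F : ext_par A = - A ->
  ext_deriv j (A * F) = ext_deriv j A * F - A * ext_deriv j F.
Proof. by move=> oA; rewrite ext_derivM oA mulNr. Qed.

Definition ext_deg_le m F := forall S, (m < #|S|)%N -> F S = 0.

Lemma ext_deg_le_card F : ext_deg_le n F.
Proof.
by move=> S; rewrite ltnNge -[X in (_ <= X)%N]card_ord max_card.
Qed.

Lemma ext_deg_le_deriv m j F : ext_deg_le m F -> ext_deg_le m.-1 (ext_deriv j F).
Proof.
move=> dF S mS; rewrite ffunE; have [jS|jS] := boolP (j \in S).
  by rewrite ext_sign_mem // mul0r.
rewrite dF ?mulr0 // cardsU1 jS; case: (m) mS => [|m'] /=; rewrite ?add1n //.
Qed.

Lemma ext_deriv_deg0 j F : ext_deg_le 0 F -> ext_deriv j F = 0.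
Proof.
move=> dF; apply/ffunP => S; rewrite !ffunE dF ?mulr0 // cardsU1.
by have [jS|//] := boolP (j \in S); rewrite lt0n cards_eq0; apply/set0Pn; exists j.
Qed.

Definition ext_ord_ge m F := forall S, (#|S| < m)%N -> F S = 0.

Lemma ext_ord_geM m k F G : ext_ord_ge m F -> ext_ord_ge k G -> ext_ord_ge (m + k) (F * G).
Proof.
move=> oF oG U; rewrite ext_mulE => cU; rewrite big1 // => S _; rewrite big1 // => T /eqP eU.
have [d|nd] := eqVneq (S :&: T) set0; last by rewrite ext_sign_inter // !mul0r.
have : (#|S| + #|T| < m + k)%N.
  by rewrite -cardsUI d cards0 addn0 eU.
case: (ltnP #|S| m) => [Sm _|mS]; first by rewrite oF // mulr0 mul0r.
by move=> ST; rewrite oG ?mulr0 // -(ltn_add2l m) (leq_ltn_trans _ ST) // leq_add2r.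
Qed.

Lemma ext_ord_geX F m : ext_ord_ge 1 F -> ext_ord_ge m (F ^+ m).
Proof.
move=> oF; elim: m => [|m IH]; first by move=> S; rewrite ltn0.
by rewrite exprS -add1n; exact: ext_ord_geM.
Qed.

(** Each factor without scalar part raises the lowest degree by one, and no degree
    exceeds n. *)
Lemma ext_nilp F : F set0 = 0 -> F ^+ n.+1 = 0.
Proof.
move=> F0; apply/ffunP => S; rewrite ffunE; apply: (@ext_ord_geX F n.+1).
  by move=> U; rewrite ltnS leqn0 cards_eq0 => /eqP->.
by rewrite ltnS -[X in (_ <= X)%N]card_ord max_card.
Qed.

Lemma ext_mul0E F G : (F * G) set0 = F set0 * G set0.
Proof.
rewrite ext_mulE (bigD1 set0) //= (bigD1 set0) ?setU0 //= ext_sign0l mul1r.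
rewrite !big1 ?addr0 // => [S nS|T /andP[/eqP eT nT]].
  rewrite big1 // => T /eqP eT; have : S \subset set0 by rewrite -eT subsetUl.
  by rewrite subset0 (negPf nS).
by rewrite -eT set0U eqxx in nT.
Qed.

End ExtTheory.

Section ExtHeat.
Import mathcomp.boot.finset mathcomp.boot.fintype.
Variables (K : numFieldType) (n : nat).
Implicit Types (F G H B : extalg K n) (C : 'I_n -> 'I_n -> K).
Local Notation x_ := (ext_gen K).

Definition antisym C := forall i j, C i j = - C j i.

Definition ext_grad C k F : extalg K n := \sum_j C k j *: ext_deriv j F.
(** For an antisymmetric C each pair of indices occurs twice in the sum, as the
    derivatives anticommute; whence the factor one half. *)
Definition ext_lap C F : extalg K n :=
  2^-1 *: \sum_i \sum_j C i j *: ext_deriv j (ext_deriv i F).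

Lemma ext_grad_is_linear C k : linear (ext_grad C k).
Proof.
move=> a F G; rewrite /ext_grad scaler_sumr -big_split; apply: eq_bigr => j _.
by rewrite linearP /= scalerDr !scalerA mulrC.
Qed.
HB.instance Definition _ C k := GRing.isLinear.Build K (extalg K n) (extalg K n)
  *:%R (ext_grad C k) (ext_grad_is_linear C k).

Lemma ext_lap_is_linear C : linear (ext_lap C).
Proof.
move=> a F G; rewrite /ext_lap scalerA mulrC -scalerA -scalerDr; congr (_ *: _).
rewrite scaler_sumr -big_split; apply: eq_bigr => i _.
rewrite scaler_sumr -big_split; apply: eq_bigr => j _.
by rewrite !linearP.
Qed.
HB.instance Definition _ C := GRing.isLinear.Build K (extalg K n) (extalg K n)
  *:%R (ext_lap C) (ext_lap_is_linear C).

Lemma ext_grad_gen C k i F :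
  ext_grad C k (x_ i * F) = C k i *: F - x_ i * ext_grad C k F.
Proof.
rewrite /ext_grad mulr_sumr -sumrN.
under eq_bigr => j _ do rewrite ext_deriv_genM scalerBr scalerA scalerAr.
rewrite big_split /= (bigD1 i) //= eqxx mulr1 big1 ?addr0 // => j ji.
by rewrite eq_sym (negPf ji) mulr0 scale0r.
Qed.

Lemma ext_grad_mul_gen C k F i :
  ext_grad C k (F * x_ i) = ext_grad C k F * x_ i + C k i *: ext_par F.
Proof.
have dg j : ext_deriv j (x_ i) = (i == j)%:R *: 1.
  have := ext_deriv_genM i j (1 : extalg K n); rewrite ext_deriv1.
  by rewrite mulr1 mulr0 subr0.
rewrite /ext_grad mulr_suml.
have term j : C k j *: ext_deriv j (F * x_ i) =
    C k j *: ext_deriv j F * x_ i + (C k j * (i == j)%:R) *: ext_par F.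
  by rewrite ext_derivM dg scalerDr -scalerAr mulr1 scalerA scalerAl.
under eq_bigr => j _ do rewrite term.
rewrite big_split /=; congr (_ + _); rewrite (bigD1 i) //= eqxx mulr1 big1 ?addr0 // => j ji.
by rewrite eq_sym (negPf ji) mulr0 scale0r.
Qed.

Lemma ext_grad_par C k F : ext_grad C k (ext_par F) = - ext_par (ext_grad C k F).
Proof.
rewrite /ext_grad [ext_par (\sum_ _ _)]linear_sum -sumrN; apply: eq_bigr => j _.
by rewrite ext_deriv_par scalerN; congr (- _); rewrite linearZ.
Qed.

Lemma ext_lap_deriv C k F : ext_deriv k (ext_lap C F) = ext_lap C (ext_deriv k F).
Proof.
rewrite /ext_lap linearZ linear_sum /=; congr (_ *: _); apply: eq_bigr => i _.
rewrite linear_sum; apply: eq_bigr => j _; rewrite linearZ /=; congr (_ *: _).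
by rewrite ext_derivC (ext_derivC k i) linearN opprK.
Qed.

Lemma ext_lap_grad C D k F : ext_grad D k (ext_lap C F) = ext_lap C (ext_grad D k F).
Proof.
rewrite /ext_grad linear_sum; apply: eq_bigr => j _.
by rewrite ext_lap_deriv [RHS]linearZ.
Qed.

(** The commutator of a second-order operator with a generator is of first order. *)
Lemma ext_lap_gen C k F : antisym C ->
  ext_lap C (x_ k * F) = x_ k * ext_lap C F + ext_grad C k F.
Proof.
move=> aC; have half : 2^-1 + 2^-1 = 1 :> K by rewrite [RHS]splitr div1r.
have row i : \sum_j C i j *: ext_deriv j (ext_deriv i (x_ k * F)) =
    x_ k * (\sum_j C i j *: ext_deriv j (ext_deriv i F)) +
    ((k == i)%:R *: ext_grad C i F - C i k *: ext_deriv i F).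
  rewrite mulr_sumr /ext_grad scaler_sumr.
  transitivity (\sum_j (C i j *: (x_ k * ext_deriv j (ext_deriv i F)) +
      ((k == i)%:R *: (C i j *: ext_deriv j F) -
       (k == j)%:R *: (C i j *: ext_deriv i F)))).
    apply: eq_bigr => j _; rewrite ext_deriv_genM raddfB /= ext_derivZ ext_deriv_genM.
    by rewrite opprB addrCA !scalerDr !scalerN !scalerA ![C i j * _]mulrC.
  rewrite !big_split /= sumrN; congr (_ + (_ - _)).
    by apply: eq_bigr => j _; rewrite scalerAr.
  rewrite (bigD1 k) //= eqxx scale1r big1 ?addr0 // => j jk.
  by rewrite eq_sym (negPf jk) scale0r.
rewrite /ext_lap; under eq_bigr => i _ do rewrite row.
rewrite !big_split /= !scalerDr -mulr_sumr scalerAr; congr (_ + _).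
rewrite (bigD1 k) //= eqxx scale1r big1 ?addr0 => [|i ik]; last first.
  by rewrite eq_sym (negPf ik) scale0r.
rewrite (_ : \sum_i - _ = ext_grad C k F).
  by rewrite -scalerDl half scale1r.
by apply: eq_bigr => i _; rewrite aC scaleNr opprK.
Qed.

(** The two kinds of cross terms in the Leibniz rule agree by antisymmetry of C, which
    uses up the factor one half. *)
Lemma ext_lap_mul_even C F B : antisym C -> ext_par B = B ->
  ext_lap C (F * B) = ext_lap C F * B + F * ext_lap C B +
    \sum_i \sum_j C i j *: (ext_deriv j B * ext_deriv i F).
Proof.
move=> aC eB; have half : 2^-1 + 2^-1 = 1 :> K by rewrite [RHS]splitr div1r.
pose Q := \sum_i \sum_j C i j *: (ext_deriv j B * ext_deriv i F).
have eQ : Q = \sum_i \sum_j - (C i j *: (ext_deriv i B * ext_deriv j F)).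
  rewrite /Q exchange_big /=; apply: eq_bigr => i _; apply: eq_bigr => j _.
  by rewrite aC scaleNr.
have row i j : C i j *: ext_deriv j (ext_deriv i (F * B)) =
    C i j *: ext_deriv j (ext_deriv i F) * B +
    C i j *: (ext_deriv j (ext_deriv i B)) * F +
    (C i j *: (ext_deriv j B * ext_deriv i F) - C i j *: (ext_deriv i B * ext_deriv j F)).
  rewrite ext_derivM_even // linearD /= ext_derivM_even // ext_deriv_oddM ?ext_even_deriv //.
  by rewrite addrACA !scalerDr scalerN -!scalerAl.
rewrite /ext_lap; under eq_bigr => i _ do under eq_bigr => j _ do rewrite row.
under eq_bigr => i _ do rewrite !big_split /=.
rewrite !big_split /= -eQ -/Q [in LHS]scalerDr [in LHS]scalerDr.
rewrite [2^-1 *: (Q + Q)]scalerDr -scalerDl half scale1r; congr (_ + _ + _).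
  by rewrite -scalerAl mulr_suml; congr (_ *: _); apply: eq_bigr => i _; rewrite mulr_suml.
rewrite -scalerAr; congr (_ *: _).
have eL : ext_par (\sum_i \sum_j C i j *: ext_deriv j (ext_deriv i B)) =
    \sum_i \sum_j C i j *: ext_deriv j (ext_deriv i B).
  rewrite linear_sum; apply: eq_bigr => i _; rewrite linear_sum; apply: eq_bigr => j _.
  rewrite linearZ /=; congr (_ *: _).
  by rewrite -[LHS]opprK -ext_deriv_par ext_even_deriv // linearN opprK.
rewrite (ext_evenC _ eL) mulr_suml; apply: eq_bigr => i _.
by rewrite mulr_suml.
Qed.

Lemma ext_lap_par C F : ext_par (ext_lap C F) = ext_lap C (ext_par F).
Proof.
rewrite /ext_lap linearZ linear_sum /=; congr (_ *: _); apply: eq_bigr => i _.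
rewrite linear_sum; apply: eq_bigr => j _; rewrite linearZ /=; congr (_ *: _).
by rewrite ext_deriv_par linearN /= ext_deriv_par opprK.
Qed.

Lemma ext_lap_deg C m F : ext_deg_le m F -> ext_deg_le m.-1 (ext_lap C F).
Proof.
move=> dF S mS; rewrite /ext_lap ffunE sum_ffunE big1 ?scaler0 // => i _.
rewrite sum_ffunE big1 // => j _; rewrite ffunE ext_derivC ffunE.
have := ext_deg_le_deriv i (ext_deg_le_deriv j dF).
case: m dF mS => [|[|m]] dF mS => dd; last by rewrite dd ?oppr0 ?scaler0 // ltnW.
  by rewrite dd ?oppr0 ?scaler0.
by rewrite dd ?oppr0 ?scaler0.
Qed.

Lemma ext_lap_deg0 C F : ext_deg_le 0 F -> ext_lap C F = 0.
Proof.
move=> dF; rewrite /ext_lap big1 ?scaler0 // => i _; rewrite big1 // => j _.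
by rewrite (ext_deriv_deg0 i dF) linear0 scaler0.
Qed.

Lemma ext_lap_iter_deg C F : ext_deg_le 0 (iter n (ext_lap C) F).
Proof.
suff dk k : ext_deg_le (n - k) (iter k (ext_lap C) F) by rewrite -(subnn n); exact: dk.
elim: k => [|k IH]; first by rewrite subn0; exact: ext_deg_le_card.
by rewrite iterS subnS; exact: ext_lap_deg.
Qed.

(** The exponential of the Laplacian, a finite sum since each Laplacian lowers the
    degree. It is convolution with the centred Gaussian of covariance C. *)
Definition ext_heat C F : extalg K n :=
  \sum_(k < n.+1) (k`!%:R)^-1 *: iter k (ext_lap C) F.

Lemma iter_lap_is_linear C k : linear (iter k (ext_lap C)).
Proof.
move=> a F G; elim: k => //= k ->; by rewrite linearP.
Qed.

Lemma ext_heat_is_linear C : linear (ext_heat C).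
Proof.
move=> a F G; rewrite /ext_heat scaler_sumr -big_split; apply: eq_bigr => k _.
by rewrite iter_lap_is_linear scalerDr !scalerA mulrC.
Qed.
HB.instance Definition _ C := GRing.isLinear.Build K (extalg K n) (extalg K n)
  *:%R (ext_heat C) (ext_heat_is_linear C).

Lemma ext_heatE C F : ext_heat C F =
  F + \sum_(k < n) (k.+1`!%:R)^-1 *: iter k.+1 (ext_lap C) F.
Proof. by rewrite /ext_heat big_ord_recl /= fact0 invr1 scale1r. Qed.

Lemma ext_lap1 C : ext_lap C 1 = 0.
Proof.
by rewrite /ext_lap big1 ?scaler0 // => i _; rewrite big1 // => j _; rewrite ext_deriv1 linear0 scaler0.
Qed.

Lemma ext_heat1 C : ext_heat C 1 = 1.
Proof.
rewrite ext_heatE big1 ?addr0 // => k _; rewrite iterSr ext_lap1.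
have -> : iter k (ext_lap C) 0 = 0 by elim: (nat_of_ord k) => //= m ->; rewrite linear0.
by rewrite scaler0.
Qed.

Lemma ext_heat_deriv C k F : ext_deriv k (ext_heat C F) = ext_heat C (ext_deriv k F).
Proof.
rewrite /ext_heat linear_sum; apply: eq_bigr => m _; rewrite linearZ /=; congr (_ *: _).
by elim: (nat_of_ord m) => //= l IH; rewrite ext_lap_deriv IH.
Qed.

Lemma ext_heat_par C F : ext_par (ext_heat C F) = ext_heat C (ext_par F).
Proof.
rewrite /ext_heat linear_sum; apply: eq_bigr => m _; rewrite linearZ /=; congr (_ *: _).
by elim: (nat_of_ord m) => //= l IH; rewrite ext_lap_par IH.
Qed.

Lemma ext_heat_grad C D k F : ext_grad D k (ext_heat C F) = ext_heat C (ext_grad D k F).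
Proof.
rewrite /ext_grad linear_sum; apply: eq_bigr => j _.
by rewrite ext_heat_deriv [RHS]linearZ.
Qed.

(** The commutator of the Laplacian with a generator is a gradient, which commutes with
    the Laplacian; so the commutator with the k-th term of the series is the gradient
    applied to the preceding term. *)
Lemma ext_heat_gen C k F : antisym C ->
  ext_heat C (x_ k * F) = x_ k * ext_heat C F + ext_grad C k (ext_heat C F).
Proof.
move=> aC.
have it m : iter m (ext_lap C) (x_ k * F) = x_ k * iter m (ext_lap C) F +
    m%:R *: ext_grad C k (iter m.-1 (ext_lap C) F).
  elim: m => [|m IH]; first by rewrite scale0r addr0.
  rewrite iterS IH linearD linearZ /= ext_lap_gen // -ext_lap_grad -addrA; congr (_ + _).
  case: m {IH} => [|m] /=; first by rewrite scale0r addr0 scale1r.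
  by rewrite -{1}[ext_grad _ _ _]scale1r -scalerDl -mulrS.
rewrite /ext_heat; under eq_bigr => m _ do rewrite it scalerDr.
rewrite big_split /=; congr (_ + _).
  by rewrite mulr_sumr; apply: eq_bigr => m _; rewrite scalerAr.
rewrite big_ord_recl /= scale0r scaler0 add0r linear_sum [RHS]big_ord_recr /=.
have z : ext_grad C k ((n`!%:R)^-1 *: iter n (ext_lap C) F) = 0.
  rewrite linearZ /= /ext_grad big1 ?scaler0 // => j _.
  by rewrite (ext_deriv_deg0 j (ext_lap_iter_deg C F)) scaler0.
rewrite z addr0; apply: eq_bigr => m _.
rewrite [RHS]linearZ /= scalerA factS natrM invfM mulrC mulrA divff ?mul1r //.
by rewrite pnatr_eq0.
Qed.

Lemma ext_heat_even C B : ext_par B = B -> ext_par (ext_heat C B) = ext_heat C B.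
Proof. by move=> eB; rewrite ext_heat_par eB. Qed.

(** Sums of independent Gaussians have the sum of the covariances. Algebraically, both
    sides obey the rule ext_heat_gen for the covariance C + D. *)
Lemma ext_heat_comp C D F : antisym C -> antisym D ->
  ext_heat C (ext_heat D F) = ext_heat (fun i j => C i j + D i j) F.
Proof.
move=> aC aD; pose CD i j := C i j + D i j.
have aCD : antisym CD by move=> i j; rewrite /CD aC aD opprD.
move: F; apply: (@ext_linear_uniq _ _ _ CD (fun k F => ext_gen K k * F)).
- by move=> a F G; rewrite !linearP.
- by move=> a F G; rewrite linearP.
- by rewrite !ext_heat1.
- move=> k F; rewrite ext_heat_gen // linearD /= ext_heat_gen // -addrA; congr (_ + _).
  rewrite -!ext_heat_grad /ext_grad -big_split; apply: eq_bigr => j _ /=.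
  by rewrite -scalerDl !ext_heat_deriv.
- move=> k F; rewrite ext_heat_gen //; congr (_ + _); apply: eq_bigr => j _.
  by rewrite ext_heat_deriv.
Qed.

Lemma ext_heat0 F : ext_heat (fun _ _ => 0) F = F.
Proof.
rewrite ext_heatE big1 ?addr0 // => k _; rewrite iterS /ext_lap.
rewrite big1 ?scaler0 // => i _; rewrite big1 // => j _; rewrite scale0r //.
Qed.

End ExtHeat.

Section ExtInv.
Import mathcomp.boot.finset mathcomp.boot.fintype.
Variables (K : numFieldType) (n : nat).
Implicit Types (F G B : extalg K n).

Lemma ext_scalar0E (a : K) : (a%:A : extalg K n) set0 = a.
Proof. by rewrite ffunE /GRing.scale /= ffunE eqxx mulr1. Qed.

(** Neumann series of the nilpotent part of B. *)
Definition ext_inv B : extalg K n :=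
  (B set0)^-1 *: \sum_(k < n.+1) (1 - (B set0)^-1 *: B) ^+ k.

Lemma ext_mulVr B : B set0 != 0 -> B * ext_inv B = 1.
Proof.
move=> B0; pose m := 1 - (B set0)^-1 *: B : extalg K n.
have eB : B = B set0 *: (1 - m) by rewrite /m opprB addrC subrK scalerA divff ?scale1r.
have m0 : m set0 = 0.
  by rewrite /m !ffunE /GRing.scale /= eqxx mulVf // subrr.
rewrite /ext_inv -/m {1}eB -scalerAl -scalerAr scalerA divff // scale1r.
by rewrite -[1 - m]opprB mulNr -subrX1 ext_nilp // sub0r opprK.
Qed.
Lemma ext_sub_scalar F : (F - (F set0)%:A) set0 = 0.
Proof. by have := ext_scalar0E (F set0); move: (_%:A) => c e; rewrite !ffunE e subrr. Qed.

Lemma ext_scalarB F G : (F - G) set0 = F set0 - G set0.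
Proof. by rewrite !ffunE. Qed.

Lemma ext_inv_scalar F : F set0 != 0 -> ext_inv F set0 = (F set0)^-1.
Proof.
move=> F0; have e1 := ext_mul0E F (ext_inv F).
rewrite ext_mulVr // in e1; have := ext_scalar0E (1 : K); rewrite scale1r => e2.
by apply: (mulfI F0); rewrite mulfV // -e1 e2.
Qed.
End ExtInv.

(** * Exponentials, and evaluation at anticommuting elements *)

Section ExtInv2.
Import mathcomp.boot.finset mathcomp.boot.fintype.
Variables (K : numFieldType) (n : nat).
Implicit Types (F G B : extalg K n).

Lemma ext_parX F k : ext_par (F ^+ k) = ext_par F ^+ k.
Proof. by elim: k => [|k IH]; rewrite ?ext_par1 // !exprS ext_parM IH. Qed.

(** The exponential series of an element without scalar part. Its last term vanishes by
    nilpotency, and is there for the derivative of the sum to be the derivative of F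
    times the same sum. *)
Definition ext_exp F : extalg K n := \sum_(k < n.+2) (k`!%:R)^-1 *: F ^+ k.

Lemma ext_exp_even F : ext_par F = F -> ext_par (ext_exp F) = ext_exp F.
Proof.
move=> eF; rewrite /ext_exp linear_sum /=; apply: eq_bigr => k _.
by rewrite linearZ /= ext_parX eF.
Qed.

Lemma ext_exp_scalar F : F set0 = 0 -> ext_exp F set0 = 1.
Proof.
move=> F0; rewrite /ext_exp big_ord_recl /= fact0 invr1 scale1r expr0 ffunE sum_ffunE.
rewrite ffunE eqxx big1 ?addr0 // => k _.
by rewrite ffunE exprS ext_mul0E F0 mul0r scaler0.
Qed.

Lemma ext_deriv_exp F j : ext_par F = F -> F set0 = 0 ->
  ext_deriv j (ext_exp F) = ext_deriv j F * ext_exp F.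
Proof.
move=> eF F0.
have dX k : ext_deriv j (F ^+ k) = k%:R *: (ext_deriv j F * F ^+ k.-1).
  elim: k => [|k IH]; first by rewrite expr0 ext_deriv1 scale0r.
  rewrite exprS ext_derivM_even; last by rewrite ext_parX eF.
  rewrite IH -scalerAl -mulrA -exprSr.
  case: k {IH} => [|k] /=; first by rewrite scale0r addr0 scale1r.
  by rewrite -{1}[ext_deriv j F * _]scale1r -scalerDl -mulrS.
rewrite /ext_exp linear_sum mulr_sumr big_ord_recl /= fact0 invr1 scale1r.
rewrite expr0 ext_deriv1 add0r [RHS]big_ord_recr /= ext_nilp // scaler0 mulr0 addr0.
apply: eq_bigr => k _; rewrite ext_derivZ dX scalerA -scalerAr.
rewrite factS natrM invfM mulrC mulrA divff ?mul1r // pnatr_eq0 //.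
Qed.

End ExtInv2.

Section EvalTheory.
Import mathcomp.boot.finset mathcomp.boot.fintype.
Variables (K : numFieldType) (n : nat) (A : algType K).
Implicit Types (F G B : extalg K n) (x y : 'I_n -> A).

Lemma ext_eval_is_linear x : linear (ext_eval x).
Proof.
move=> a F G; rewrite /ext_eval scaler_sumr -big_split; apply: eq_bigr => S _.
by rewrite !ffunE scalerDl scalerA.
Qed.
HB.instance Definition _ x := GRing.isLinear.Build K (extalg K n) A
  *:%R (ext_eval x) (ext_eval_is_linear x).

Definition anticomm x := forall i j, x i * x j + x j * x i = 0.

Lemma anticomm_sqr x i : anticomm x -> x i * x i = 0.
Proof.
move=> /(_ i i) e; apply: (@scalerI _ _ (2 : K)); first by rewrite pnatr_eq0.
by rewrite scaler0 scaler_nat mulr2n.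
Qed.

Lemma anticommD x y : anticomm y -> anticomm x ->
  (forall i j, y i * x j + x j * y i = 0) -> anticomm (fun i => y i + x i).
Proof.
move=> ay ax yx i j; rewrite !mulrDl !mulrDr addrACA [X in X + _]addrACA ay add0r.
by rewrite [X in _ + X]addrACA ax addr0 [x i * _ + _]addrC addrACA !yx addr0.
Qed.

Lemma ext_evalM x F G : anticomm x ->
  ext_eval x (F * G) = ext_eval x F * ext_eval x G.
Proof.
move=> ax; have sq i := anticomm_sqr i ax.
by case: (ext_eval_is_monoid_morphism sq ax).
Qed.

Lemma ext_eval1 x : ext_eval x 1 = 1.
Proof.
rewrite /ext_eval (bigD1 set0) //= ffunE eqxx scale1r big_set0.
by rewrite big1 ?addr0 // => S nS; rewrite ffunE (negPf nS) scale0r.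
Qed.

Lemma ext_eval_genM x i F : anticomm x ->
  ext_eval x (ext_gen K i * F) = x i * ext_eval x F.
Proof. by move=> ax; rewrite ext_evalM // ext_eval_gen. Qed.

Lemma ext_eval_zero F : ext_eval (fun=> 0 : A) F = (F set0)%:A.
Proof.
rewrite /ext_eval (bigD1 set0) //= big_set0 big1 ?addr0 // => S nS.
by rewrite prodr_const expr0n cards_eq0 (negPf nS) scaler0.
Qed.

Lemma ext_eval_par x (y : A) F : anticomm x ->
  (forall i, y * x i + x i * y = 0) -> y * ext_eval x F = ext_eval x (ext_par F) * y.
Proof.
move=> ax yx; move: F; apply: ext_ind => [a F G eF eG||i F eF].
- by rewrite !linearP /= mulrDr mulrDl -scalerAl -scalerAr eF eG.
- by rewrite ext_par1 ext_eval1 mul1r mulr1.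
- rewrite ext_par_gen linearN /= !ext_eval_genM // mulNr -mulrA -eF !mulrA.
  by rewrite -mulNr; congr (_ * _); apply/eqP; rewrite -addr_eq0 yx.
Qed.

Lemma ext_eval_closed x (P : A -> Prop) F :
  P 1 -> (forall a u w, P u -> P w -> P (a *: u + w)) ->
  (forall u w, P u -> P w -> P (u * w)) -> (forall i, P (x i)) -> P (ext_eval x F).
Proof.
move=> P1 Plin PM Px; have P0 : P 0.
  by have := Plin (-1) _ _ P1 P1; rewrite scaleN1r addNr.
rewrite /ext_eval; elim/big_ind: _ => // [u w Pu Pw|S _].
  by rewrite -[u]scale1r; exact: Plin.
rewrite -[_ *: _]addr0; apply: Plin => //.
by elim/big_ind: _.
Qed.

Lemma ext_evalX x F p : anticomm x -> ext_eval x (F ^+ p) = ext_eval x F ^+ p.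
Proof.
move=> ax; elim: p => [|p IH]; first by rewrite !expr0 ext_eval1.
by rewrite !exprS ext_evalM // IH.
Qed.
End EvalTheory.

(** * Real-valued norms *)

Local Open Scope classical_set_scope.

Section RealNorm.
Variables (R : realType).

(** Norms take their values in R[i], where the order is partial; estimates are made on
    this real number. *)
Definition rn (V : normedZmodType R[i]) (a : V) : R := complex.Re `|a|.

Section Zmod.
Variable V : normedZmodType R[i].
Implicit Types a b : V.

Lemma rnE a : `|a| = (rn a)%:C%C.
Proof.
have := normr_ge0 a; rewrite /rn; case: `|a| => x y /=.
by rewrite lecE /= => /andP[/eqP-> _].
Qed.

Lemma rn_ge0 a : 0 <= rn a.
Proof. by have := normr_ge0 a; rewrite rnE lecR. Qed.

Lemma rnD a b : rn (a + b) <= rn a + rn b.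
Proof. by have := ler_normD a b; rewrite !rnE -rmorphD lecR. Qed.

Lemma rnN a : rn (- a) = rn a.
Proof. by rewrite /rn normrN. Qed.

Lemma rnB a b : rn (a - b) <= rn a + rn b.
Proof. by rewrite -(rnN b) rnD. Qed.

Lemma rnC a b : rn (a - b) = rn (b - a).
Proof. by rewrite -rnN opprB. Qed.

Lemma rn0 : rn (0 : V) = 0.
Proof. by rewrite /rn normr0. Qed.

Lemma rn_eq0 a : rn a = 0 -> a = 0.
Proof. by move=> a0; apply/eqP; rewrite -normr_eq0 rnE a0. Qed.

Lemma rn_le0 a : rn a <= 0 -> a = 0.
Proof. by move=> a0; apply: rn_eq0; apply/eqP; rewrite eq_le a0 rn_ge0. Qed.

Lemma rn_sum (I : Type) (r : seq I) (P : pred I) (f : I -> V) :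
  rn (\sum_(i <- r | P i) f i) <= \sum_(i <- r | P i) rn (f i).
Proof.
elim/big_rec2: _ => [|i y z _ le]; first by rewrite rn0.
by apply: le_trans (rnD _ _) _; rewrite lerD2l.
Qed.

Lemma rn_leP a (c : R) : (`|a| <= c%:C%C) = (rn a <= c).
Proof. by rewrite rnE lecR. Qed.

Lemma rn_ltP a (c : R) : (`|a| < c%:C%C) = (rn a < c).
Proof. by rewrite rnE ltcR. Qed.

End Zmod.

Lemma rnM (z w : R[i]) : rn (z * w) = rn z * rn w.
Proof.
have : `|z * w| = (rn z * rn w)%:C%C by rewrite normrM !rnE rmorphM.
by rewrite /rn => ->.
Qed.

Lemma rn_real (x : R) : rn (x%:C%C : R[i]) = `|x|.
Proof. by rewrite /rn normc_def /= expr0n /= addr0 sqrtr_sqr. Qed.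

Lemma rn1 : rn (1 : R[i]) = 1.
Proof. by rewrite /rn normr1. Qed.

Lemma rnV (z : R[i]) : rn z^-1 = (rn z)^-1.
Proof.
have : `|z^-1| = ((rn z)^-1)%:C%C by rewrite normfV rnE fmorphV.
by rewrite /rn => ->.
Qed.

Lemma rn_nat (k : nat) : rn (k%:R : R[i]) = k%:R.
Proof. by rewrite -(rmorph_nat (real_complex R)) rn_real normr_nat. Qed.

Lemma rnZ (V : normedModType R[i]) (z : R[i]) (a : V) : rn (z *: a) = rn z * rn a.
Proof.
have : `|z *: a| = (rn z * rn a)%:C%C by rewrite normrZ !rnE rmorphM.
by rewrite /rn => ->.
Qed.

Section CS.
Variable A : cstarAlgType R.
Implicit Types a b : A.

Lemma rn_mul a b : rn (a * b) <= rn a * rn b.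
Proof.
by rewrite -rn_leP rmorphM /= -!rnE; exact: cnormM.
Qed.

Lemma rn_one : rn (1 : A) <= 1.
Proof.
have s1 : star (1 : A) = 1.
  by have := starM (star 1) (1 : A); rewrite mulr1 starK mulr1.
 have := cnorm_star (1 : A); rewrite s1 mul1r => e.
have {}e : rn (1 : A) = rn (1 : A) ^+ 2.
  have : `|1 : A| = (rn (1 : A) ^+ 2)%:C%C.
    by rewrite rmorphXn /= -rnE; exact: e.
  by rewrite /rn => {1}->.
have := rn_ge0 (1 : A); nra.
Qed.

(** By the C*-identity the square of the norm of an element is at most its norm times
    that of its adjoint, and the adjoint is an involution. *)
Lemma rn_star a : rn (star a) = rn a.
Proof.
have le b : rn b <= rn (star b).
  have e : rn (star b * b) = rn b ^+ 2.
    have : `|star b * b| = (rn b ^+ 2)%:C%C by rewrite rmorphXn /= -rnE; exact: cnorm_star.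
    by rewrite /rn => ->.
  have := rn_mul (star b) b; rewrite e expr2.
  have := rn_ge0 b; have := rn_ge0 (star b); rewrite le_eqVlt => sb.
  rewrite le_eqVlt => /orP[/eqP<-|b0]; first by rewrite rn_ge0.
  by rewrite ler_pM2r.
by apply/eqP; rewrite eq_le le andbT; have := le (star a); rewrite starK.
Qed.

Lemma rn_starM a : rn (star a * a) = rn a ^+ 2.
Proof.
have : `|star a * a| = (rn a ^+ 2)%:C%C by rewrite rmorphXn /= -rnE; exact: cnorm_star.
by rewrite /rn => ->.
Qed.

End CS.
End RealNorm.

(** * Norm estimates: heat operator, evaluation, Taylor expansion *)

Section ExtNorm.
Variables (R : realType) (n : nat).
Local Notation K := R[i].
Implicit Types (F G B : extalg K n) (C : 'I_n -> 'I_n -> K) (S T : {set 'I_n}).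
Local Notation sg := (@ext_sign K n).

(** The l1 norm of the coefficients. It is submultiplicative because the signs in the
    product have modulus at most one. *)
Definition ext_rn F : R := \sum_S rn (F S : K).

Lemma ext_rn_ge0 F : 0 <= ext_rn F.
Proof. by apply: sumr_ge0 => S _; exact: rn_ge0. Qed.

Lemma ext_rnD F G : ext_rn (F + G) <= ext_rn F + ext_rn G.
Proof.
rewrite /ext_rn -big_split; apply: ler_sum => S _.
by rewrite ffunE; exact: rnD.
Qed.

Lemma ext_rnZ (a : K) F : ext_rn (a *: F) = rn a * ext_rn F.
Proof.
by rewrite /ext_rn mulr_sumr; apply: eq_bigr => S _; rewrite ffunE -rnM.
Qed.

Lemma ext_rnN F : ext_rn (- F) = ext_rn F.
Proof. by rewrite -scaleN1r ext_rnZ rnN rn1 mul1r. Qed.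

Lemma ext_rn0 : ext_rn 0 = 0.
Proof. by rewrite /ext_rn big1 // => S _; rewrite ffunE rn0. Qed.

Lemma ext_rn_mono S : ext_rn (ext_mono K S) = 1.
Proof.
rewrite /ext_rn (bigD1 S) //= ffunE eqxx rn1 big1 ?addr0 // => T nT.
by rewrite ffunE (negPf nT) rn0.
Qed.

Lemma ext_rn1 : ext_rn 1 = 1. Proof. exact: ext_rn_mono. Qed.

Lemma ext_rn_sum (I : Type) (r : seq I) (P : pred I) (f : I -> extalg K n) :
  ext_rn (\sum_(i <- r | P i) f i) <= \sum_(i <- r | P i) ext_rn (f i).
Proof.
elim/big_rec2: _ => [|i y z _ le]; first by rewrite ext_rn0.
by apply: le_trans (ext_rnD _ _) _; rewrite lerD2l.
Qed.

Lemma ext_rn_scalar F : rn (F finset.set0 : K) <= ext_rn F.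
Proof.
by rewrite /ext_rn (bigD1 finset.set0) //= lerDl; apply: sumr_ge0 => S _; exact: rn_ge0.
Qed.

Lemma rn_sign_le1 S T : rn (sg S T) <= 1.
Proof.
rewrite /ext_sign; elim/big_ind: _ => [|x y lx ly|i _]; first by rewrite rn1.
  by rewrite rnM mulr_ile1 ?rn_ge0.
elim/big_ind: _ => [|x y lx ly|j _]; first by rewrite rn1.
  by rewrite rnM mulr_ile1 ?rn_ge0.
by rewrite /ext_sign1; case: ifP => _; rewrite ?rn0 // /rn normrX normrN1 expr1n.
Qed.

Lemma ext_rnM F G : ext_rn (F * G) <= ext_rn F * ext_rn G.
Proof.
rewrite /ext_rn mulr_suml.
have e : \sum_S rn (F S : K) * (\sum_T rn (G T : K)) =
    \sum_U \sum_S \sum_(T | S :|: T == U) rn (F S : K) * rn (G T : K).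
  rewrite exchange_big /=; apply: eq_bigr => S _; rewrite mulr_sumr.
  rewrite (exchange_big_dep xpredT) //=; apply: eq_bigr => T _.
  by rewrite (big_pred1 (S :|: T)) // => U; rewrite /= eq_sym.
rewrite e; apply: ler_sum => U _; rewrite ext_mulE.
apply: le_trans (rn_sum _ _ _) _; apply: ler_sum => S _.
apply: le_trans (rn_sum _ _ _) _; apply: ler_sum => T _.
rewrite !rnM ler_wpM2r ?rn_ge0 // ler_piMl ?rn_ge0 //; exact: rn_sign_le1.
Qed.

Lemma ext_rnX F k : ext_rn (F ^+ k) <= ext_rn F ^+ k.
Proof.
elim: k => [|k IH]; first by rewrite !expr0 ext_rn1.
rewrite !exprS; apply: le_trans (ext_rnM _ _) _.
by rewrite ler_wpM2l ?ext_rn_ge0.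
Qed.

Lemma ext_rn_deriv j F : ext_rn (ext_deriv j F) <= ext_rn F.
Proof.
apply: (@le_trans _ _ (\sum_(S : {set 'I_n} | j \notin S) rn (F (j |: S) : K))).
  rewrite [X in _ <= X]big_mkcond /ext_rn; apply: ler_sum => S _; rewrite ffunE.
  case: ifPn => [jS|]; last by rewrite negbK => jS; rewrite ext_sign_mem // mul0r rn0.
  by rewrite rnM ler_piMl ?rn_ge0 //; exact: rn_sign_le1.
rewrite /ext_rn [X in _ <= X](bigID (fun S => j \in S)) /= -[X in X <= _]addr0.
apply: lerD; last by apply: sumr_ge0 => S _; exact: rn_ge0.
rewrite [X in _ <= X](reindex_onto (fun S => j |: S) (fun U => U :\ j)) /=; last first.
  by move=> S jS; rewrite finset.setD1K.
rewrite le_eqVlt; apply/orP; left; apply/eqP; apply: eq_bigl => S.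
rewrite !inE eqxx /=; have [jS|jS] := boolP (j \in S); last by rewrite finset.setU1K // eqxx.
by apply/esym/negbTE; apply: contraTneq jS => <-; rewrite !inE eqxx.
Qed.

Definition cov_rn C : R := \sum_i \sum_j rn (C i j).

Lemma cov_rn_ge0 C : 0 <= cov_rn C.
Proof. by apply: sumr_ge0 => i _; apply: sumr_ge0 => j _; exact: rn_ge0. Qed.

Lemma ext_rn_lap C (c : R) F : cov_rn C <= c -> ext_rn (ext_lap C F) <= c * ext_rn F.
Proof.
move=> Cc; have c0 := le_trans (cov_rn_ge0 C) Cc.
rewrite /ext_lap ext_rnZ rnV rn_nat.
apply: (@le_trans _ _ (ext_rn (\sum_i \sum_j C i j *: ext_deriv j (ext_deriv i F)))).
  by rewrite ler_piMl ?ext_rn_ge0 // invf_le1 // ler1n.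
apply: (@le_trans _ _ (cov_rn C * ext_rn F)); last by rewrite ler_wpM2r ?ext_rn_ge0.
apply: le_trans (ext_rn_sum _ _ _) _; rewrite /cov_rn mulr_suml; apply: ler_sum => i _.
apply: le_trans (ext_rn_sum _ _ _) _; rewrite mulr_suml; apply: ler_sum => j _.
rewrite ext_rnZ ler_wpM2l ?rn_ge0 //.
by apply: le_trans (ext_rn_deriv _ _) _; exact: ext_rn_deriv.
Qed.

Lemma ext_rn_lap_iter C (c : R) k F : cov_rn C <= c ->
  ext_rn (iter k (ext_lap C) F) <= c ^+ k * ext_rn F.
Proof.
move=> Cc; have c0 := le_trans (cov_rn_ge0 C) Cc.
elim: k => [|k IH] /=; first by rewrite expr0 mul1r.
by apply: le_trans (ext_rn_lap _ Cc) _; rewrite exprS -mulrA ler_wpM2l.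
Qed.

Lemma rn_invfact_le1 k : rn ((k`!%:R)^-1 : K) <= 1.
Proof. by rewrite rnV rn_nat invf_le1 ?ltr0n ?ler1n ?fact_gt0. Qed.

Lemma ext_rn_heat C (c : R) F : cov_rn C <= c ->
  ext_rn (ext_heat C F) <= n.+1%:R * (1 + c) ^+ n * ext_rn F.
Proof.
move=> Cc; have c0 := le_trans (cov_rn_ge0 C) Cc.
apply: le_trans (ext_rn_sum _ _ _) _.
have -> : n.+1%:R * (1 + c) ^+ n * ext_rn F = \sum_(k < n.+1) (1 + c) ^+ n * ext_rn F.
  by rewrite sumr_const card_ord -mulrA mulr_natl.
apply: ler_sum => k _; rewrite ext_rnZ.
apply: le_trans (ler_piMl (ext_rn_ge0 _) (rn_invfact_le1 _)) _.
apply: le_trans (ext_rn_lap_iter _ _ Cc) _; rewrite ler_wpM2r ?ext_rn_ge0 //.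
apply: (@le_trans _ _ ((1 + c) ^+ k)); first by rewrite lerXn2r ?nnegrE ?lerDr ?addr_ge0.
by rewrite ler_weXn2l ?lerDl // -ltnS.
Qed.

(** The terms of order k in the exponential series carry a factor c ^ k, and c <= 1. *)
Lemma ext_rn_heat1 C (c : R) F : cov_rn C <= c -> c <= 1 ->
  ext_rn (ext_heat C F - F) <= n%:R * c * ext_rn F.
Proof.
move=> Cc c1; have c0 := le_trans (cov_rn_ge0 C) Cc.
rewrite ext_heatE addrC addKr.
apply: le_trans (ext_rn_sum _ _ _) _.
have -> : n%:R * c * ext_rn F = \sum_(k < n) c * ext_rn F.
  by rewrite sumr_const card_ord -mulrA mulr_natl.
apply: ler_sum => k _; rewrite ext_rnZ.
apply: le_trans (ler_piMl (ext_rn_ge0 _) (rn_invfact_le1 _)) _.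
apply: le_trans (ext_rn_lap_iter _ _ Cc) _; rewrite ler_wpM2r ?ext_rn_ge0 //.
by rewrite exprS ler_piMr // exprn_ile1.
Qed.

Lemma ext_rn_heat2 C (c : R) F : cov_rn C <= c -> c <= 1 ->
  ext_rn (ext_heat C F - F - ext_lap C F) <= n%:R * c ^+ 2 * ext_rn F.
Proof.
move=> Cc c1; have c0 := le_trans (cov_rn_ge0 C) Cc.
rewrite ext_heatE [F + _]addrC addrK.
have gen m : (0 < m)%N ->
    ext_rn (\sum_(k < m) k.+1`!%:R^-1 *: iter k.+1 (ext_lap C) F - ext_lap C F) <=
    m%:R * c ^+ 2 * ext_rn F.
  case: m => // m _; rewrite big_ord_recl /= (_ : 1`! = 1%N) // invr1 scale1r addrAC subrr add0r.
  apply: le_trans (ext_rn_sum _ _ _) _.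
  apply: (@le_trans _ _ (m%:R * c ^+ 2 * ext_rn F)); last first.
    by rewrite ler_wpM2r ?ext_rn_ge0 // ler_wpM2r ?sqr_ge0 // ler_nat.
  have -> : m%:R * c ^+ 2 * ext_rn F = \sum_(k < m) c ^+ 2 * ext_rn F.
    by rewrite sumr_const card_ord -mulrA mulr_natl.
  apply: ler_sum => k _; rewrite ext_rnZ.
  apply: le_trans (ler_piMl (ext_rn_ge0 _) (rn_invfact_le1 _)) _.
  apply: le_trans (ext_rn_lap_iter k.+2 _ Cc) _; rewrite ler_wpM2r ?ext_rn_ge0 //.
  by rewrite -addn2 exprD ler_piMl ?sqr_ge0 // exprn_ile1.
have [n0|n0] := posnP n; last exact: gen.
have d0 : ext_deg_le 0 F by have := ext_deg_le_card F; rewrite [X in ext_deg_le X]n0.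
rewrite ext_lap_deg0 // subr0 big1 ?ext_rn0 ?mulr_ge0 ?sqr_ge0 ?ext_rn_ge0 //.
by case=> k kn; exfalso; move: kn; rewrite n0.
Qed.

Lemma ext_rn_inv B (k b : R) : 0 < k -> k <= rn (B finset.set0 : K) -> ext_rn B <= b ->
  ext_rn (ext_inv B) <= k^-1 * (n.+1%:R * (1 + k^-1 * b) ^+ n).
Proof.
move=> k0 kB Bb; have b0 := le_trans (ext_rn_ge0 B) Bb.
have ki : rn ((B finset.set0)^-1 : K) <= k^-1 by rewrite rnV lef_pV2 ?posrE // (lt_le_trans k0).
rewrite /ext_inv ext_rnZ ler_pM ?rn_ge0 ?ext_rn_ge0 //.
apply: le_trans (ext_rn_sum _ _ _) _.
rewrite -[n.+1%:R * _](_ : \sum_(i < n.+1) (1 + k^-1 * b) ^+ n = _); last first.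
  by rewrite sumr_const card_ord mulr_natl.
apply: ler_sum => i _; apply: le_trans (ext_rnX _ _) _.
have kb : 0 <= k^-1 * b by rewrite mulr_ge0 // invr_ge0 ltW.
apply: (@le_trans _ _ ((1 + k^-1 * b) ^+ i)).
  rewrite lerXn2r ?nnegrE ?ext_rn_ge0 ?addr_ge0 //.
  apply: le_trans (ext_rnD _ _) _; rewrite ext_rn1 lerD2l ext_rnN ext_rnZ.
  by rewrite ler_pM ?rn_ge0 ?ext_rn_ge0.
by rewrite ler_weXn2l ?lerDl // -ltnS.
Qed.

Section Eval.
Variable A : cstarAlgType R.
Implicit Types (x d : 'I_n -> A) (M e : R).

Lemma rn_prod (I : Type) (r : seq I) (P : pred I) (f : I -> A) :
  rn (\prod_(i <- r | P i) f i) <= \prod_(i <- r | P i) rn (f i).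
Proof.
elim/big_rec2: _ => [|i y z _ le]; first exact: rn_one.
apply: le_trans (rn_mul _ _) _.
by rewrite ler_wpM2l ?rn_ge0.
Qed.

Lemma rn_mono_eval x M (S : {set 'I_n}) : 1 <= M -> (forall i, rn (x i) <= M) ->
  rn (\prod_(i in S) x i) <= M ^+ n.
Proof.
move=> M1 xM; apply: le_trans (rn_prod _ _ _) _.
apply: (@le_trans _ _ (\prod_(i in S) M)).
  by apply: ler_prod => i _; rewrite rn_ge0 xM.
rewrite prodr_const ler_weXn2l //.
by rewrite -[X in (_ <= X)%N]card_ord max_card.
Qed.

Lemma rn_eval x M F : 1 <= M -> (forall i, rn (x i) <= M) ->
  rn (ext_eval x F) <= ext_rn F * M ^+ n.
Proof.
move=> M1 xM; apply: le_trans (rn_sum _ _ _) _; rewrite /ext_rn mulr_suml.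
by apply: ler_sum => S _; rewrite rnZ ler_wpM2l ?rn_ge0 // rn_mono_eval.
Qed.

(** The remainders of order zero and one of the Taylor expansion at x. The increments
    stand on the left because ext_deriv is a left derivative. *)
Definition ext_diff x d F : A :=
  ext_eval (fun i => x i + d i) F - ext_eval x F.
Definition ext_taylor x d F : A :=
  ext_diff x d F - \sum_i d i * ext_eval x (ext_deriv i F).

Lemma ext_diff_gen x d k F : anticomm x -> anticomm (fun i => x i + d i) ->
  ext_diff x d (ext_gen K k * F) =
  x k * ext_diff x d F + d k * ext_eval (fun i => x i + d i) F.
Proof.
move=> ax axd; rewrite /ext_diff !ext_eval_genM // mulrDl mulrBr addrAC //.
Qed.

Lemma ext_taylor_gen x d k F : anticomm x -> anticomm (fun i => x i + d i) ->
  (forall i j, x i * d j + d j * x i = 0) ->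
  ext_taylor x d (ext_gen K k * F) = x k * ext_taylor x d F + d k * ext_diff x d F.
Proof.
move=> ax axd xd; rewrite /ext_taylor ext_diff_gen //.
have -> : \sum_i d i * ext_eval x (ext_deriv i (ext_gen K k * F)) =
    d k * ext_eval x F + x k * \sum_i d i * ext_eval x (ext_deriv i F).
  transitivity (\sum_i ((k == i)%:R *: (d i * ext_eval x F) +
     x k * (d i * ext_eval x (ext_deriv i F)))).
    apply: eq_bigr => i _; rewrite ext_deriv_genM linearB linearZ /= ext_eval_genM //.
    rewrite mulrBr -scalerAr; congr (_ + _); rewrite !mulrA -mulNr; congr (_ * _).
    by apply/esym/eqP; rewrite -addr_eq0 xd.
  rewrite big_split -mulr_sumr; congr (_ + _).
  rewrite (bigD1 k) //= eqxx scale1r big1 ?addr0 // => i ik.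
  by rewrite eq_sym (negPf ik) scale0r.
rewrite [in RHS]mulrBr [d k * ext_diff _ _ _]mulrBr.
by rewrite [d k * _ + x k * _]addrC opprD addrACA.
Qed.

Lemma ext_diff_is_linear x d : linear (ext_diff x d).
Proof.
move=> a F G; rewrite /ext_diff !ext_eval_is_linear scalerBr.
by rewrite opprD addrACA.
Qed.
HB.instance Definition _ x d := GRing.isLinear.Build K (extalg K n) A
  *:%R (ext_diff x d) (ext_diff_is_linear x d).

Lemma ext_taylor_is_linear x d : linear (ext_taylor x d).
Proof.
move=> a F G; rewrite /ext_taylor ext_diff_is_linear.
have -> : \sum_i d i * ext_eval x (ext_deriv i (a *: F + G)) =
  a *: (\sum_i d i * ext_eval x (ext_deriv i F)) + \sum_i d i * ext_eval x (ext_deriv i G).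
  rewrite scaler_sumr -big_split; apply: eq_bigr => i _ /=.
  by rewrite ext_deriv_is_linear ext_eval_is_linear mulrDr scalerAr.
by rewrite [in RHS]scalerBr opprD addrACA.
Qed.
HB.instance Definition _ x d := GRing.isLinear.Build K (extalg K n) A
  *:%R (ext_taylor x d) (ext_taylor_is_linear x d).

Lemma rn_linear_mono (T : {linear extalg K n -> A}) (b : R) F :
  (forall S, rn (T (ext_mono K S)) <= b) -> rn (T F) <= ext_rn F * b.
Proof.
move=> Tb; rewrite {1}(ext_sum_mono F) linear_sum /=.
apply: le_trans (rn_sum _ _ _) _; rewrite /ext_rn mulr_suml; apply: ler_sum => S _.
by rewrite linearZ /= rnZ; apply: ler_wpM2l; [exact: rn_ge0|exact: Tb].
Qed.

(** By ext_diff_gen and ext_taylor_gen the remainders of a product with a generator are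
    expressed by those of the other factor, with one more factor d for those of lower
    order; induction on the degree gives a constant that depends on M and n only. *)
Lemma rn_ext_diff_taylor M : 1 <= M -> exists2 L : R, 0 <= L &
  forall x d e, 0 <= e <= 1 -> anticomm x -> anticomm (fun i => x i + d i) ->
    (forall i j, x i * d j + d j * x i = 0) ->
    (forall i, rn (x i) <= M) -> (forall i, rn (d i) <= e) -> forall F,
    rn (ext_diff x d F) <= ext_rn F * (L * e) /\
    rn (ext_taylor x d F) <= ext_rn F * (L * e ^+ 2).
Proof.
move=> M1.
have M0 : 0 <= M by apply: le_trans M1.
suff gen m : exists2 L : R, 0 <= L &
  forall x d e, 0 <= e <= 1 -> anticomm x -> anticomm (fun i => x i + d i) ->
    (forall i j, x i * d j + d j * x i = 0) ->
    (forall i, rn (x i) <= M) -> (forall i, rn (d i) <= e) -> 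
    forall S, (#|S| <= m)%N ->
    rn (ext_diff x d (ext_mono K S)) <= L * e /\
    rn (ext_taylor x d (ext_mono K S)) <= L * e ^+ 2.
  have [L L0 HL] := gen n; exists L => // x d e he ax axd xd xM de F.
  have cn S : (#|S| <= n)%N by rewrite -[X in (_ <= X)%N]card_ord max_card.
  split; apply: rn_linear_mono => S; by have [] := HL x d e he ax axd xd xM de S (cn S).
elim: m => [|m [L L0 IH]].
  exists 0 => // x d e he ax axd xd xM de S; rewrite leqn0 cards_eq0 => /eqP->.
  rewrite !mul0r /ext_taylor /ext_diff !ext_eval1 subrr rn0; split=> //.
  by rewrite big1 ?subr0 ?rn0 // => i _; rewrite ext_deriv1 linear0 mulr0.
pose L' := M * L + (M + 1) ^+ n + L.
have P0 : 0 <= (M + 1) ^+ n by rewrite exprn_ge0 // addr_ge0.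
have L'0 : 0 <= L' by rewrite !addr_ge0 // mulr_ge0.
exists L' => // x d e he ax axd xd xM de S Sm.
have /andP[e0 e1] := he.
have [->|/set0Pn[i iS]] := eqVneq S finset.set0.
  have [] := IH x d e he ax axd xd xM de finset.set0 _; first by rewrite cards0.
  have LL : L <= L' by rewrite lerDr addr_ge0 ?mulr_ge0.
  move=> h1 h2; split; [apply: le_trans h1 _ | apply: le_trans h2 _];
    by rewrite ler_wpM2r ?sqr_ge0.
rewrite (ext_gen_mulD1 _ iS) !linearZ /= !rnZ.
have Sm' : (#|(S :\ i)%SET| <= m)%N by move: Sm; rewrite (cardsD1 i) iS.
have [h1 h2] := IH x d e he ax axd xd xM de _ Sm'.
set G := ext_mono K _ in h1 h2 *.
have c1 := rn_sign_le1 [set i]%SET (S :\ i)%SET.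
have xdM j : rn (x j + d j) <= M + 1.
  by apply: le_trans (rnD _ _) _; rewrite lerD // (le_trans (de j)).
have eG : rn (ext_eval (fun j => x j + d j) G) <= (M + 1) ^+ n.
  apply: le_trans (rn_eval _ _ xdM) _; first by rewrite lerDr.
  by rewrite ext_rn_mono mul1r.
split.
  apply: le_trans (ler_piMl (rn_ge0 _) c1) _; rewrite ext_diff_gen //.
  apply: (@le_trans _ _ (M * (L * e) + e * (M + 1) ^+ n)).
    apply: le_trans (rnD _ _) _; rewrite lerD //.
      by apply: le_trans (rn_mul _ _) _; rewrite ler_pM ?rn_ge0.
    by apply: le_trans (rn_mul _ _) _; rewrite ler_pM ?rn_ge0.
  rewrite /L'; have := mulr_ge0 L0 e0; lra.
apply: le_trans (ler_piMl (rn_ge0 _) c1) _; rewrite ext_taylor_gen //.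
apply: (@le_trans _ _ (M * (L * e ^+ 2) + e * (L * e))).
  apply: le_trans (rnD _ _) _; rewrite lerD //.
    by apply: le_trans (rn_mul _ _) _; rewrite ler_pM ?rn_ge0.
  by apply: le_trans (rn_mul _ _) _; rewrite ler_pM ?rn_ge0.
have := mulr_ge0 P0 (sqr_ge0 e); rewrite /L' !expr2; lra.
Qed.
End Eval.

End ExtNorm.

(** * The heat flow tilted by a weight *)

(** The product of two first-order expansions with remainders r and r2, less that of the
    product with remainder r3, is of second order: p and q stand for the Laplacians of f
    and g, and d for the drift, which supplies the cross terms. *)
Lemma product_residual (U : nzRingType) (f p d r g q r2 r3 : U) :
  (f + p + d + r) * (g + (q + r2)) - (f * g + (p * g + f * q + d * g) + r3) =
  (p + d) * q + (f + p + d) * r2 + r * (g + (q + r2)) - r3.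
Proof.
rewrite [LHS]addrC opprD addrAC [- (_ + _) + _]addrC; congr (_ - _).
apply/eqP; rewrite subr_eq mulrDl !(mulrDr (f + p + d)) !mulrDl; apply/eqP.
by rewrite [LHS](AC (3*(3*3)*1) (5*6*(7*8*9)*10*(1*(2*4*3)))).
Qed.

Lemma sub_mul_inverse (U : nzRingType) (a b c d : U) :
  b * c = 1 -> a - d * c = (a * b - d) * c.
Proof. by move=> bc; rewrite mulrBl -mulrA bc mulr1. Qed.

Section HeatStep.
Variables (R : realType) (n : nat).
Local Notation K := R[i].
Implicit Types (F G H Z : extalg K n) (C : 'I_n -> 'I_n -> K) (e b k : R).

Definition log_deriv Z j : extalg K n := ext_deriv j Z * ext_inv Z.

Lemma log_derivM Z j : Z finset.set0 != 0 -> ext_par Z = Z -> log_deriv Z j * Z = ext_deriv j Z.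
Proof.
move=> Z0 eZ; rewrite /log_deriv -mulrA.
by rewrite (ext_evenC _ eZ) ext_mulVr // mulr1.
Qed.

(** The bound of ext_rn_inv on the norm of ext_inv. *)
Definition inv_bound k b : R := k^-1 * (n.+1%:R * (1 + k^-1 * b) ^+ n).

Lemma inv_bound_ge0 k b : 0 < k -> 0 <= b -> 0 <= inv_bound k b.
Proof.
by move=> k0 b0; rewrite /inv_bound !mulr_ge0 ?exprn_ge0 ?addr_ge0 ?mulr_ge0 ?invr_ge0 // ltW.
Qed.

Lemma ext_rn_log_deriv Z j k b : 0 < k -> k <= rn (Z finset.set0 : K) -> ext_rn Z <= b ->
  ext_rn (log_deriv Z j) <= b * inv_bound k b.
Proof.
move=> k0 kZ Zb; apply: le_trans (ext_rnM _ _) _; apply: ler_pM; rewrite ?ext_rn_ge0 //.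
  exact: le_trans (ext_rn_deriv _ _) Zb.
exact: ext_rn_inv.
Qed.

(** The cross terms of ext_lap_mul_even for the Laplacian of H * Z, divided by Z. *)
Definition drift C Z H : extalg K n :=
  \sum_i \sum_j C i j *: (log_deriv Z j * ext_deriv i H).

Lemma ext_rn_drift C Z H k b e : 0 < k -> k <= rn (Z finset.set0 : K) -> ext_rn Z <= b ->
  cov_rn C <= e -> ext_rn (drift C Z H) <= e * (b * inv_bound k b * ext_rn H).
Proof.
move=> k0 kZ Zb Ce; have b0 := le_trans (ext_rn_ge0 Z) Zb.
have B0 : 0 <= b * inv_bound k b * ext_rn H.
  by rewrite mulr_ge0 ?ext_rn_ge0 // mulr_ge0 // inv_bound_ge0.
apply: (@le_trans _ _ (cov_rn C * (b * inv_bound k b * ext_rn H))); last by rewrite ler_wpM2r.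
apply: le_trans (ext_rn_sum _ _ _) _; rewrite /cov_rn mulr_suml; apply: ler_sum => i _.
apply: le_trans (ext_rn_sum _ _ _) _; rewrite mulr_suml; apply: ler_sum => j _.
rewrite ext_rnZ ler_wpM2l ?rn_ge0 //; apply: le_trans (ext_rnM _ _) _.
apply: ler_pM; rewrite ?ext_rn_ge0 ?ext_rn_deriv //; exact: ext_rn_log_deriv.
Qed.

(** By the Leibniz rule the Laplacian of H * Z consists of those of H and Z and of cross
    terms, which are the drift times Z. Dividing the heat flow of H * Z by that of Z
    therefore leaves the heat flow of H plus the drift, up to second order in the
    covariance. *)
Lemma tilted_heat_step k b : 0 < k -> 0 <= b -> exists2 L : R, 0 <= L &
  forall C Z H e, antisym C -> cov_rn C <= e -> e <= 1 -> ext_par Z = Z ->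
    ext_rn Z <= b -> k <= rn (Z finset.set0 : K) -> k <= rn (ext_heat C Z finset.set0 : K) ->
    ext_rn (ext_heat C H + drift C Z H - ext_heat C (H * Z) * ext_inv (ext_heat C Z)) <=
      ext_rn H * (L * e ^+ 2).
Proof.
move=> k0 b0; pose b2 := n.+1%:R * 2 ^+ n * b; pose q := b * inv_bound k b.
pose L1 := (1 + q) * b + (2 + q) * (n%:R * b) + n%:R * b2 + n%:R * b.
have b20 : 0 <= b2 by rewrite !mulr_ge0 ?exprn_ge0.
have q0 : 0 <= q by rewrite mulr_ge0 ?inv_bound_ge0.
have n0 : 0 <= n%:R :> R by [].
have nb0 : 0 <= n%:R * b by rewrite mulr_ge0.
have L10 : 0 <= L1 by rewrite !addr_ge0 ?mulr_ge0 ?addr_ge0.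
exists (L1 * inv_bound k b2); first by rewrite mulr_ge0 ?inv_bound_ge0.
move=> C Z H e aC Ce e1 eZ Zb kZ kSZ; have e0 := le_trans (cov_rn_ge0 C) Ce.
set S := ext_heat C; set D := drift C Z H; set Lp := ext_lap C.
have nz x : k <= rn x -> x != 0 by move=> kx; apply: contraTneq kx => ->; rewrite rn0 -ltNge.
have SZ1 : S Z * ext_inv (S Z) = 1 by apply: ext_mulVr; exact: nz.
pose r1 := S H - H - Lp H; pose r2 := S Z - Z - Lp Z; pose r3 := S (H * Z) - H * Z - Lp (H * Z).
have DZ : D * Z = \sum_i \sum_j C i j *: (ext_deriv j Z * ext_deriv i H).
  rewrite /D /drift mulr_suml; apply: eq_bigr => i _; rewrite mulr_suml; apply: eq_bigr => j _.
  rewrite -scalerAl -mulrA (ext_evenC _ eZ) mulrA log_derivM //; exact: nz.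
have key : (S H + D) * S Z - S (H * Z) =
    (Lp H + D) * Lp Z + (H + Lp H + D) * r2 + r1 * S Z - r3.
  have eSH : S H + D = H + Lp H + D + r1 by apply/ffunP => U; rewrite /r1 !ffunE; ring.
  have eSZ : S Z = Z + (Lp Z + r2) by apply/ffunP => U; rewrite /r2 !ffunE; ring.
  have eSHZ : S (H * Z) = H * Z + (Lp H * Z + H * Lp Z + D * Z) + r3.
    rewrite DZ -(ext_lap_mul_even H aC eZ) /r3 -/Lp.
    by rewrite -[_ - _ - Lp _]addrA -opprD [RHS]addrC subrK.
  by rewrite eSH eSHZ {1 2}eSZ; exact: product_residual.
have -> : S H + D - S (H * Z) * ext_inv (S Z) = ((S H + D) * S Z - S (H * Z)) * ext_inv (S Z).
  exact: sub_mul_inverse.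
rewrite key.
have SZb : ext_rn (S Z) <= b2.
  apply: le_trans (ext_rn_heat Z (le_trans Ce e1)) _.
  by rewrite ler_wpM2l // mulr_ge0 ?exprn_ge0.
apply: le_trans (ext_rnM _ _) _.
apply: (@le_trans _ _ (ext_rn H * (L1 * e ^+ 2) * inv_bound k b2)); last first.
  by rewrite le_eqVlt; apply/orP; left; apply/eqP; ring.
apply: ler_pM; rewrite ?ext_rn_ge0 //; last exact: ext_rn_inv.
have hH := ext_rn_ge0 H.
have lH : ext_rn (Lp H) <= e * ext_rn H by exact: ext_rn_lap.
have lZ : ext_rn (Lp Z) <= e * b by apply: le_trans (ext_rn_lap _ Ce) _; rewrite ler_wpM2l.
have dD : ext_rn D <= e * (q * ext_rn H) by exact: ext_rn_drift.
have h1 : ext_rn r1 <= n%:R * e ^+ 2 * ext_rn H by exact: ext_rn_heat2.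
have h2 : ext_rn r2 <= n%:R * e ^+ 2 * b.
  by apply: le_trans (ext_rn_heat2 _ Ce e1) _; rewrite ler_wpM2l // mulr_ge0 ?sqr_ge0.
have h3 : ext_rn r3 <= n%:R * e ^+ 2 * (ext_rn H * b).
  apply: le_trans (ext_rn_heat2 _ Ce e1) _; rewrite ler_wpM2l ?mulr_ge0 ?sqr_ge0 //.
  by apply: le_trans (ext_rnM _ _) _; rewrite ler_wpM2l.
have t1 : ext_rn ((Lp H + D) * Lp Z) <= (e * ext_rn H + e * (q * ext_rn H)) * (e * b).
  apply: le_trans (ext_rnM _ _) _; apply: ler_pM; rewrite ?ext_rn_ge0 //.
  by apply: le_trans (ext_rnD _ _) _; exact: lerD.
have t2 : ext_rn ((H + Lp H + D) * r2) <= (2 + q) * ext_rn H * (n%:R * e ^+ 2 * b).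
  apply: le_trans (ext_rnM _ _) _; apply: ler_pM; rewrite ?ext_rn_ge0 //.
  have -> : (2 + q) * ext_rn H = ext_rn H + 1 * ext_rn H + 1 * (q * ext_rn H) by ring.
  apply: le_trans (ext_rnD _ _) _; apply: lerD.
    apply: le_trans (ext_rnD _ _) _; apply: lerD => //; apply: le_trans lH _.
    exact: ler_wpM2r.
  apply: le_trans dD _; apply: ler_wpM2r => //; exact: mulr_ge0.
have t3 : ext_rn (r1 * S Z) <= n%:R * e ^+ 2 * ext_rn H * b2.
  by apply: le_trans (ext_rnM _ _) _; apply: ler_pM; rewrite ?ext_rn_ge0.
have -> : ext_rn H * (L1 * e ^+ 2) =
  (e * ext_rn H + e * (q * ext_rn H)) * (e * b) + (2 + q) * ext_rn H * (n%:R * e ^+ 2 * b) +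
  n%:R * e ^+ 2 * ext_rn H * b2 + n%:R * e ^+ 2 * (ext_rn H * b) by rewrite /L1; ring.
apply: le_trans (ext_rnD _ _) _; rewrite ext_rnN; apply: lerD => //.
apply: le_trans (ext_rnD _ _) _; apply: lerD => //.
by apply: le_trans (ext_rnD _ _) _; exact: lerD.
Qed.

(** The heat flow moves each factor by O(e). For the inverses in the logarithmic
    derivatives this follows from Y^-1 - Z^-1 = Z^-1 (Z - Y) Y^-1. *)
Lemma log_deriv_transport k b : 0 < k -> 0 <= b -> exists2 L : R, 0 <= L &
  forall C D Z F j e, cov_rn C <= e -> cov_rn D <= e -> e <= 1 -> ext_par Z = Z ->
    ext_rn Z <= b -> k <= rn (Z finset.set0 : K) -> k <= rn (ext_heat D Z finset.set0 : K) ->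
    ext_rn (ext_heat C (log_deriv (ext_heat D Z) j * ext_heat D F) - log_deriv Z j * F) <=
      ext_rn F * (L * e).
Proof.
have split3 C (x y w f : extalg K n) : ext_rn (ext_heat C (x * w) - y * f) <=
    ext_rn (ext_heat C (x * w) - x * w) + (ext_rn (x * (w - f)) + ext_rn ((x - y) * f)).
  have -> : ext_heat C (x * w) - y * f =
      (ext_heat C (x * w) - x * w) + (x * (w - f) + (x - y) * f).
    by rewrite (mulrBr x) (mulrBl f) [_ - _ + (_ - _)]addrA subrK addrA subrK.
  by apply: le_trans (ext_rnD _ _) _; apply: lerD => //; exact: ext_rnD.
move=> k0 b0; pose c := n.+1%:R * 2 ^+ n : R; pose b2 := c * b.
pose j1 := inv_bound k b; pose j2 := inv_bound k b2; pose q := n%:R * b * (j2 + b * (j1 * j2)).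
have c0 : 0 <= c by rewrite mulr_ge0 ?exprn_ge0.
have b20 : 0 <= b2 by exact: mulr_ge0.
have j10 : 0 <= j1 by exact: inv_bound_ge0.
have j20 : 0 <= j2 by exact: inv_bound_ge0.
have n0 : 0 <= n%:R :> R by [].
have q0 : 0 <= q by do ![done | apply: mulr_ge0 | apply: addr_ge0].
exists (n%:R * (b2 * j2 * c) + b2 * j2 * n%:R + q).
  by do ![done | apply: addr_ge0 | apply: mulr_ge0].
move=> C D Z F j e Ce De e1 eZ Zb kZ kY; have e0 := le_trans (cov_rn_ge0 C) Ce.
set Y := ext_heat D Z.
have heat_le G : ext_rn (ext_heat D G) <= c * ext_rn G.
  exact: ext_rn_heat (le_trans De e1).
have Yb : ext_rn Y <= b2 by apply: le_trans (heat_le Z) _; rewrite ler_wpM2l.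
have nz x : k <= rn x -> x != 0 by move=> kx; apply: contraTneq kx => ->; rewrite rn0 -ltNge.
have iZ : ext_inv Z * Z = 1 by rewrite (ext_evenC _ eZ) ext_mulVr // nz.
have iY : Y * ext_inv Y = 1 by rewrite ext_mulVr // nz.
have hF := ext_rn_ge0 F.
have dZ : ext_rn (Y - Z) <= n%:R * e * b.
  by apply: le_trans (ext_rn_heat1 _ De e1) _; rewrite ler_wpM2l ?mulr_ge0.
have lY : ext_rn (log_deriv Y j) <= b2 * j2 by exact: ext_rn_log_deriv.
have dinv : ext_inv Y - ext_inv Z = ext_inv Z * (Z - Y) * ext_inv Y.
  by rewrite mulrBr iZ mulrBl mul1r -mulrA iY mulr1.
have r1 : ext_rn (ext_inv Y - ext_inv Z) <= j1 * (n%:R * e * b) * j2.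
  rewrite dinv; apply: le_trans (ext_rnM _ _) _; apply: ler_pM; rewrite ?ext_rn_ge0 //.
    apply: le_trans (ext_rnM _ _) _; apply: ler_pM; rewrite ?ext_rn_ge0 //.
      exact: ext_rn_inv.
    by rewrite -ext_rnN opprB.
  exact: ext_rn_inv.
have dl : ext_rn (log_deriv Y j - log_deriv Z j) <= q * e.
  have -> : log_deriv Y j - log_deriv Z j =
      ext_deriv j (Y - Z) * ext_inv Y + ext_deriv j Z * (ext_inv Y - ext_inv Z).
    by rewrite raddfB /= mulrBl mulrBr addrA subrK.
  apply: le_trans (ext_rnD _ _) _.
  have u1 : ext_rn (ext_deriv j (Y - Z) * ext_inv Y) <= n%:R * e * b * j2.
    apply: le_trans (ext_rnM _ _) _; apply: ler_pM; rewrite ?ext_rn_ge0 //.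
      exact: le_trans (ext_rn_deriv _ _) dZ.
    exact: ext_rn_inv.
  have u2 : ext_rn (ext_deriv j Z * (ext_inv Y - ext_inv Z)) <= b * (j1 * (n%:R * e * b) * j2).
    apply: le_trans (ext_rnM _ _) _; apply: ler_pM; rewrite ?ext_rn_ge0 //.
    exact: le_trans (ext_rn_deriv _ _) Zb.
  have -> : q * e = n%:R * e * b * j2 + b * (j1 * (n%:R * e * b) * j2) by rewrite /q; ring.
  exact: lerD.
have v1 : ext_rn (ext_heat C (log_deriv Y j * ext_heat D F) - log_deriv Y j * ext_heat D F) <=
    n%:R * e * (b2 * j2 * (c * ext_rn F)).
  apply: le_trans (ext_rn_heat1 _ Ce e1) _; apply: ler_wpM2l; first exact: mulr_ge0.
  by apply: le_trans (ext_rnM _ _) _; apply: ler_pM; rewrite ?ext_rn_ge0.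
have v2 : ext_rn (log_deriv Y j * (ext_heat D F - F)) <= b2 * j2 * (n%:R * e * ext_rn F).
  apply: le_trans (ext_rnM _ _) _; apply: ler_pM; rewrite ?ext_rn_ge0 //.
  exact: ext_rn_heat1.
have v3 : ext_rn ((log_deriv Y j - log_deriv Z j) * F) <= q * e * ext_rn F.
  by apply: le_trans (ext_rnM _ _) _; apply: ler_pM; rewrite ?ext_rn_ge0.
apply: le_trans (split3 _ _ _ _ _) _.
apply: (@le_trans _ _ (n%:R * e * (b2 * j2 * (c * ext_rn F)) +
    (b2 * j2 * (n%:R * e * ext_rn F) + q * e * ext_rn F))).
  by apply: lerD => //; exact: lerD.
by rewrite le_eqVlt; apply/orP; left; apply/eqP; ring.
Qed.
End HeatStep.

(** * Wick's rule and conditional Gaussian expectations *)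

Lemma subrACA (V : zmodType) (p q r s : V) : p - q - (r - s) = p - r - (q - s).
Proof. by rewrite !opprB -!addrA; congr (_ + _); rewrite addrCA [RHS]addrCA [- q - r]addrC. Qed.

Section Contraction.
Variables (K : comNzRingType) (A : algType K).

(** The right-hand side of Wick's rule for a letter placed in front of a word, with c y
    the covariance of that letter and y. The recursion on words replaces the expansion
    of the Pfaffian, whose terms are indexed by positions (contraction_sum). *)
Fixpoint contraction (c : A -> K) (l : seq A) : A :=
  if l is y :: l' then c y *: \prod_(z <- l') z - y * contraction c l' else 0.

Lemma contraction_sum (T : Type) (f : T -> A) (c : T -> K) (x : T) (l : seq T) (c' : A -> K) :
  (forall y, c' (f y) = c y) ->
  \sum_(j < size l) ((-1) ^+ j * c (nth x l j)) *:
      \prod_(p <- take j l ++ drop j.+1 l) f p = contraction c' (map f l).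
Proof.
move=> cc; elim: l => [|y l IH] /=; first by rewrite big_ord0.
rewrite big_ord_recl /= expr0 mul1r drop0 cc big_map -IH mulr_sumr -sumrN; congr (_ + _).
apply: eq_bigr => j _; rewrite /bump /= add1n exprS mulN1r mulNr scaleNr big_cons.
by rewrite scalerAr.
Qed.

Lemma contraction_rcons c l y :
  contraction c (rcons l y) =
  contraction c l * y + ((-1) ^+ size l * c y) *: \prod_(z <- l) z.
Proof.
elim: l => [|z l IH] /=.
  by rewrite !big_nil mulr0 subr0 mul0r add0r expr0 mul1r.
rewrite IH big_rcons /= big_cons exprS mulN1r mulNr scaleNr.
by rewrite mulrBl mulrDr opprD addrA mulrA -scalerAl -scalerAr.
Qed.

End Contraction.

Section PfaffianTheory.
Variables (K : comNzRingType) (T : Type) (c : T -> T -> K).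

Lemma pfaffian_rec_size k s : (size s <= k)%N -> pfaffian_rec c k s = pfaffian c s.
Proof.
rewrite /pfaffian.
suff gen m k1 k2 (l : seq T) : (size l <= m)%N -> (size l <= k1)%N -> (size l <= k2)%N ->
    pfaffian_rec c k1 l = pfaffian_rec c k2 l by move=> sk; exact: (gen k).
elim: m k1 k2 l => [|m IH] k1 k2 [|x l] //=; try by case: k1; case: k2.
case: k1 => // k1; case: k2 => // k2 /=; rewrite !ltnS => lm l1 l2.
apply: eq_bigr => j _; congr (_ * _).
have sz : (size (take j l ++ drop j.+1 l) <= size l)%N.
  by rewrite size_cat size_take size_drop ltn_ord -[X in (_ <= X)%N](subnKC (ltnW (ltn_ord j))) leq_add2l leq_sub2l.
by apply: IH; apply: leq_trans sz _.
Qed.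

Lemma pfaffian_cons x l : pfaffian c (x :: l) =
  \sum_(j < size l) (-1) ^+ j * c x (nth x l j) * pfaffian c (take j l ++ drop j.+1 l).
Proof.
rewrite /pfaffian /=; apply: eq_bigr => j _; congr (_ * _).
rewrite pfaffian_rec_size //.
by rewrite size_cat size_take size_drop ltn_ord -[X in (_ <= X)%N](subnKC (ltnW (ltn_ord j))) leq_add2l leq_sub2l.
Qed.

End PfaffianTheory.

Section Wick.
Variables (R : realType) (A : fnps R) (h : hilbertType R).
Variables (Theta : h -> h) (G : R -> {linear h -> h}) (X : R -> {linear h -> A}).
Hypothesis X_gbm : is_gbm Theta G X.
Local Notation omega := (nc_state A).

(** Wick's rule is given for the values of X, and extends by linearity in each letter;
    differences are all that increments require. *)
Inductive gaussian_letter : A -> Prop :=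
| GaussianValue r f : 0 <= r -> gaussian_letter (X r f)
| GaussianSub a b : gaussian_letter a -> gaussian_letter b -> gaussian_letter (a - b).

Lemma omegaB a b : omega (a - b) = omega a - omega b.
Proof. exact: raddfB. Qed.

Lemma omegaD a b : omega (a + b) = omega a + omega b.
Proof. exact: raddfD. Qed.

Lemma omegaZ z a : omega (z *: a) = z * omega a.
Proof. exact: linearZ. Qed.

Definition wick_at (x : A) (l : seq A) : Prop :=
  omega (x * \prod_(z <- l) z) = omega (contraction (fun y => omega (x * y)) l).

Lemma wick_values r f (l : seq (R * h)) : 0 <= r -> (forall p, p \in l -> 0 <= p.1) ->
  wick_at (X r f) [seq X p.1 p.2 | p <- l].
Proof.
move=> r0 l0; rewrite /wick_at big_map.
rewrite -(contraction_sum (c := fun p : R * h => omega (X r f * X p.1 p.2)) (r, f)) //.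
rewrite linear_sum /=.
have := gbm_gaussian X_gbm (s := (r, f) :: l).
rewrite big_cons pfaffian_cons => -> /=; last first.
  by move=> p; rewrite inE => /orP[/eqP->//|/l0].
apply: eq_bigr => j _; rewrite linearZ /= (gbm_gaussian X_gbm) //.
move=> p; rewrite mem_cat => /orP[/mem_take|/mem_drop]; exact: l0.
Qed.

Lemma prod_sub (l1 l2 : seq A) (a b : A) :
  \prod_(z <- l1 ++ (a - b) :: l2) z =
  \prod_(z <- l1 ++ a :: l2) z - \prod_(z <- l1 ++ b :: l2) z.
Proof. by rewrite !big_cat !big_cons /= mulrBl mulrBr. Qed.

Lemma contraction_linear (c : A -> R[i]) (l1 l2 : seq A) (a b : A) :
  c (a - b) = c a - c b ->
  contraction c (l1 ++ (a - b) :: l2) =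
  contraction c (l1 ++ a :: l2) - contraction c (l1 ++ b :: l2).
Proof.
move=> cab; elim: l1 => [|y l1 IH] /=; first by rewrite cab scalerBl mulrBl subrACA.
by rewrite IH prod_sub scalerBr mulrBr subrACA.
Qed.

Lemma wick_subl x y l : wick_at x l -> wick_at y l -> wick_at (x - y) l.
Proof.
rewrite /wick_at mulrBl omegaB => -> ->; rewrite -omegaB; congr (omega _).
elim: l => [|z l /= IH] /=; first by rewrite subr0.
by rewrite -IH mulrBl omegaB scalerBl mulrBr subrACA.
Qed.

Lemma wick_subr x a b l1 l2 : wick_at x (l1 ++ a :: l2) -> wick_at x (l1 ++ b :: l2) ->
  wick_at x (l1 ++ (a - b) :: l2).
Proof.
rewrite /wick_at contraction_linear; last by rewrite mulrBr omegaB.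
by rewrite prod_sub mulrBr !omegaB => -> ->.
Qed.

(** Both sides of Wick's rule are linear in every letter: pass from the values of X to
    their differences one letter at a time. *)
Lemma wick_letters x l : gaussian_letter x -> {in l, forall y, gaussian_letter y} ->
  wick_at x l.
Proof.
move=> gx gl.
have base r f (l2 : seq (R * h)) l1 : 0 <= r -> (forall p, p \in l2 -> 0 <= p.1) ->
    {in l1, forall y, gaussian_letter y} ->
    wick_at (X r f) (l1 ++ [seq X p.1 p.2 | p <- l2]).
  move=> r0; elim/last_ind: l1 l2 => [|l1 a IH] l2 l20 gl1; first exact: wick_values.
  rewrite cat_rcons; have ga : gaussian_letter a by apply: gl1; rewrite mem_rcons mem_head.
  have gl1' : {in l1, forall y, gaussian_letter y}.
    by move=> y yl; apply: gl1; rewrite mem_rcons inE yl orbT.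
  elim: ga => [r' f' r'0|a' b' _ IHa _ IHb]; last exact: wick_subr.
  apply: (IH ((r', f') :: l2)) => // p; rewrite inE => /orP[/eqP->//|]; exact: l20.
elim: gx => [r f r0|a b _ IHa _ IHb]; last exact: wick_subl.
by have := base r f [::] l r0; rewrite cats0; apply.
Qed.

Variables (n : nat).
Implicit Types (F : extalg R[i] n) (x y : 'I_n -> A).

(** Gaussian integration by parts. In the induction on F a word stands in front of F,
    since a generator taken off F is appended to it; contracting with the letters of F
    amounts to the derivatives in the gradient. *)
Lemma wick_ibp x k F : (forall i, gaussian_letter (x i)) -> anticomm x ->
  omega (x k * ext_eval x F) =
  omega (ext_eval x (ext_grad (fun i j => omega (x i * x j)) k F)).
Proof.
move=> gx ax; pose C i j := omega (x i * x j).
pose w (l : seq 'I_n) := \prod_(i <- l) x i.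
pose ct l := contraction (fun z => omega (x k * z)) (map x l).
suff gen l : omega (x k * w l * ext_eval x F) =
    omega (ct l * ext_eval x F) +
    (-1) ^+ size l * omega (w l * ext_eval x (ext_grad C k F)).
  by have := gen [::]; rewrite /w /ct /= big_nil mulr1 !mul0r mul1r raddf0 add0r mul1r.
move: F l; apply: ext_ind => [a F H eF eH l|l|i F eF l].
- rewrite ext_grad_is_linear !ext_eval_is_linear.
  rewrite !mulrDr -!scalerAr !omegaD !omegaZ eF eH.
  by rewrite !mulrDr addrACA; congr (_ + _ + (_ + _)); rewrite mulrCA.
- rewrite ext_eval1 !mulr1.
  have -> : ext_grad C k 1 = 0 by rewrite /ext_grad big1 // => j _; rewrite ext_deriv1 scaler0.
  rewrite linear0 mulr0 linear0 mulr0 addr0.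
  have := @wick_letters (x k) (map x l) (gx k); rewrite /wick_at big_map; apply.
  by move=> y /mapP[j _ ->].
- have wr : w (rcons l i) = w l * x i by rewrite /w big_rcons.
  have cr : ct (rcons l i) = ct l * x i + ((-1) ^+ size l * C k i) *: w l.
    by rewrite /ct map_rcons contraction_rcons size_map big_map.
  have e1 := ext_eval_genM i F ax.
  have e2 := ext_eval_genM i (ext_grad C k F) ax.
  have := eF (rcons l i); rewrite wr cr size_rcons => e.
  rewrite e1 mulrA -[x k * w l * x i]mulrA e mulrDl omegaD -scalerAl omegaZ.
  rewrite -[ct l * x i * _]mulrA -addrA; congr (_ + _).
  rewrite ext_grad_gen raddfB /= e2 [ext_eval x (_ *: _)]linearZ /= mulrBr omegaB.
  rewrite -scalerAr omegaZ exprS mulN1r mulNr mulrBr mulrA; congr (_ - _).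
  by rewrite mulrA.
Qed.

Variables (s : R) (s0 : 0 <= s).

Lemma cexp_filtM a b : filt s a -> cexp A s (a * b) = a * cexp A s b.
Proof.
move=> fa; have [f1 _ _ _ _] := filt_sub A s0.
by have := cexp_bimod b s0 fa f1; rewrite !mulr1.
Qed.

Lemma cexp_Mfilt a b : filt s b -> cexp A s (a * b) = cexp A s a * b.
Proof.
move=> fb; have [f1 _ _ _ _] := filt_sub A s0.
by have := cexp_bimod a s0 f1 fb; rewrite !mul1r.
Qed.

(** The letters y of the past are pulled out of the conditional expectation as elements
    of the filtration, and the future ones are integrated by parts under the state. The
    factor ext_eval x F' collects the future letters already taken off F. *)
Lemma cexp_ibp x y k F F' : (forall i, gaussian_letter (x i)) -> anticomm x ->
  (forall i, future X s (x i)) -> (forall i, filt s (y i)) ->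
  (forall i j, y i * x j + x j * y i = 0) -> anticomm (fun i => y i + x i) ->
  let C i j := omega (x i * x j) in
  let yx i := y i + x i in
  cexp A s (x k * ext_eval x F' * ext_eval yx F) =
  cexp A s (ext_eval x (ext_grad C k F') * ext_eval yx F) +
  cexp A s (ext_eval x (ext_par F') * ext_eval yx (ext_grad C k F)).
Proof.
move=> gx ax fx fy yxc ayx C yx.
have fut H : future X s (ext_eval x H).
  move=> B sB EB; have [b1 bl bm _ _] := sB.
  by apply: ext_eval_closed => // i; exact: fx.
have cfut a : future X s a -> cexp A s a = omega a *: 1 by exact: (gbm_cexp_future X_gbm).
move: F F'; apply: ext_ind => [a F H eF eH F'|F'|i F eF F'].
- rewrite ext_grad_is_linear !ext_eval_is_linear.
  rewrite !mulrDr -!scalerAr !linearD !linearZ /= eF eH.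
  by rewrite scalerDr addrACA.
- rewrite ext_eval1 !mulr1.
  have -> : ext_grad C k 1 = 0 by rewrite /ext_grad big1 // => j _; rewrite ext_deriv1 scaler0.
  rewrite [ext_eval yx 0]linear0 mulr0 linear0 addr0.
  have e1 := ext_eval_genM k F' ax.
  rewrite -e1 !cfut //; congr (_ *: _); rewrite e1.
  exact: wick_ibp.
- have e1 := ext_eval_genM i F ayx.
  have e2 := ext_eval_genM i (ext_grad C k F) ayx.
  rewrite e1 ext_grad_gen raddfB /= e2 [ext_eval yx (_ *: _)]linearZ /=.
  have ex : cexp A s (x k * ext_eval x F' * (x i * ext_eval yx F)) =
      cexp A s (ext_eval x (ext_grad C k F') * (x i * ext_eval yx F)) +
      cexp A s (ext_eval x (ext_par F') *
        (C k i *: ext_eval yx F - x i * ext_eval yx (ext_grad C k F))).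
    have ev H : ext_eval x (H * ext_gen _ i) = ext_eval x H * x i.
      by rewrite ext_evalM // ext_eval_gen.
    have := eF (F' * ext_gen _ i).
    rewrite ext_grad_mul_gen ext_parM ext_par_geni mulrN.
    rewrite [ext_eval x (_ + _)]linearD [ext_eval x (- _)]linearN /= !ev [ext_eval x (_ *: _)]linearZ /=.
    rewrite !mulrA => ->; rewrite mulrDl linearD /= -addrA; congr (_ + _).
    rewrite mulrBr raddfB mulrA /= -!scalerAl -scalerAr; congr (_ + _).
    by rewrite mulNr raddfN.
  have yF H : y i * ext_eval x H = ext_eval x (ext_par H) * y i.
    by apply: ext_eval_par => // j; exact: yxc.
  have ey : cexp A s (x k * ext_eval x F' * (y i * ext_eval yx F)) =
      cexp A s (ext_eval x (ext_grad C k F') * (y i * ext_eval yx F)) -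
      cexp A s (ext_eval x (ext_par F') * (y i * ext_eval yx (ext_grad C k F))).
    have yx' H Z : ext_eval x H * (y i * Z) = y i * (ext_eval x (ext_par H) * Z).
      by rewrite !mulrA yF ext_parK.
    have xy' Z : x k * (y i * Z) = - (y i * (x k * Z)).
      by rewrite !mulrA -mulNr; congr (_ * _); apply/eqP; rewrite -addr_eq0 addrC yxc.
    rewrite -mulrA (yx' F') xy' raddfN /= (yx' (ext_grad C k F')) (yx' (ext_par F')).
    rewrite !(cexp_filtM _ (fy i)) (mulrA (x k)) eF -mulrBr -mulrN opprD.
    by rewrite ext_grad_par linearN /= mulNr linearN /= opprK.
  rewrite [yx i * ext_eval yx F]mulrDl mulrDr linearD /= ey ex.
  rewrite addrACA; congr (_ + _); first by rewrite mulrDr linearD.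
  rewrite -linearN -linearD /= -mulrN -mulrDr; congr (cexp A s (_ * _)).
  by rewrite mulrDl opprD addrCA.
Qed.

(** Both sides obey the same rule when F is multiplied by a generator, by cexp_ibp and
    by ext_heat_gen, and such a rule determines a linear map (ext_linear_uniq). *)
Lemma cexp_heat x y F : (forall i, gaussian_letter (x i)) -> anticomm x ->
  (forall i, future X s (x i)) -> (forall i, filt s (y i)) -> anticomm y ->
  (forall i j, y i * x j + x j * y i = 0) ->
  cexp A s (ext_eval (fun i => y i + x i) F) =
  ext_eval y (ext_heat (fun i j => omega (x i * x j)) F).
Proof.
move=> gx ax fx fy ay yx; pose C i j := omega (x i * x j).
have aC : antisym C.
  by move=> i j; apply/eqP; rewrite /C -addr_eq0 -omegaD ax raddf0.
have ayx := anticommD ay ax yx.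
move: F; apply: (ext_linear_uniq (C := C) (y := fun k a => y k * a)).
- by move=> a F H; rewrite ext_eval_is_linear linearP.
- by move=> a F H; rewrite ext_heat_is_linear ext_eval_is_linear.
- by rewrite ext_heat1 !ext_eval1 cexp1.
- move=> k F; have e1 := ext_eval_genM k F ayx; rewrite e1 mulrDl linearD /= cexp_filtM //.
  congr (_ + _).
  have /= := cexp_ibp k F 1 gx ax fx fy yx ayx.
  rewrite ext_par1 ext_eval1 mulr1 mul1r.
  have -> : ext_grad (fun i j => omega (x i * x j)) k 1 = 0.
    by rewrite /ext_grad big1 // => j _; rewrite ext_deriv1 scaler0.
  rewrite [ext_eval x 0]linear0 mul0r linear0 add0r => ->.
  rewrite /ext_grad [ext_eval _ (\sum_(j < n) _)]linear_sum linear_sum /=.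
  by apply: eq_bigr => j _; rewrite !linearZ.
- move=> k F; rewrite ext_heat_gen // linearD /= ext_eval_genM //; congr (_ + _).
  rewrite /ext_grad linear_sum; apply: eq_bigr => j _.
  by rewrite linearZ /= ext_heat_deriv.
Qed.

End Wick.

(** * Contractivity of conditional expectations *)

Section ComplexConj.
Variable R : realType.
Implicit Types z w : R[i].
Lemma conjD z w : (z + w)^* = z^* + w^*. Proof. exact: rmorphD. Qed.
Lemma conjM z w : (z * w)^* = z^* * w^*. Proof. exact: rmorphM. Qed.
Lemma conjN z : (- z)^* = - z^*. Proof. exact: rmorphN. Qed.
Lemma conjR (x : R) : (x%:C%C)^* = x%:C%C.
Proof. by rewrite conj_Creal // complex_real. Qed.
End ComplexConj.

Section HilbertTheory.
Variables (R : realType) (h : hilbertType R).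
Implicit Types (f g : h) (z : R[i]).

Lemma ipDr f g1 g2 : ip f (g1 + g2) = ip f g1 + ip f g2.
Proof. by have := ip_scalar f 1 g1 g2; rewrite scale1r mul1r. Qed.

Lemma ip0r f : ip f 0 = 0.
Proof.
have := ip_scalar f (-1) 0 0; rewrite scaler0 addr0 mulN1r => ->.
by rewrite addNr.
Qed.

Lemma ipZr f z g : ip f (z *: g) = z * ip f g.
Proof. by have := ip_scalar f z g 0; rewrite ip0r !addr0. Qed.

Lemma ipDl f1 f2 g : ip (f1 + f2) g = ip f1 g + ip f2 g.
Proof. by rewrite (ip_conj g (f1 + f2)) ipDr conjD -!ip_conj. Qed.

Lemma ipZl z f g : ip (z *: f) g = z^* * ip f g.
Proof. by rewrite (ip_conj g (z *: f)) ipZr conjM -ip_conj. Qed.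

Lemma ipNr f g : ip f (- g) = - ip f g.
Proof. by rewrite -scaleN1r ipZr mulN1r. Qed.

Lemma ipNl f g : ip (- f) g = - ip f g.
Proof. by rewrite (ip_conj g (- f)) ipNr conjN -ip_conj. Qed.

Lemma ip0l g : ip 0 g = 0.
Proof. by rewrite ip_conj ip0r conjC0. Qed.

Lemma ip_sumr (I : Type) (r : seq I) (P : pred I) f (F : I -> h) :
  ip f (\sum_(i <- r | P i) F i) = \sum_(i <- r | P i) ip f (F i).
Proof. by elim/big_rec2: _ => [|i y1 y2 _ <-]; rewrite ?ip0r ?ipDr. Qed.

Lemma ip_suml (I : Type) (r : seq I) (P : pred I) g (F : I -> h) :
  ip (\sum_(i <- r | P i) F i) g = \sum_(i <- r | P i) ip (F i) g.
Proof. by elim/big_rec2: _ => [|i y1 y2 _ <-]; rewrite ?ip0l ?ipDl. Qed.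

Lemma ipE f : ip f f = (rn f ^+ 2)%:C%C.
Proof. by rewrite -ip_norm rnE rmorphXn. Qed.

Lemma rn_mul_conj z : z * z^* = (rn z ^+ 2)%:C%C.
Proof. by rewrite -normCK rnE rmorphXn. Qed.

Lemma cauchy_schwarz f g : rn (ip f g) <= rn f * rn g.
Proof.
set w := ip f g.
have key (s : R) : 0 <= rn f ^+ 2 - 2 * s * rn w ^+ 2 + s ^+ 2 * rn w ^+ 2 * rn g ^+ 2.
  have := sqr_ge0 (rn (f - (s%:C%C * w^*) *: g)).
  rewrite -lecR -ipE ipDl !ipDr !ipNr !ipNl !ipZl !ipZr -/w (ip_conj f g) -/w !ipE.
  rewrite conjM conjCK conjR.
  set u := _ + _ + _; suff -> : u = (rn f ^+ 2 - 2 * s * rn w ^+ 2 + s ^+ 2 * rn w ^+ 2 * rn g ^+ 2)%:C%C by rewrite lecR.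
  have e : w * w^* = (rn w)%:C%C ^+ 2 by rewrite rn_mul_conj rmorphXn.
  rewrite /u; set W := w^* in e *.
  rewrite !(rmorphB, rmorphD, rmorphM, rmorphXn) /= ?rmorph_nat.
  by ring: e.
have [g0|g0] := eqVneq (rn g) 0.
  have w2 : rn w ^+ 2 = 0.
    apply/eqP; rewrite eq_le sqr_ge0 andbT leNgt; apply/negP => w0.
    have := key ((rn f ^+ 2 + 1) / rn w ^+ 2); rewrite g0 expr0n /= mulr0 addr0.
    rewrite -mulrA divfK ?gt_eqF //; have := sqr_ge0 (rn f); lra.
  by rewrite g0 mulr0; move/eqP: w2; rewrite sqrf_eq0 => /eqP->.
rewrite -ler_sqr ?nnegrE ?mulr_ge0 ?rn_ge0 // exprMn.
have g2 : 0 < rn g ^+ 2 by rewrite exprn_gt0 // lt_def g0 rn_ge0.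
have := key ((rn g ^+ 2)^-1).
have -> : ((rn g ^+ 2)^-1) ^+ 2 * rn w ^+ 2 * rn g ^+ 2 = (rn g ^+ 2)^-1 * rn w ^+ 2.
  by field; rewrite g0.
have -> : rn f ^+ 2 - 2 * (rn g ^+ 2)^-1 * rn w ^+ 2 + (rn g ^+ 2)^-1 * rn w ^+ 2 =
  rn f ^+ 2 - rn w ^+ 2 / rn g ^+ 2 by ring.
by rewrite subr_ge0 ler_pdivrMr.
Qed.
End HilbertTheory.

Section CStarTheory.
Variables (R : realType) (A : cstarAlgType R).
Implicit Types a b x y : A.

Lemma star1 : star (1 : A) = 1.
Proof. by have := starM (star 1) (1 : A); rewrite mulr1 starK mulr1. Qed.

Lemma starN a : star (- a) = - star a.
Proof. by rewrite -scaleN1r starZ rmorphN1 scaleN1r. Qed.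

Lemma starB a b : star (a - b) = star a - star b.
Proof. by rewrite starD starN. Qed.

(** If y is a fixed point then 1 - y is a square root of 1 - x. The map preserves the
    ball of radius rn x, and multiplies distances in it by at most rn x. *)
Definition sqrt_step x y := 2^-1 *: (x + y * y).

Lemma sqrt_step_ball x y : rn x <= 1 -> rn y <= rn x -> rn (sqrt_step x y) <= rn x.
Proof.
move=> x1 yx; rewrite /sqrt_step rnZ rnV rn_nat.
have h1 := rnD x (y * y); have h2 := rn_mul y y; have := rn_ge0 y; have := rn_ge0 x.
have : rn y * rn y <= rn x * 1 by rewrite ler_pM ?rn_ge0 // (le_trans yx).
lra.
Qed.

Lemma sqrt_step_contract x y z : rn y <= rn x -> rn z <= rn x ->
  rn (sqrt_step x y - sqrt_step x z) <= rn x * rn (y - z).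
Proof.
move=> yx zx; rewrite /sqrt_step -scalerBr rnZ rnV rn_nat.
have -> : x + y * y - (x + z * z) = y * (y - z) + (y - z) * z.
  by rewrite mulrBr mulrBl opprD addrACA subrr add0r addrA addrNK.
have h := rnD (y * (y - z)) ((y - z) * z).
have h1 := rn_mul y (y - z); have h2 := rn_mul (y - z) z.
have : rn y * rn (y - z) <= rn x * rn (y - z) by rewrite ler_wpM2r ?rn_ge0.
have : rn (y - z) * rn z <= rn x * rn (y - z) by rewrite mulrC ler_wpM2r ?rn_ge0.
lra.
Qed.

Lemma rn_arbitrarily_small a (K : R) : (forall e : R, 0 < e -> rn a <= K * e) -> a = 0.
Proof.
move=> ae; apply: rn_le0; rewrite leNgt; apply/negP => a0.
have [K0|K0] := leP K 0.
  by have := ae 1 ltr01; rewrite mulr1 => /(lt_le_trans a0); rewrite ltNge K0.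
have := ae (rn a / (2 * K)) _; rewrite divr_gt0 ?mulr_gt0 // => /(_ isT).
have -> : K * (rn a / (2 * K)) = rn a / 2 by field; rewrite gt_eqF.
lra.
Qed.

Fixpoint sqrt_iter x k := if k is k'.+1 then sqrt_step x (sqrt_iter x k') else 0.

Lemma sqrt_iter_ball x k : rn x <= 1 -> rn (sqrt_iter x k) <= rn x.
Proof. by move=> x1; elim: k => [|k IH] /=; rewrite ?rn0 ?rn_ge0 ?sqrt_step_ball. Qed.

Lemma sqrt_iter_cauchy x k j : rn x <= 1 ->
  rn (sqrt_iter x (k + j) - sqrt_iter x k) <= rn x ^+ k.
Proof.
move=> x1; elim: k => [|k IH].
  by rewrite subr0 expr0 (le_trans (sqrt_iter_ball _ x1)).
rewrite addSn /= exprS; apply: le_trans (sqrt_step_contract _ _) _; try exact: sqrt_iter_ball.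
by rewrite ler_wpM2l ?rn_ge0.
Qed.

Lemma sqrt_one_sub x : rn x < 1 -> star x = x -> exists2 d : A, star d = d & d * d = 1 - x.
Proof.
move=> x1 sx; have x1' := ltW x1.
have pow (e : R) : 0 < e -> exists N, rn x ^+ N < e.
  move=> e0; have : (fun k => rn x ^+ k) @ \oo --> (0 : R).
    by apply: cvg_expr; rewrite ger0_norm ?rn_ge0.
  move=> /cvgrPdist_lt/(_ e e0)[N _ /(_ N (leqnn N))] /=.
  by rewrite sub0r normrN ger0_norm ?exprn_ge0 ?rn_ge0 // => h; exists N.
have [|y Hy] := cnorm_complete (sqrt_iter x).
  move=> e e0; have e0' : 0 < complex.Re e.
    by move: e0; case: (e) => a b; rewrite ltcE /= => /andP[].
  have ee : e = (complex.Re e)%:C%C.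
    by move: e0; case: (e) => a b; rewrite ltcE /= => /andP[/eqP-> _].
  have [N HN] := pow (complex.Re e / 2) (divr_gt0 e0' (ltr0Sn _ 1)).
  exists N => m k Nm Nk; rewrite ee; have /= -> := rn_ltP (sqrt_iter x m - sqrt_iter x k).
  have h1 := sqrt_iter_cauchy N (m - N) x1'; have h2 := sqrt_iter_cauchy N (k - N) x1'.
  rewrite !subnKC // in h1 h2.
  have := rnB (sqrt_iter x m - sqrt_iter x N) (sqrt_iter x k - sqrt_iter x N).
  rewrite opprB addrA addrNK; lra.
have {}Hy (e : R) : 0 < e -> exists N, forall m, (N <= m)%N -> rn (y - sqrt_iter x m) < e.
  move=> e0; have [|N HN] := Hy (e%:C%C); first by rewrite ltcR.
  by exists N => m /HN; have /= -> := rn_ltP (y - sqrt_iter x m).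
have yx : rn y <= rn x.
  apply/ler_addgt0Pr => e e0; have [N /(_ N (leqnn N))] := Hy e e0.
  have := rnD (y - sqrt_iter x N) (sqrt_iter x N); rewrite subrK.
  have := sqrt_iter_ball N x1'; lra.
have fix_y : y = sqrt_step x y.
  apply/eqP; rewrite -subr_eq0; apply/eqP/(@rn_arbitrarily_small _ 2) => e e0.
  have [N HN] := Hy e e0; have h1 := HN N.+1 (leqnSn N); have h2 := HN N (leqnn N).
  have h3 := sqrt_step_contract yx (sqrt_iter_ball N x1').
  have h4 := rnB (y - sqrt_iter x N.+1) (sqrt_step x y - sqrt_step x (sqrt_iter x N)).
  have e4 : y - sqrt_iter x N.+1 - (sqrt_step x y - sqrt_step x (sqrt_iter x N)) =
     y - sqrt_step x y by rewrite /= opprB addrA subrK.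
  rewrite e4 in h4.
  have : rn x * rn (y - sqrt_iter x N) <= 1 * rn (y - sqrt_iter x N).
    by rewrite ler_wpM2r ?rn_ge0.
  lra.
have sit k : star (sqrt_iter x k) = sqrt_iter x k.
  elim: k => [|k IH] /=; first by have := starB 0 0; rewrite !subrr.
  by rewrite /sqrt_step starZ starD starM IH sx fmorphV rmorph_nat.
have sy : star y = y.
  apply/eqP; rewrite -subr_eq0; apply/eqP/(@rn_arbitrarily_small _ 2) => e e0.
  have [N HN] := Hy e e0; have h2 := HN N (leqnn N).
  have := rnB (star (y - sqrt_iter x N)) (y - sqrt_iter x N).
  rewrite rn_star starB sit opprB addrA subrK; lra.
exists (1 - y); first by rewrite starB star1 sy.
have e2 : y + y = x + y * y.
  by rewrite {1 2}fix_y /sqrt_step -scalerDl -[X in X + _]div1r -[X in _ + X]div1r -splitr scale1r.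
have ex : x = y + y - y * y by rewrite e2 addrK.
by rewrite ex mulrBl mul1r mulrBr mulr1 !opprB -addrA; congr (_ + _); rewrite addrCA -opprD.
Qed.

Section Rep.
Variables (H : hilbertType R) (rho : operator_rep A H).
Implicit Types u w : H.

Lemma repD a b u : rep rho (a + b) u = rep rho a u + rep rho b u.
Proof. by have := rep_linear_op rho u 1 a b; rewrite /= !scale1r. Qed.

Lemma repB a b u : rep rho (a - b) u = rep rho a u - rep rho b u.
Proof. by rewrite addrC -scaleN1r (rep_linear_op rho u) scaleN1r addrC. Qed.

Lemma rn_rep a u : rn (rep rho a u) <= rn a * rn u.
Proof.
have [h _] := rep_norm rho a (normr_ge0 a).
by have := h (lexx _) u; rewrite !rnE -rmorphM lecR.
Qed.

Lemma rn_rep_le a (c : R) : 0 <= c -> (forall u, rn (rep rho a u) <= c * rn u) -> rn a <= c.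
Proof.
move=> c0 ac; rewrite -rn_leP; apply/(rep_norm rho); first by rewrite lecR.
by move=> u; rewrite !rnE -rmorphM lecR.
Qed.

Lemma ip_rep_star a u : ip u (rep rho (star a * a) u) = (rn (rep rho a u) ^+ 2)%:C%C.
Proof. by rewrite repM rep_star starK ipE. Qed.

End Rep.
End CStarTheory.

Section CondExp.
Variables (R : realType) (A : fnps R) (t : R).
Hypothesis t0 : 0 <= t.
Local Notation E := (cexp A t).
Implicit Types a b : A.

Lemma cexp_sa a : star (E (star a * a)) = E (star a * a).
Proof.
have [b ->] := cexp_ge0 t0 (ex_intro (fun b => star a * a = star b * b) a erefl).
by rewrite starM starK.
Qed.

(** Polarisation: the expectation of star c * c is self-adjoint for c = a + z *: 1, and
    the values z = 1 and z = 'i separate a from its adjoint. *)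
Lemma cexp_star a : star (E a) = E (star a).
Proof.
have p z : star (E (star (a + z *: 1) * (a + z *: 1))) = E (star (a + z *: 1) * (a + z *: 1)).
  exact: cexp_sa.
have ex z : star (a + z *: 1) * (a + z *: 1) =
    star a * a + (z *: star a + z^* *: a) + (z^* * z) *: 1.
  rewrite starD starZ star1 mulrDl !mulrDr -!scalerAl -!scalerAr !mul1r mulr1 scalerA.
  by rewrite !addrA.
have q z : star (E (z *: star a + z^* *: a)) = E (z *: star a + z^* *: a).
  have := p z; rewrite ex !linearD /= !starD cexp_sa.
  have -> : star (E ((z^* * z) *: 1)) = E ((z^* * z) *: 1).
    by rewrite linearZ /= cexp1 // starZ star1 conjM conjCK mulrC.
  by move=> /addIr /addrI.
have := q 1; rewrite conjC1 !scale1r linearD /= starD => e1.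
have := q 'i; rewrite conjCi scaleNr -scalerBr linearZ /= starZ conjCi.
rewrite linearB starB /= scaleNr -scalerN => /(scalerI (neq0Ci _)).
rewrite opprB => e2.
have : star (E a) + star (E a) = E (star a) + E (star a).
  rewrite -{1}[star (E a)](addrK (star (E (star a)))) [star (E a) + _]addrC e1.
  by rewrite -addrA [- _ + _]addrC e2 addrACA subrr addr0.
move=> e3; apply: (@scalerI _ _ (2 : R[i])); first by rewrite pnatr_eq0.
by rewrite !scaler_nat !mulr2n.
Qed.

(** The Kadison-Schwarz inequality E(b)^* E(b) <= E(b^* b), which the module property
    gives, bounds E(b)^* E(b) by 1 as soon as 1 - b^* b is a square. *)
Lemma rn_cexp a : rn (E a) <= rn a.
Proof.
have one b : rn b < 1 -> rn (E b) <= 1.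
  move=> b1; have b2 : rn (star b * b) < 1 by rewrite rn_starM expr_lt1 ?rn_ge0.
  have [|d sd dd] := sqrt_one_sub b2; first by rewrite starM starK.
  have [e He] := cexp_ge0 t0 (ex_intro (fun c => star d * d = star c * c) d erefl).
  pose g := b - E b.
  have [f Hf] := cexp_ge0 t0 (ex_intro (fun c => star g * g = star c * c) g erefl).
  have fE : filt t (E b) by exact: cexp_in.
  have fE' : filt t (star (E b)) by have [_ _ _ + _] := filt_sub A t0; apply.
  have Eg : E (star g * g) = E (star b * b) - star (E b) * E b.
    rewrite /g starB mulrBl !mulrBr !linearB /=.
    rewrite (cexp_Mfilt t0 (star b) fE) (cexp_filtM t0 b fE') (cexp_filtM t0 (E b) fE') -!cexp_star.
    have -> : E (E b) = E b by have := cexp_filtM t0 (1 : A) fE; rewrite cexp1 // !mulr1.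
    by rewrite opprK addNr addr0.
  have sumE : 1 - star (E b) * E b = star e * e + star f * f.
    by rewrite -He -Hf Eg sd dd linearB /= cexp1 // addrA subrK.
  apply: (rn_rep_le (rho := nc_rep A) ler01) => u; rewrite mul1r.
  rewrite -ler_sqr ?nnegrE ?rn_ge0 // -subr_ge0 -lecR rmorphB /= -(ip_rep_star (nc_rep A)).
  have -> : (rn u ^+ 2)%:C%C = ip u (rep (nc_rep A) 1 u) by rewrite rep1 ipE.
  rewrite -ipNr -ipDr -repB sumE repD ipDr !ip_rep_star -rmorphD lecR.
  by rewrite addr_ge0 ?sqr_ge0.
apply/ler_addgt0Pr => e e0; have c0 : 0 < rn a + e by rewrite ltr_wpDl ?rn_ge0.
have i0 : 0 < (rn a + e)^-1 by rewrite invr_gt0.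
have := one ((rn a + e)^-1%:C%C *: a).
rewrite linearZ /= !rnZ rn_real (gtr0_norm i0) ![_^-1 * _]mulrC ltr_pdivrMr // ler_pdivrMr //.
by rewrite !mul1r ltrDl e0 => /(_ isT).
Qed.

End CondExp.

(** * The fundamental theorem of calculus for one-sided derivatives *)

Section FTC.
Variable R : realType.
Local Notation mu := (@lebesgue_measure R).
Implicit Types (f g h Phi : R -> R) (a b e : R).

(** The set of the points up to which the bound holds is closed, as h has no upward jump
    from the left and Phi is monotone, and it is open to the right by the last
    hypothesis; hence it is the whole interval. *)
Lemma right_growth h Phi a b : a <= b ->
  (forall x, a < x <= b -> forall e, 0 < e ->
     exists2 d, 0 < d & forall y, a <= y -> x - d < y <= x -> h x <= h y + e) ->
  (forall x y, a <= x <= y -> y <= b -> Phi x <= Phi y) ->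
  (forall x, a <= x < b -> exists2 d, 0 < d &
     forall y, x < y <= b -> y < x + d -> h y - h x <= Phi y - Phi x) ->
  h b - h a <= Phi b - Phi a.
Proof.
move=> ab hl mPhi loc; pose S := [set x | a <= x <= b /\ h x - h a <= Phi x - Phi a].
have Sa : S a by split; rewrite ?lexx ?ab // !subrr.
have Sb : ubound S b by move=> x [/andP[]].
have supS : has_sup S by split; [exists a|exists b].
set s := sup S.
have as_ : a <= s by apply: ub_le_sup => //; exists b.
have sb : s <= b by apply: ge_sup => //; exists a.
have Ss : h s - h a <= Phi s - Phi a.
  have [<-|sa] := eqVneq a s; first by rewrite !subrr.
  have {sa}sa : a < s by rewrite lt_neqAle sa.
  apply/ler_addgt0Pr => e e0.
  have [|d d0 hd] := hl s _ e e0; first by rewrite sa sb.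
  have [x [/andP[ax xb] Sx] dx] := sup_adherent d0 supS.
  have xs : x <= s by apply: ub_le_sup; [exists b|split; rewrite ?ax].
  have := hd x ax; rewrite dx xs => /(_ isT).
  have := mPhi x s; rewrite ax xs => /(_ isT sb); lra.
have [sb'|bs] := ltP s b; last by have <- : s = b by apply/eqP; rewrite eq_le sb bs.
have [|d d0 hd] := loc s; first by rewrite as_ sb'.
pose y := Num.min b (s + d / 2).
have sy : s < y by rewrite lt_min sb' ltrDl divr_gt0.
have yb : y <= b by rewrite ge_min lexx.
have yd : y < s + d.
  by rewrite gt_min; apply/orP; right; rewrite ltrD2l ltr_pdivrMr // mulr_natr mulr2n ltrDl.
have := hd y; rewrite sy yb => /(_ isT yd) hy.
suff : S y by move=> /(ub_le_sup (ex_intro _ b Sb)); rewrite leNgt sy.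
by split; [rewrite (le_trans as_ (ltW sy)) yb | lra].
Qed.

Lemma mitv (i : interval R) : measurable ([set` i] : set (measurableTypeR R)).
Proof. exact: measurable_itv. Qed.

Local Open Scope ereal_scope.

(** Cover N by open sets V k of u-mass at most e / 2 ^ (k + 1), and let Phi be the
    integral of the sum over k of u restricted to V k. Near a point of N the first m of
    these sets overlap, so that Phi grows there at least m times as fast as the integral
    of u. *)
Lemma null_cover (N : set R) (u : R -> R) e : measurable N -> mu N = 0 ->
  mu.-integrable setT (EFin \o u) -> (forall x, 0 <= u x)%R -> (0 < e)%R ->
  exists Phi, [/\ (forall x y, x <= y -> Phi x <= Phi y)%R,
    (forall x y, Phi y - Phi x <= e)%R &
    forall x, N x -> forall m : nat, exists2 d : R, (0 < d)%R &
      forall y, (x < y < x + d)%R ->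
      (m%:R * Rintegral mu `]x, y] u <= Phi y - Phi x)%R].
Proof.
move=> mN N0 iu u0 e0.
have mu_ : measurable_fun setT u by case/integrableP: iu => /measurable_EFinP.
have /choice[V HV] : forall k : nat, exists V : set R, [/\ open V, N `<=` V &
    \int[mu]_(x in V) (u x)%:E <= (e / (2 ^ k.+1)%:R)%:E].
  move=> k; have ek : (0 < e / (2 ^ k.+1)%:R)%R by rewrite divr_gt0 // ltr0n expn_gt0.
  have [d [d0 Hd]] := integral_normr_continuous iu ek.
  have Nfin : mu N < +oo by rewrite N0.
  have [V [oV NV Vd]] := lebesgue_regularity_outer mN Nfin d0.
  exists V; split=> //; have mV := open_measurable oV.
  have VN : mu V < d%:E.
    have le : mu V <= mu N + mu (V `\` N).
      by rewrite -{1}(setDUK NV); apply: measureU2 => //; exact: measurableD.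
    by apply: le_lt_trans le _; rewrite N0 add0e.
  have iV : mu.-integrable V (EFin \o u) by apply: integrableS iu.
  have := ltW (Hd V mV VN); rewrite -lee_fin => /(le_trans _); apply.
  rewrite (_ : Rintegral _ _ _ = Rintegral mu V u); last first.
    by apply: eq_Rintegral => x _; rewrite ger0_norm.
  by rewrite /Rintegral fineK //; exact: integrable_fin_num.
pose f k x := (u x)%:E * (\1_(V k) x)%:E.
have mV k : measurable (V k) by have [oV _ _] := HV k; exact: open_measurable.
have f0 k x : 0 <= f k x by rewrite /f mule_ge0 // lee_fin.
have mf k : measurable_fun setT (f k).
  apply: emeasurable_funM; first exact/measurable_EFinP.
  by apply/measurable_EFinP; exact: measurable_indic.
pose W x := \sum_(k <oo) f k x.
have W0 x : 0 <= W x by apply: nneseries_ge0 => k _ _; exact: f0.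
have mW : measurable_fun setT W by apply: ge0_emeasurable_sum => // k x _ _; exact: f0.
have intW : \int[mu]_x W x <= e%:E.
  rewrite /W integral_nneseries //.
  apply: le_trans (epsilon_trick0 xpredT (ltW e0)).
  apply: lee_nneseries => [k _ _|k _]; first by apply: integral_ge0.
  have [_ _] := HV k; apply: le_trans; rewrite le_eqVlt; apply/orP; left; apply/eqP.
  rewrite [RHS]integral_mkcond; apply: eq_integral => x _.
  rewrite /f patchE indicE; by case: (x \in V k); rewrite ?mule1 ?mule0.
have subW (B C : set R) : measurable B -> measurable C -> B `<=` C ->
    \int[mu]_(x in B) W x <= \int[mu]_(x in C) W x.
  by move=> mB mC BC; apply: ge0_subset_integral => //; exact: measurable_funTS.
have fW (B : set R) : measurable B -> \int[mu]_(x in B) W x \is a fin_num.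
  move=> mB; rewrite ge0_fin_numE; last by apply: integral_ge0.
  apply: le_lt_trans (subW B setT mB measurableT _) _ => //.
  by rewrite (le_lt_trans intW) // ltry.
pose Phi x := fine (\int[mu]_(z in `]-oo, x]) W z).
have diff x y : (x <= y)%R -> (Phi y - Phi x)%R = fine (\int[mu]_(z in `]x, y]) W z).
  move=> xy; rewrite /Phi.
  have -> : \int[mu]_(z in `]-oo, y]) W z =
      \int[mu]_(z in `]-oo, x]) W z + \int[mu]_(z in `]x, y]) W z.
    rewrite (@itv_bndbnd_setU _ _ -oo%O (BRight x) (BRight y)) ?bnd_simp //.
    rewrite ge0_integral_setU //; first exact: measurable_funTS.
    by apply: lt_disjoint => z w; rewrite !in_itv /= => zx /andP[xw _]; exact: le_lt_trans xw.
  by rewrite fineD ?fW // addrC addKr.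
exists Phi; split.
- move=> x y xy; rewrite -subr_ge0 diff //; apply: fine_ge0; exact: integral_ge0.
- move=> x y; have [xy|yx] := leP x y; last first.
    have : (0 <= Phi x - Phi y)%R by rewrite diff ?(ltW yx) //; apply: fine_ge0; exact: integral_ge0.
    by move=> h; rewrite (le_trans _ (ltW e0)) // -oppr_ge0 opprB.
  rewrite diff // -lee_fin fineK ?fW //.
  by apply: le_trans (subW _ setT _ _ _) intW.
- move=> x Nx m.
  have [d d0 Hd] : exists2 d : R, (0 < d)%R &
      forall k z, (k < m)%N -> (`|x - z| < d)%R -> V k z.
    elim: m => [|m [d d0 IH]]; first by exists 1%R.
    have [oV NV _] := HV m; have := open_nbhs_nbhs (conj oV (NV _ Nx)).
    move=> /nbhs_ballP[d' /= d'0 Hd']; exists (Num.min d d'); first by rewrite lt_min d0.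
    move=> k z; rewrite ltnS leq_eqVlt lt_min => /orP[/eqP->|km] /andP[zd zd'].
      exact: Hd'.
    exact: IH.
  exists d => // y /andP[xy yd]; rewrite diff ?(ltW xy) //.
  have ixy : mu.-integrable `]x, y] (EFin \o u) by apply: integrableS iu.
  have ixm : mu.-integrable `]x, y] (fun z => (m%:R * u z)%:E).
    by have := @integrableZl _ _ _ mu `]x, y]%classic (mitv _) m%:R _ ixy.
  rewrite -RintegralZl // /Rintegral fine_le ?fW //; first exact: integrable_fin_num.
  apply: ge0_le_integral => //.
  + by move=> z _; rewrite lee_fin mulr_ge0.
  + by apply/measurable_EFinP; apply: measurable_funTS; exact: measurable_funM.
  + exact: measurable_funTS.
  + move=> z /=; rewrite in_itv /= => /andP[xz zy].
    apply: le_trans (nneseries_lim_ge m _); last by move=> k _ _; exact: f0.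
    rewrite big_mkord (eq_bigr (fun=> (u z)%:E)) => [|k _]; last first.
      rewrite /f indicE mem_set ?mule1 //; apply: Hd => //.
      by rewrite distrC gtr0_norm ?subr_gt0 // ltrBlDl (le_lt_trans zy).
    by rewrite sumEFin sumr_const card_ord mulr_natl lexx.
Qed.
Local Close Scope ereal_scope.

Definition left_continuous_on f a b := forall x, a < x <= b -> forall e, 0 < e ->
  exists2 d, 0 < d & forall y, a <= y -> x - d < y <= x -> `|f x - f y| <= e.

Definition right_derivative_on f g a b := forall x, a <= x < b -> forall e, 0 < e ->
  exists2 d, 0 < d & forall y, x < y <= b -> y < x + d ->
    `|f y - f x - g x * (y - x)| <= e * (y - x).

Lemma Rintegral_split g a x y : a <= x -> x <= y ->
  mu.-integrable `[a, y] (EFin \o g) ->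
  Rintegral mu `[a, y] g = Rintegral mu `[a, x] g + Rintegral mu `]x, y] g.
Proof.
move=> ax xy ig.
by rewrite -(Rintegral_itvB (a := BLeft a) (b := BRight y) (x := x)) ?bnd_simp // subrKC.
Qed.

(** Let F be the integral of g. Outside a null set F has derivative g, and f - F grows
    at an arbitrarily small rate. At a point of the null set the derivative of f is
    still finite, so that f - F grows at most like a multiple of the integral of 1 +
    |g|, and null_cover provides an increasing function of small total variation that
    grows faster. By right_growth f - F does not grow. *)
Lemma le_increment_Rintegral f g a b : a <= b ->
  mu.-integrable `[a, b] (EFin \o g) ->
  left_continuous_on f a b -> right_derivative_on f g a b ->
  f b - f a <= Rintegral mu `[a, b] g.
Proof.
move=> ab ig lf rf.
have mab : measurable (`[a, b]%classic : set (measurableTypeR R)) by [].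
pose gab := g \_ `[a, b].
have igab : mu.-integrable setT (EFin \o gab).
  by have := (integrable_mkcond (mu := mu) _ mab).1 ig; rewrite restrict_EFin.
pose u := (fun x => 1 + `|g x|) \_ `[a, b].
have i1 : mu.-integrable `[a, b] (EFin \o (fun=> 1 : R)).
  by apply: continuous_compact_integrable; [exact: segment_compact|exact: continuous_subspaceT (@cst_continuous _ _ _)].
have iu1 : mu.-integrable `[a, b] (fun x => (1 + `|g x|)%:E).
  have i2 := integrable_abse ig.
  have i3 := integrableD mab i1 i2.
  by apply: eq_integrable i3.
have iu : mu.-integrable setT (EFin \o u).
  by have := (integrable_mkcond (mu := mu) _ mab).1 iu1; rewrite restrict_EFin.
have u0 x : 0 <= u x by rewrite /u patchE; case: ifP => // _; rewrite addr_ge0.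
pose F y := Rintegral mu `[a, y] gab.
have FE y : y <= b -> F y = Rintegral mu `[a, y] g.
  move=> yb; apply: eq_Rintegral => x; rewrite inE /= in_itv /= => /andP[ax xy].
  by rewrite /gab mem_set //= in_itv /= ax (le_trans xy).
have Fd x y : a <= x -> x <= y -> F y - F x = Rintegral mu `]x, y] gab.
  move=> ax xy; have igay : mu.-integrable `[a, y] (EFin \o gab).
    by apply: integrableS igab.
  by rewrite /F (Rintegral_split ax xy igay) addrAC subrr add0r.
have iF y : mu.-integrable [set` Interval (BLeft a) (BRight y)] (EFin \o gab).
  by apply: integrableS igab.
have lF : locally_integrable [set: R] gab by exact: integrable_locally.
have [N0 [mN0 muN0 HN0]] := FTC1 iF lF.
pose N := N0 `|` [set a].
have mN : measurable N by apply: measurableU.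
have muN : mu N = 0%E.
  have le : (mu N <= mu N0 + mu [set a])%E by apply: measureU2.
  by apply/eqP; rewrite -measure_le0; apply: le_trans le _; rewrite muN0 lebesgue_measure_set1 add0e.
rewrite -subr_le0 -FE //; apply/ler_addgt0Pr => e e0; rewrite add0r.
pose e1 := e / (1 + (b - a)).
have ba1 : 0 < 1 + (b - a) by rewrite ltr_pwDl // subr_ge0.
have e10 : 0 < e1 by rewrite divr_gt0.
have [Phi [mPhi dPhi HPhi]] := null_cover mN muN iu u0 e10.
have Faa : F a = 0 by rewrite FE // set_itv1 Rintegral_set1.
suff : (f b - F b) - (f a - F a) <= (Phi b + e1 * b) - (Phi a + e1 * a).
  rewrite Faa subr0 => hb; have := dPhi a b.
  have : e1 * (1 + (b - a)) = e by rewrite /e1 divfK // gt_eqF.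
  move: hb; rewrite mulrDr mulrBr mulr1; lra.
apply: (right_growth (h := fun x => f x - F x) (Phi := fun x => Phi x + e1 * x)) => //.
- move=> x xab e2 e20; have e22 : 0 < e2 / 2 by rewrite divr_gt0.
  have [d d0 Hd] := lf x xab _ e22.
  have [d' [d'0 Hd']] := integral_normr_continuous igab e22.
  exists (Num.min d d'); first by rewrite lt_min d0.
  move=> y ay /andP[xy yx].
  have xyd : x - y < Num.min d d' by move: xy; rewrite ltrBlDr -ltrBlDl.
  move: xyd; rewrite lt_min => /andP[xyd xyd'].
  have := Hd y ay; rewrite yx andbT ltrBlDr -ltrBlDl => /(_ xyd).
  have mu_xy : (mu `]y, x]%classic < d'%:E)%E.
    rewrite lebesgue_measure_itv /= lte_fin; case: ifP => _; last by rewrite lte_fin.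
    by rewrite -EFinB lte_fin.
  have := Hd' _ (mitv _) mu_xy.
  have igxy : mu.-integrable `]y, x] (EFin \o gab) by apply: integrableS igab.
  have := le_normr_Rintegral (mitv _) igxy.
  rewrite -Fd // !ler_norml => /andP[h1 h2] h3 /andP[h4 h5]; lra.
- move=> x y /andP[ax xy] yb; apply: lerD; first exact: mPhi.
  by rewrite ler_wpM2l // ltW.
- move=> x /andP[ax xb]; have [xN|xN] := pselect (N x); last first.
    have ax' : a < x.
      by rewrite lt_neqAle ax andbT; apply: contra_notN xN => /eqP <-; right.
    have [dF F'] : derivable F x 1 /\ F^`()%classic x = gab x.
      apply: contrapT => hx; apply: xN; left; apply: HN0 => /= hx'; apply: hx.
      by apply: hx'; rewrite lte_fin.
    have gx : gab x = g x by rewrite /gab patchE mem_set //= in_itv /= ax ltW.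
    have e12 : 0 < e1 / 2 by rewrite divr_gt0.
    have [d1 d10 Hd1] := rf x (introT andP (conj ax xb)) _ e12.
    have cF : h^-1 *: (F (h *: 1 + x) - F x) @[h --> 0^'] --> g x.
      by rewrite -gx -F' derive1E.
    move/cvgrPdist_le/(_ _ e12): cF => [d2 /= d20 Hd2].
    exists (Num.min d1 d2); first by rewrite lt_min d10.
    move=> y /andP[xy yb]; rewrite -ltrBlDl lt_min !ltrBlDl => /andP[yd1 yd2].
    have := Hd1 y; rewrite xy yb => /(_ isT yd1).
    have y0 : 0 < y - x by rewrite subr_gt0.
    have /= := Hd2 (y - x); rewrite sub0r normrN gtr0_norm // ltrBlDl => /(_ yd2).
    rewrite gt_eqF // => /(_ isT); rewrite /GRing.scale /= mulr1 subrK => h1.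
    have eq1 : g x * (y - x) - (F y - F x) = (g x - (y - x)^-1 * (F y - F x)) * (y - x).
      by rewrite mulrBl mulrAC mulVf ?gt_eqF // mul1r.
    have : `|g x * (y - x) - (F y - F x)| <= e1 / 2 * (y - x).
      by rewrite eq1 normrM (gtr0_norm y0) ler_wpM2r // ltW.
    rewrite !ler_norml => /andP[h2 h3] /andP[h4 h5].
    have h6 : 0 <= Phi y - Phi x by rewrite subr_ge0 mPhi // ltW.
    lra.
  have [d1 d10 Hd1] := rf x (introT andP (conj ax xb)) _ ltr01.
  pose m := Num.bound (`|g x| + 1).
  have gm : `|g x| + 1 < m%:R by apply: archi_boundP; rewrite addr_ge0.
  have [d2 d20 Hd2] := HPhi x xN m.
  exists (Num.min d1 d2); first by rewrite lt_min d10.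
  move=> y /andP[xy yb]; rewrite -ltrBlDl lt_min !ltrBlDl => /andP[yd1 yd2].
  have y0 : 0 < y - x by rewrite subr_gt0.
  have := Hd1 y; rewrite xy yb mul1r => /(_ isT yd1); rewrite ler_norml => /andP[_ h1].
  have := Hd2 y; rewrite xy yd2 => /(_ isT) h2.
  have igxy : mu.-integrable `]x, y] (EFin \o gab) by apply: integrableS igab.
  have h3 := le_normr_Rintegral (mitv _) igxy.
  have sub z : z \in `]x, y]%classic -> z \in `[a, b]%classic.
    rewrite !inE /= !in_itv /= => /andP[xz zy].
    by rewrite (le_trans ax (ltW xz)) (le_trans zy yb).
  have iuE : Rintegral mu `]x, y] u = (y - x) + Rintegral mu `]x, y] (fun z => `|gab z|).
    have -> : Rintegral mu `]x, y] u = Rintegral mu `]x, y] (fun z => 1 + `|gab z|).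
      by apply: eq_Rintegral => z /sub zab; rewrite /u /gab !patchE zab.
    rewrite RintegralD //; first last.
    - exact: integrable_abse igxy.
    - apply: integrableS i1 => // z zxy; apply: set_mem; apply: sub; exact: mem_set.
    congr (_ + _); rewrite Rintegral_cst // mul1r.
    transitivity (fine (y - x)%:E) => //; congr fine.
    suff : mu `]x, y]%classic = (y - x)%:E by [].
    by rewrite lebesgue_measure_itv /= lte_fin xy -EFinB.
  have m1 : 1 <= m%:R :> R by rewrite (le_trans _ (ltW gm)) // lerDr.
  have I0 : 0 <= Rintegral mu `]x, y] (fun z => `|gab z|) by apply: Rintegral_ge0.
  have p1 : (`|g x| + 1) * (y - x) <= m%:R * (y - x) by rewrite ler_wpM2r // ltW.
  have p2 : 1 * Rintegral mu `]x, y] (fun z => `|gab z|) <=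
     m%:R * Rintegral mu `]x, y] (fun z => `|gab z|) by rewrite ler_wpM2r.
  have p3 : g x * (y - x) <= `|g x| * (y - x) by rewrite ler_wpM2r ?ler_norm // ltW.
  have p4 : 0 <= e1 * (y - x) by rewrite mulr_ge0 // ltW.
  have FF := Fd x y ax (ltW xy).
  move: h2 h3 h1 p1 p2 p3 p4 FF; rewrite iuE mulrDr mulrDl mul1r mulrBr ler_norml.
  move=> h2 /andP[h3 _]; rewrite !mul1r; lra.
Qed.

(** The inequality le_increment_Rintegral for f and for its opposite. *)
Lemma FTC_right_derivative f g a b : a <= b ->
  mu.-integrable `[a, b] (EFin \o g) ->
  left_continuous_on f a b -> right_derivative_on f g a b ->
  Rintegral mu `[a, b] g = f b - f a.
Proof.
move=> ab ig lf rf; apply/eqP; rewrite eq_le le_increment_Rintegral // andbT.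
have mab : measurable (`[a, b]%classic : set (measurableTypeR R)) by [].
have ig' : mu.-integrable `[a, b] (EFin \o (fun x => -1 * g x)).
  by have := integrableZl mab (-1) ig.
rewrite -lerN2 opprB.
have -> : - Rintegral mu `[a, b] g = Rintegral mu `[a, b] (fun x => -1 * g x).
  by rewrite RintegralZl // mulN1r.
rewrite (_ : f a - f b = (- f b) - (- f a)); last by rewrite opprK addrC.
apply: (@le_increment_Rintegral (fun x => - f x)) => //.
- move=> x xab e e0; have [d d0 Hd] := lf x xab e e0; exists d => // y ay yx.
  by rewrite -opprD normrN; exact: Hd.
- move=> x xab e e0; have [d d0 Hd] := rf x xab e e0; exists d => // y ay yx.
  have := Hd y ay yx; rewrite -normrN; congr (_ <= _); congr (`|_|).
  by rewrite mulN1r mulNr !opprD !opprK.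
Qed.
End FTC.

(** * Weak integrals *)

Section ComplexIntegral.
Variable R : realType.
Local Notation mu := (@lebesgue_measure R).
Implicit Types (a b u w : R) (f g : R -> R[i]) (z : R[i]).

Lemma rn_Re z : `|complex.Re z| <= rn z.
Proof.
case: z => x y; rewrite /rn normc_def /= -sqrtr_sqr ler_sqrt ?addr_ge0 ?sqr_ge0 //.
by rewrite lerDl sqr_ge0.
Qed.

Lemma rn_Im z : `|complex.Im z| <= rn z.
Proof.
case: z => x y; rewrite /rn normc_def /= -sqrtr_sqr ler_sqrt ?addr_ge0 ?sqr_ge0 //.
by rewrite lerDr sqr_ge0.
Qed.

Lemma rn_ReIm z : rn z <= `|complex.Re z| + `|complex.Im z|.
Proof.
rewrite {1}[z]complexE.
apply: le_trans (rnD _ _) _; rewrite rnM !rn_real lerD2l ler_piMl //.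
by rewrite /rn normc_def /= expr0n expr1n add0r sqrtr1.
Qed.

(** A majorant of the modulus, integrable as soon as the two components are. *)
Definition abs1 f (r : R) : R := `|complex.Re (f r)| + `|complex.Im (f r)|.

Lemma cintegrableS a b u w f : a <= u -> w <= b ->
  cintegrable a b f -> cintegrable u w f.
Proof.
move=> au wb [h1 h2]; have s : `[u, w] `<=` `[a, b].
  by apply: subset_itv; rewrite bnd_simp.
by split; [apply: integrableS h1|apply: integrableS h2].
Qed.

Lemma cintegrable_abs1 a b f : cintegrable a b f ->
  mu.-integrable `[a, b] (EFin \o abs1 f).
Proof.
move=> [h1 h2]; have h3 := integrableD (mitv _) (integrable_abse h1) (integrable_abse h2).
exact: eq_integrable h3.
Qed.

Lemma cintegrableB a b f g : cintegrable a b f -> cintegrable a b g ->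
  cintegrable a b (fun r => f r - g r).
Proof.
move=> [f1 f2] [g1 g2]; split.
  by apply: (eq_integrable (mitv _) _ _ _ (integrableB (mitv _) f1 g1)) => r _ /=; rewrite raddfB.
by apply: (eq_integrable (mitv _) _ _ _ (integrableB (mitv _) f2 g2)) => r _ /=; rewrite raddfB.
Qed.

Lemma cintegrableMr a b f z : cintegrable a b f -> cintegrable a b (fun r => f r * z).
Proof.
case: z => x y [f1 f2]; split.
  have h := integrableB (mitv _) (integrableZl (mitv _) x f1) (integrableZl (mitv _) y f2).
  apply: (eq_integrable (mitv _) _ _ _ h) => r _ /=; case: (f r) => p q /=.
  by rewrite -!EFinM -EFinB; congr EFin; rewrite ![_ * x]mulrC ![_ * y]mulrC.
have h := integrableD (mitv _) (integrableZl (mitv _) y f1) (integrableZl (mitv _) x f2).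
apply: (eq_integrable (mitv _) _ _ _ h) => r _ /=; case: (f r) => p q /=.
by rewrite -!EFinM -EFinD; congr EFin; rewrite ![_ * x]mulrC ![_ * y]mulrC.
Qed.

Lemma cintegralB a b f g : cintegrable a b f -> cintegrable a b g ->
  cintegral a b (fun r => f r - g r) = cintegral a b f - cintegral a b g.
Proof.
move=> [f1 f2] [g1 g2]; rewrite /cintegral; apply/eqP; rewrite eq_complex /=.
rewrite -!RintegralB //; apply/andP; split; apply/eqP; apply: eq_Rintegral => r _ /=;
  by rewrite raddfB.
Qed.

Lemma cintegralMr a b f z : cintegrable a b f ->
  cintegral a b (fun r => f r * z) = cintegral a b f * z.
Proof.
case: z => x y [f1 f2]; rewrite /cintegral; apply/eqP; rewrite eq_complex /=.
rewrite -!RintegralZr //; rewrite -RintegralB //; last 2 first.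
- by apply: (eq_integrable (mitv _) _ _ _ (integrableZr (mitv _) x f1)).
- by apply: (eq_integrable (mitv _) _ _ _ (integrableZr (mitv _) y f2)).
rewrite -RintegralD //; last 2 first.
- by apply: (eq_integrable (mitv _) _ _ _ (integrableZr (mitv _) y f1)).
- by apply: (eq_integrable (mitv _) _ _ _ (integrableZr (mitv _) x f2)).
by apply/andP; split; apply/eqP; apply: eq_Rintegral => r _ /=; case: (f r).
Qed.

Lemma Rintegral_tail a u w (k : R -> R) : a <= u -> u <= w ->
  mu.-integrable `[a, w] (EFin \o k) ->
  Rintegral mu `[a, w] k - Rintegral mu `[a, u] k = Rintegral mu `[u, w] k.
Proof.
move=> au uw ik; rewrite (Rintegral_split au uw ik) addrAC subrr add0r.
rewrite [RHS](Rintegral_split (lexx u) uw) ?set_itv1 ?Rintegral_set1 ?add0r //.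
by apply: integrableS ik => //; apply: subset_itvr; rewrite bnd_simp.
Qed.

Lemma cintegral_tail a u w f : a <= u -> u <= w -> cintegrable a w f ->
  cintegral a w f - cintegral a u f = cintegral u w f.
Proof.
move=> au uw [f1 f2]; apply/eqP; rewrite /cintegral eq_complex /=.
by rewrite !Rintegral_tail // !eqxx.
Qed.

Lemma rn_cintegral_le a b f (k : R -> R) : cintegrable a b f ->
  mu.-integrable `[a, b] (EFin \o k) -> (forall r, a <= r <= b -> rn (f r) <= k r) ->
  rn (cintegral a b f) <= 2 * Rintegral mu `[a, b] k.
Proof.
move=> [f1 f2] ik fk; apply: le_trans (rn_ReIm _) _ => /=.
have bound (g : R -> R) : mu.-integrable `[a, b] (EFin \o g) ->
    (forall r, a <= r <= b -> `|g r| <= k r) ->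
    `|Rintegral mu `[a, b] g| <= Rintegral mu `[a, b] k.
  move=> ig gk; apply: le_trans (le_normr_Rintegral (mitv _) ig) _.
  apply: le_Rintegral => //; exact: integrable_abse ig.
rewrite mulr_natl mulr2n; apply: lerD; apply: bound => // r rab.
  exact: le_trans (rn_Re _) (fk r rab).
exact: le_trans (rn_Im _) (fk r rab).
Qed.

End ComplexIntegral.

Section Pettis.
Variables (R : realType) (A : nc_prob_space R).
Local Notation mu := (@lebesgue_measure R).
Local Notation H := (nc_hilbert A).
Local Notation rho := (nc_rep A).

Section VectorFunctional.
Variables (Phi : {linear A -> A}) (x y : H).
(** The matrix coefficients of Phi a in the representation: they determine the norm and,
    being continuous, commute with weak integrals. *)
Definition vector_functional (a : A) : R[i] := ip x (rep rho (Phi a) y).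
Lemma vector_functional_is_linear : scalar vector_functional.
Proof.
move=> z a b; rewrite /vector_functional linearP (rep_linear_op rho y) /=.
by rewrite ipDr ipZr.
Qed.
HB.instance Definition _ := GRing.isLinear.Build R[i] A R[i] *%R
  vector_functional vector_functional_is_linear.

Lemma vector_functional_continuous (K : R) : (forall a, rn (Phi a) <= K * rn a) ->
  continuous (vector_functional : A -> R[i]^o).
Proof.
move=> PK; pose K' := rn x * (`|K| * rn y) + 1.
have K'0 : 0 < K' by rewrite ltr_wpDl // !mulr_ge0 ?rn_ge0.
have bd a : rn (vector_functional a) <= K' * rn a.
  apply: le_trans (cauchy_schwarz _ _) _.
  apply: (@le_trans _ _ (rn x * (`|K| * rn a * rn y))).
    rewrite ler_wpM2l ?rn_ge0 //; apply: le_trans (rn_rep rho _ _) _.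
    rewrite ler_wpM2r ?rn_ge0 //; apply: le_trans (PK a) _.
    by rewrite ler_wpM2r ?rn_ge0 // ler_norm.
  rewrite /K' mulrDl mul1r [`|K| * rn a * _]mulrAC !mulrA lerDl rn_ge0 //.
move=> a; apply/(@cvgrPdist_lt _ _ _ _ (nbhs_filter a)) => e e0.
have [e' e'0 ->] : exists2 e' : R, 0 < e' & e = e'%:C%C.
  by case: e e0 => p q; rewrite ltcE /= => /andP[/eqP -> p0]; exists p.
apply/nbhs_ballP; exists ((e' / K')%:C%C); first by rewrite /= ltcR divr_gt0.
move=> b /=; rewrite -ball_normE /= rn_ltP => ab.
rewrite -[_ - _](linearB vector_functional) rn_ltP.
apply: le_lt_trans (bd _) _.
by rewrite mulrC -ltr_pdivlMr.
Qed.
End VectorFunctional.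

(** Let Z be the element to be estimated, and x = Z y. The square of the norm of x is a
    matrix coefficient of Z, namely the integral of c r times that of Phi (b r) - Q,
    hence at most e times the norms of x and y times the integral of c. The factor 2
    comes from the real and imaginary parts. *)
Lemma pettis_estimate (Phi : {linear A -> A}) (K a u w : R) (c : R -> R[i]) (b : R -> A)
    (I J Q : A) (e : R) :
  (forall a, rn (Phi a) <= K * rn a) -> a <= u -> u <= w -> 0 <= e ->
  is_integral a u (fun r => c r *: b r) I -> is_integral a w (fun r => c r *: b r) J ->
  cintegrable a w c -> (forall r, u <= r <= w -> rn (Phi (b r) - Q) <= e) ->
  rn (Phi (J - I) - cintegral u w c *: Q) <= 2 * e * Rintegral mu `[u, w] (abs1 c).
Proof.
move=> PK au uw e0 II IJ ic be.
have icu : cintegrable u w c by apply: cintegrableS ic.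
set Z := Phi _ - _; set S := Rintegral _ _ _.
have S0 : 0 <= S by apply: Rintegral_ge0 => r _; rewrite /abs1 addr_ge0.
apply: (rn_rep_le (rho := rho)); first by rewrite !mulr_ge0.
move=> y; set x := rep rho Z y.
pose f : {scalar A} := vector_functional Phi x y.
have cf : continuous (f : A -> R[i]^o) by exact: (vector_functional_continuous PK).
have [iI eI] := II f cf.
have [iJ eJ] := IJ f cf.
have fE : f \o (fun r => c r *: b r) = fun r => c r * f (b r).
  by apply: funext => r /=; rewrite -[f (c r *: b r)]/(vector_functional Phi x y _) linearZ.
rewrite fE in iI eI iJ eJ; have iJu : cintegrable u w (fun r => c r * f (b r)).
  exact: cintegrableS iJ.
have key : ip x x = cintegral u w (fun r => c r * (f (b r)) - c r * ip x (rep rho Q y)).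
  rewrite {2}/x /Z repB ipDr ipNr (linearB Phi) repB ipDr ipNr.
  rewrite -[ip x (rep rho (Phi J) y)]/(f J) -[ip x (rep rho (Phi I) y)]/(f I) eI eJ.
  rewrite cintegral_tail // -[rep rho (_ *: Q) y]/(rep rho (_ *: Q) y).
  have -> : rep rho (cintegral u w c *: Q) y = cintegral u w c *: rep rho Q y.
    have r0 : rep rho 0 y = 0 by have := repB rho 0 0 y; rewrite !subrr.
    by have := rep_linear_op rho y (cintegral u w c) Q 0; rewrite /= r0 !addr0.
  by rewrite ipZr -cintegralMr // -cintegralB //; exact: cintegrableMr.
have k0 : 0 <= e * (rn x * rn y) by rewrite !mulr_ge0 ?rn_ge0.
have bnd : rn (ip x x) <= 2 * (e * (rn x * rn y) * S).
  rewrite key -RintegralZl ?cintegrable_abs1 //; apply: rn_cintegral_le.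
  - apply: cintegrableB; last exact: cintegrableMr.
    exact: iJu.
  - have := integrableZl (mitv _) (e * (rn x * rn y)) (cintegrable_abs1 icu).
    exact.
  - move=> r rab; rewrite -mulrBr rnM mulrC; apply: ler_pM; rewrite ?rn_ge0 //; last exact: rn_ReIm.
    rewrite -[f (b r)]/(ip x (rep rho (Phi (b r)) y)) -ipNr -ipDr -repB.
    apply: le_trans (cauchy_schwarz _ _) _; rewrite mulrCA ler_wpM2l ?rn_ge0 //.
    apply: le_trans (rn_rep rho _ _) _; rewrite ler_wpM2r ?rn_ge0 //; exact: be.
have [x0|x0] := eqVneq (rn x) 0; first by rewrite x0 !mulr_ge0 ?rn_ge0.
have xp : 0 < rn x by rewrite lt_def x0 rn_ge0.
move: bnd; rewrite ipE rn_real ger0_norm ?sqr_ge0 // expr2.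
rewrite (_ : 2 * (e * (rn x * rn y) * S) = rn x * (2 * e * S * rn y)); last by ring.
by rewrite ler_pM2l.
Qed.
End Pettis.

(** * Polar decomposition *)

Local Open Scope sesquilinear_scope.

Section Svd.
Variables (C : numClosedFieldType) (n : nat).
Implicit Types (N Q : 'M[C]_n) (d : 'I_n -> C).

Definition orthogonal_rows N d :=
  forall i j, \sum_k N i k * (N j k)^* = (i == j)%:R * d i.

Lemma orthogonal_rows_ge0 N d i : orthogonal_rows N d -> 0 <= d i.
Proof.
move=> /(_ i i); rewrite eqxx mul1r => <-; apply: sumr_ge0 => k _.
exact: mul_conjC_ge0.
Qed.

Lemma orthogonal_rows_unitary Q : orthogonal_rows Q (fun=> 1) -> Q \is unitarymx.
Proof.
move=> oQ; apply/unitarymxP/matrixP => i j; rewrite !mxE.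
by under eq_bigr => k _ do rewrite !mxE; rewrite oQ mulr1.
Qed.

(** Normalise the rows if none of them vanishes. A vanishing row is first replaced by a
    unit vector orthogonal to the other ones, which leaves fewer vanishing rows. *)
Lemma orthogonal_rows_factor N d : orthogonal_rows N d ->
  exists2 Q, Q \is unitarymx & forall i j, N i j = sqrtC (d i) * Q i j.
Proof.
have [m] := ubnP #|[set i | d i == 0]%SET|; elim: m => // m IH in N d *.
rewrite ltnS => dm oN; have d0 i := orthogonal_rows_ge0 i oN.
have [z|/set0Pn[i0]] := eqVneq [set i | d i == 0]%SET finset.set0.
  have dn i : d i != 0 by apply/negP => di; have := finset.in_set0 i; rewrite -z inE di.
  exists (\matrix_(i, j) ((sqrtC (d i))^-1 * N i j)); last first.
    by move=> i j; rewrite mxE mulrA divff ?mul1r // sqrtC_eq0.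
  apply: orthogonal_rows_unitary => i j; under eq_bigr => k _ do rewrite !mxE rmorphM /= mulrACA.
  rewrite -mulr_sumr oN; case: eqVneq => [<-|_]; last by rewrite mul0r mulr0 mul0r.
  rewrite mul1r fmorphV /= conj_Creal ?ger0_real ?sqrtC_ge0 // -invfM -expr2 sqrtCK.
  by rewrite mulVf // mulr1.
rewrite inE => /eqP di0.
have N0 j : N i0 j = 0.
  have := oN i0 i0; rewrite di0 mulr0 => /eqP; rewrite psumr_eq0; last first.
    by move=> k _; exact: mul_conjC_ge0.
  by move=> /allP/(_ j (mem_index_enum _)); rewrite mul_conjC_eq0 => /eqP.
have [u u0 Nu] : exists2 u : 'rV[C]_n, u != 0 & u *m N^T = 0.
  have : kermx N^T != 0.
    rewrite kermx_eq0 row_free_unit unitmx_tr; apply/negP => uN.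
    have /matrixP/(_ i0 i0) := mulmxV uN; rewrite !mxE eqxx big1 => [/eqP|k _].
      by rewrite eq_sym oner_eq0.
    by rewrite N0 mul0r.
  move=> k0; exists (nz_row (kermx N^T)); first by rewrite nz_row_eq0.
  by apply/sub_kermxP; exact: nz_row_sub.
pose s := \sum_k u 0 k * (u 0 k)^*.
have s0 : s != 0.
  apply: contra u0; rewrite psumr_eq0 => [/allP h|k _]; last exact: mul_conjC_ge0.
  apply/eqP/rowP => k; rewrite mxE; have := h k (mem_index_enum _).
  by rewrite mul_conjC_eq0 => /eqP.
have s_ge0 : 0 <= s by apply: sumr_ge0 => k _; exact: mul_conjC_ge0.
pose N' := \matrix_(i, j) if i == i0 then (sqrtC s)^-1 * (u 0 j)^* else N i j.
pose d' i := if i == i0 then 1 else d i.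
have orth j : \sum_k (u 0 k)^* * (N j k)^* = 0.
  have /rowP/(_ j) := Nu; rewrite !mxE => e.
  transitivity ((\sum_k u 0 k * N^T k j)^*); last by rewrite e conjC0.
  by rewrite rmorph_sum; apply: eq_bigr => k _; rewrite rmorphM /= mxE.
have oN' : orthogonal_rows N' d'.
  move=> i j; under eq_bigr => k _ do rewrite !mxE.
  have [ii|ii] := boolP (i == i0); have [ji|ji] := boolP (j == i0).
  - rewrite (eqP ii) (eqP ji) eqxx mul1r /d' eqxx; under eq_bigr => k _ do rewrite rmorphM /= mulrACA conjCK.
    rewrite -mulr_sumr fmorphV /= conj_Creal ?ger0_real ?sqrtC_ge0 // -invfM -expr2 sqrtCK.
    by under eq_bigr => k _ do rewrite mulrC; rewrite -/s mulVf.
  - rewrite (eqP ii) eq_sym (negPf ji) mul0r; under eq_bigr => k _ do rewrite -mulrA.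
    by rewrite -mulr_sumr orth mulr0.
  - rewrite (eqP ji) (negPf ii) mul0r; under eq_bigr => k _ do rewrite rmorphM /= conjCK mulrCA.
    rewrite -mulr_sumr (_ : \sum_k _ = 0) ?mulr0 //.
    have /rowP/(_ i) := Nu; rewrite !mxE => e; rewrite -[RHS]e.
    by apply: eq_bigr => k _; rewrite mxE mulrC.
  - by rewrite oN /d' (negPf ii).
have [|Q uQ NQ] := IH N' d' _ oN'.
  apply: leq_trans dm; apply: proper_card; apply/properP; split.
    by apply/fintype.subsetP => i; rewrite !inE /d'; case: (i =P i0) => // _; rewrite oner_eq0.
  by exists i0; rewrite !inE ?di0 // /d' eqxx oner_eq0.
exists Q => // i j; have := NQ i j; rewrite /d' mxE; case: eqVneq => [->|//] _.
by rewrite N0 di0 sqrtC0 mul0r.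
Qed.

(** Diagonalise M times its adjoint by P: then the rows of P *m M are orthogonal, hence
    multiples of the rows of a unitary matrix. *)
Lemma svd (M : 'M[C]_n) : exists P Q (d : 'rV[C]_n),
  [/\ P \is unitarymx, Q \is unitarymx, forall i, 0 <= d 0 i &
      M = P^t* *m diag_mx d *m Q].
Proof.
have hM : M *m M^t* \is normalmx.
  by apply/normalmxP; rewrite !trmx_mul !map_mxM /= trmxCK.
have /orthomx_spectralP := hM; set P := spectralmx _; set sp := spectral_diag _ => eM.
have uP : P \is unitarymx by exact: spectral_unitarymx.
have oN : orthogonal_rows (P *m M) (fun i => sp 0 i).
  have e : (P *m M) *m (P *m M)^t* = diag_mx sp.
    rewrite trmx_mul map_mxM mulmxA -[P *m M *m _]mulmxA eM invmx_unitary //.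
    by rewrite !mulmxA (unitarymxP uP) mul1mx mulmxtVK.
  move=> i j; have /matrixP/(_ i j) := e; rewrite [LHS]mxE [RHS]mxE mulr_natl => <-.
  by apply: eq_bigr => k _; rewrite !mxE.
have [Q uQ NQ] := orthogonal_rows_factor oN.
exists P, Q, (\row_i sqrtC (sp 0 i)); split=> // [i|].
  by rewrite mxE sqrtC_ge0; exact: orthogonal_rows_ge0 i oN.
have -> : M = P^t* *m (P *m M) by rewrite mulmxA -invmx_unitary // mulVmx ?mul1mx ?unitarymx_unit.
rewrite -mulmxA; congr (_ *m _); apply/matrixP => i j; rewrite NQ mul_diag_mx mxE.
by rewrite mxE.
Qed.
End Svd.

Section Polar.
Variables (R : realType) (h : hilbertType R) (n : nat) (v : 'I_n -> h).
Hypothesis v_onb : orthonormal_basis v.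
Local Notation C := R[i].
Implicit Types M : 'M[C]_n.

Definition mxop M (f : h) : h := \sum_i (\sum_j M i j * ip (v j) f) *: v i.

Lemma mxop_is_linear M : linear (mxop M).
Proof.
move=> a f g; rewrite /mxop scaler_sumr -big_split; apply: eq_bigr => i _ /=.
rewrite scalerA -scalerDl mulr_sumr -big_split; congr (_ *: _); apply: eq_bigr => j _ /=.
by rewrite ipDr ipZr mulrDr mulrCA.
Qed.
HB.instance Definition _ M := GRing.isLinear.Build C h h *:%R (mxop M) (mxop_is_linear M).

Lemma ip_mxop M i f : ip (v i) (mxop M f) = \sum_j M i j * ip (v j) f.
Proof.
have [ov _] := v_onb; rewrite /mxop ip_sumr (bigD1 i) //= ipZr ov eqxx mulr1.
by rewrite [X in _ + X]big1 ?addr0 // => j ji; rewrite ipZr ov eq_sym (negPf ji) mulr0.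
Qed.

Lemma onb_inj f g : (forall i, ip (v i) f = ip (v i) g) -> f = g.
Proof.
have [_ ev] := v_onb => fg; rewrite (ev f) (ev g).
by apply: eq_bigr => i _; rewrite fg.
Qed.

Lemma mxopM M N f : mxop (M *m N) f = mxop M (mxop N f).
Proof.
apply: onb_inj => i; rewrite !ip_mxop.
under eq_bigr => j _ do rewrite mxE mulr_suml.
rewrite exchange_big /=; apply: eq_bigr => j _.
by rewrite ip_mxop mulr_sumr; apply: eq_bigr => k _; rewrite mulrA.
Qed.

Lemma mxop1 f : mxop 1%:M f = f.
Proof.
apply: onb_inj => i; rewrite ip_mxop (bigD1 i) //= mxE eqxx mul1r big1 ?addr0 // => j ji.
by rewrite mxE eq_sym (negPf ji) mul0r.
Qed.

Lemma mxop_adjoint M : adjoint_of (mxop (M^t* )) (mxop M).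
Proof.
have [ov ev] := v_onb; move=> f g.
have step f' g' : ip f' g' = \sum_i (ip (v i) f')^* * ip (v i) g'.
  by rewrite {1}(ev f') ip_suml; apply: eq_bigr => i _; rewrite ipZl.
rewrite !step.
under eq_bigr => i _ do rewrite ip_mxop rmorph_sum mulr_suml /=.
rewrite exchange_big /=; apply: eq_bigr => j _; rewrite ip_mxop mulr_sumr.
by apply: eq_bigr => i _; rewrite !mxE rmorphM /= conjCK; ring.
Qed.

(** If D has the matrix P^* d Q, then C = d^(1/2) P and U = P^* Q satisfy C^* C U = D. *)
Lemma polar_decomposition (D : {linear h -> h}) :
  exists C U : {linear h -> h}, is_decomposition D C U.
Proof.
pose M := \matrix_(i, j) ip (v i) (D (v j)).
have DM f : D f = mxop M f.
  have [ov ev] := v_onb; apply: onb_inj => i; rewrite ip_mxop {1}(ev f) linear_sum ip_sumr.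
  by apply: eq_bigr => j _; rewrite linearZ ipZr mxE mulrC.
have [P [Q [d [uP uQ d0 eM]]]] := svd M.
pose sd := \row_i sqrtC (d 0 i).
exists (mxop (diag_mx sd *m P)), (mxop (P^t* *m Q)); split.
  have uU : (P^t* *m Q)^t* *m (P^t* *m Q) = 1%:M.
    rewrite trmx_mul map_mxM trmxCK mulmxA -[_ *m P *m _]mulmxA (unitarymxP uP) mulmx1.
    by rewrite -invmx_unitary // mulVmx // unitarymx_unit.
  have uU' : (P^t* *m Q) *m (P^t* *m Q)^t* = 1%:M.
    rewrite trmx_mul map_mxM trmxCK mulmxA mulmxtVK // -invmx_unitary // mulVmx //.
    exact: unitarymx_unit.
  split=> [f g|g].
    have ad := mxop_adjoint ((P^t* *m Q)^t* ) f (mxop (P^t* *m Q) g).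
    by rewrite trmxCK in ad; rewrite ad -mxopM uU mxop1.
  by exists (mxop ((P^t* *m Q)^t* ) g); rewrite /= -mxopM uU' mxop1.
exists (mxop ((diag_mx sd *m P)^t* )); first exact: mxop_adjoint.
move=> f; rewrite DM /= -!mxopM; congr (mxop _ f).
rewrite trmx_mul map_mxM tr_diag_mx map_diag_mx.
have -> : diag_mx (map_mx Num.conj sd) = diag_mx sd.
  congr diag_mx; apply/rowP => i; rewrite !mxE conj_Creal // ger0_real // sqrtC_ge0.
  exact: d0.
rewrite !mulmxA -[_ *m P *m P^t*]mulmxA (unitarymxP uP) mulmx1 eM; congr (_ *m _).
rewrite -mulmxA; congr (_ *m _).
apply/matrixP => i j; rewrite mul_diag_mx !mxE; case: eqVneq => [->|_].
  by rewrite !mulr1n -expr2 sqrtCK.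
by rewrite !mulr0n mulr0.
Qed.
End Polar.

(** * Consequences of norm compatibility *)

Section Covariance.
Variables (R : realType) (A : fnps R) (h : hilbertType R).
Variables (Theta : h -> h) (G Gdot : R -> {linear h -> h}) (X : R -> {linear h -> A}).
Hypothesis G_diff : forall r : R, 0 <= r -> has_derivative G (Gdot r) r.
Local Notation mu := (@lebesgue_measure R).

Section Form.
Variables (x y : h).
Definition cov_form (r : R) : R[i] := theta_form Theta x (G r y).
Definition cov_rate (r : R) : R[i] := theta_form Theta x (Gdot r y).

Lemma cov_form_derivative (r e : R) : 0 <= r -> 0 < e -> exists2 d : R, 0 < d &
  forall w, 0 <= w -> `|w - r| < d ->
  rn (cov_form w - cov_form r - (w - r)%:C%C * cov_rate r) <= e * `|w - r|.
Proof.
move=> r0 e0; pose K := rn (Theta x) + 1.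
have K0 : 0 < K by rewrite ltr_wpDl ?rn_ge0.
have eK : 0 < (e / K)%:C%C :> R[i] by rewrite ltcR divr_gt0.
have Gd : (fun e : R => (e^-1)%:C%C *: (G (r + e) y - G r y)) @
    within [set e | 0 <= r + e] 0^' --> Gdot r y by exact: G_diff.
move/cvgrPdist_le: Gd => /(_ _ eK).
rewrite /within /= => -[d /= d0 Hd]; exists d => // w w0 wr.
have [->|wr'] := eqVneq w r; first by rewrite !subrr mul0r subrr rn0 normr0 mulr0.
have := Hd (w - r); rewrite /= sub0r normrN subrKC => /(_ wr).
rewrite subr_eq0 wr' => /(_ isT w0); rewrite rn_leP => hw.
have -> : cov_form w - cov_form r - (w - r)%:C%C * cov_rate r =
    - ((w - r)%:C%C * ip (Theta x) (Gdot r y - ((w - r)^-1)%:C%C *: (G w y - G r y))).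
  rewrite /cov_form /cov_rate /theta_form ipDr ipNr ipZr ipDr ipNr fmorphV mulrBr mulrA divff.
    by rewrite mul1r opprB addrC.
  by rewrite fmorph_eq0 subr_eq0.
rewrite rnN rnM rn_real mulrC ler_wpM2r //.
apply: le_trans (cauchy_schwarz _ _) _.
apply: (@le_trans _ _ (K * (e / K))); last by rewrite mulrC divfK ?gt_eqF.
by rewrite ler_pM ?rn_ge0 // lerDl.
Qed.

Lemma cov_form_continuous (r e : R) : 0 <= r -> 0 < e -> exists2 d : R, 0 < d &
  forall w, 0 <= w -> `|w - r| < d -> rn (cov_form w - cov_form r) <= e.
Proof.
move=> r0 e0; have [d d0 Hd] := cov_form_derivative r0 ltr01.
pose K := 1 + rn (cov_rate r); have K0 : 0 < K by rewrite ltr_pwDl ?rn_ge0.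
exists (Num.min d (e / K)); first by rewrite lt_min d0 divr_gt0.
move=> w w0; rewrite lt_min => /andP[wd we]; have := Hd w w0 wd.
have := rnD (cov_form w - cov_form r - (w - r)%:C%C * cov_rate r) ((w - r)%:C%C * cov_rate r).
rewrite subrK rnM rn_real mul1r => h1 h2.
have : `|w - r| * K <= e by rewrite -ler_pdivlMr // ltW.
rewrite /K; lra.
Qed.

(* The real and imaginary parts of complex-valued functions are treated alike. *)
Variable part : {additive R[i] -> R}.
Hypothesis part_le : forall z, `|part z| <= rn z.
Hypothesis partZ : forall (p : R) z, part (p%:C%C * z) = p * part z.

Lemma partB z w : part (z - w) = part z - part w.
Proof. exact: raddfB. Qed.

Lemma part_right_derivative a b : 0 <= a ->
  right_derivative_on (part \o cov_form) (part \o cov_rate) a b.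
Proof.
move=> a0 r /andP[ar rb] e e0; have r0 := le_trans a0 ar.
have [d d0 Hd] := cov_form_derivative r0 e0; exists d => // w /andP[rw wb] wd.
have w0 : 0 <= w - r by rewrite subr_ge0 ltW.
have := Hd w (le_trans r0 (ltW rw)); rewrite ger0_norm // ltrBlDl => /(_ wd).
apply: le_trans; apply: le_trans (part_le _); by rewrite !partB partZ mulrC.
Qed.

Lemma part_left_continuous a b : 0 <= a -> left_continuous_on (part \o cov_form) a b.
Proof.
move=> a0 r /andP[ar rb] e e0; have r0 := le_trans a0 (ltW ar).
have [d d0 Hd] := cov_form_continuous r0 e0; exists d => // w aw /andP[dw wr].
have := Hd w (le_trans a0 aw); rewrite ler0_norm ?subr_le0 // opprB ltrBlDl -ltrBlDr.
move=> /(_ dw); apply: le_trans; apply: le_trans (part_le _).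
by rewrite partB distrC.
Qed.

(** The rate is a pointwise limit of difference quotients of the covariance, which is
    continuous once it is extended by its initial value. *)
Lemma part_cov_rate_measurable (T : R) :
  measurable_fun (`[0, T]%classic : set (measurableTypeR R)) (part \o cov_rate).
Proof.
pose g r := part (cov_form (Num.max r 0)).
have cg : continuous g.
  move=> r; apply/cvgrPdist_le => e e0.
  have r0 : 0 <= Num.max r 0 by rewrite le_max lexx orbT.
  have [d d0 Hd] := cov_form_continuous r0 e0.
  exists d => // w /= wr; rewrite /g distrC -partB.
  apply: le_trans (part_le _) _; apply: Hd; first by rewrite le_max lexx orbT.
  apply: le_lt_trans wr; rewrite distrC.
  have : `|Num.max w 0 - Num.max r 0| <= `|w - r|.
    rewrite !maxEle; case: (leP w 0) => h1; case: (leP r 0) => h2.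
    - by rewrite subrr normr0.
    - rewrite sub0r normrN gtr0_norm // distrC ger0_norm ?subr_ge0; lra.
    - rewrite subr0 gtr0_norm // ger0_norm ?subr_ge0; lra.
    - by [].
  by rewrite distrC [`|w - r|]distrC.
pose f (m : nat) (r : R) := m.+1%:R * (g (r + m.+1%:R^-1) - g r).
apply: (@measurable_fun_cvg _ _ _ _ f).
  move=> m; apply: measurable_funTS; apply: measurable_funM; first exact: measurable_cst.
  apply: measurable_funB; last exact: continuous_measurable_fun.
  apply: measurableT_comp; first exact: continuous_measurable_fun.
  by apply: measurable_funD => //; exact: measurable_cst.
move=> r; rewrite /= in_itv /= => /andP[r0 _]; apply/cvgrPdist_le => e e0.
have [d d0 Hd] := cov_form_derivative r0 e0.
near=> m; have m0 : 0 < m.+1%:R^-1 :> R by rewrite invr_gt0.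
have md : m.+1%:R^-1 < d.
  by near: m; exact: near_infty_natSinv_lt (PosNum d0).
rewrite /f /g !max_l ?addr_ge0 ?(ltW m0) //.
have e1 : r + m.+1%:R^-1 - r = m.+1%:R^-1 by rewrite addrC addKr.
have := Hd (r + m.+1%:R^-1); rewrite e1 addr_ge0 ?(ltW m0) // gtr0_norm //.
move=> /(_ isT md) h1; have := le_trans (part_le _) h1.
rewrite !partB partZ => h2.
have -> : part (cov_rate r) - m.+1%:R * (part (cov_form (r + m.+1%:R^-1)) - part (cov_form r)) =
   - (m.+1%:R * (part (cov_form (r + m.+1%:R^-1)) - part (cov_form r) - m.+1%:R^-1 * part (cov_rate r))).
  by rewrite [in RHS]mulrBr mulVKf // opprB.
rewrite normrN normrM ger0_norm // -ler_pdivlMl ?ltr0Sn // [_^-1 * e]mulrC.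
exact: h2.
Unshelve. all: by end_near. Qed.
End Form.

Variables (n : nat) (v : 'I_n -> h).
Hypothesis v_onb : orthonormal_basis v.
Hypothesis X_norm : norm_compatible Theta Gdot X.

(** A decomposition of Gdot r exists for every r, by polar_decomposition. The Cauchy-
    Schwarz inequality bounds the covariance rates by the integrand of the norm bound,
    which is integrable. *)
Lemma norm_compatible_bounds (T : R) : 0 <= T ->
  (forall x y, cintegrable 0 T (cov_rate x y)) /\
  (forall f, exists2 M : R, 0 <= M & forall r, 0 <= r <= T -> rn (X r f) <= M).
Proof.
move=> T0.
have /choice[CU HCU] : forall r : R, exists CU : {linear h -> h} * {linear h -> h},
    0 <= r -> is_decomposition (Gdot r) CU.1 CU.2.
  by move=> r; have [C [U CU]] := polar_decomposition v_onb (Gdot r); exists (C, U).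
pose C r := (CU r).1; pose U r := (CU r).2.
have [c c0 Xc] := X_norm (C := C) (U := U) HCU.
pose b (f : h) (r : R) : R[i] := `|C r (U r f)| ^+ 2 + `|C r (Theta f)| ^+ 2.
have bE f r : b f r = (rn (C r (U r f)) ^+ 2 + rn (C r (Theta f)) ^+ 2)%:C%C.
  by rewrite /b !rnE !rmorphD !rmorphXn.
have ib f : cintegrable 0 T (b f) by have [] := Xc T f T0.
split.
  move=> x y; pose k (r : R) := complex.Re (b x r) + complex.Re (b y r).
  have ik : mu.-integrable `[0, T] (EFin \o k).
    have [i1 _] := ib x; have [i2 _] := ib y.
    by apply: (eq_integrable (mitv _) _ _ _ (integrableD (mitv _) i1 i2)).
  have bound r : 0 <= r -> rn (cov_rate x y r) <= k r.
    move=> r0; have [_ [B adjB DB]] := HCU r r0.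
    rewrite /cov_rate /theta_form DB ip_conj adjB -ip_conj.
    apply: le_trans (cauchy_schwarz _ _) _; rewrite /k !bE /=.
    set p := rn (_ (Theta x)); set q := rn (C r (U r y)).
    have := sqr_ge0 (p - q); have := sqr_ge0 (rn (C r (U r x))).
    have := sqr_ge0 (rn (C r (Theta y))); nra.
  have ip_ (part : {additive R[i] -> R}) : (forall z, `|part z| <= rn z) ->
      (forall (p : R) z, part (p%:C%C * z) = p * part z) ->
      mu.-integrable `[0, T] (EFin \o (part \o cov_rate x y)).
    move=> p1 p2; apply: (le_integrable (mitv _)) ik.
      by apply/measurable_EFinP; exact: part_cov_rate_measurable.
    move=> r; rewrite /= in_itv /= => /andP[r0 _]; rewrite lee_fin.
    by apply: le_trans (p1 _) (le_trans (bound r r0) (ler_norm _)).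
  split.
    have h1 := ip_ (@complex.Re R) (@rn_Re R); apply: h1.
    by move=> p [u w] /=; rewrite mul0r subr0.
  have h1 := ip_ (@complex.Im R) (@rn_Im R); apply: h1.
  by move=> p [u w] /=; rewrite mul0r addr0.
move=> f; pose S := Rintegral mu `[0, T] (@complex.Re R \o b f).
have S0 : 0 <= S.
  by apply: Rintegral_ge0 => r _ /=; rewrite bE addr_ge0 ?sqr_ge0.
exists (1 + c * S); first by rewrite addr_ge0 // mulr_ge0 // ltW.
move=> r /andP[r0 rT]; have [_ Xr] := Xc r f r0.
have : rn (X r f) ^+ 2 <= c * S.
  have zE : complex.Re (cintegral 0 r (b f)) = Rintegral mu `[0, r] (@complex.Re R \o b f) by [].
  move: Xr; rewrite rnE -rmorphXn -/(b f); case: (cintegral 0 r (b f)) zE => p q /= ->.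
  rewrite lecE /= => /andP[_]; rewrite mul0r subr0 => /le_trans; apply.
  rewrite ler_pM2l //.
  have [i1 _] := ib f; rewrite -subr_ge0 Rintegral_tail //.
  by apply: Rintegral_ge0 => u _ /=; rewrite bE addr_ge0 ?sqr_ge0.
have := rn_ge0 (X r f); have := mulr_ge0 (ltW c0) S0; nra.
Qed.

Lemma cintegral_cov_rate x y (u w : R) : 0 <= u -> u <= w ->
  cintegrable 0 w (cov_rate x y) ->
  cintegral u w (cov_rate x y) = cov_form x y w - cov_form x y u.
Proof.
move=> u0 uw ic; have [i1 i2] : cintegrable u w (cov_rate x y) by apply: cintegrableS ic.
rewrite /cintegral.
have ReZ p (z : R[i]) : complex.Re (p%:C%C * z) = p * complex.Re z.
  by case: z => a b /=; rewrite mul0r subr0.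
have ImZ p (z : R[i]) : complex.Im (p%:C%C * z) = p * complex.Im z.
  by case: z => a b /=; rewrite mul0r addr0.
have l1 := @part_left_continuous x y (@complex.Re R) (@rn_Re R) u w u0.
have r1 := @part_right_derivative x y (@complex.Re R) (@rn_Re R) ReZ u w u0.
have l2 := @part_left_continuous x y (@complex.Im R) (@rn_Im R) u w u0.
have r2 := @part_right_derivative x y (@complex.Im R) (@rn_Im R) ImZ u w u0.
rewrite (FTC_right_derivative uw i1 l1 r1) (FTC_right_derivative uw i2 l2 r2).
by rewrite /=; case: (cov_form x y w) => a b; case: (cov_form x y u).
Qed.

End Covariance.

(** * The exponential of a scalar plus a nilpotent element *)

Section ExpPartial.
Variables (K : numFieldType) (B : algType K).
Implicit Types x y : B.

Definition exp_partial (N : nat) x : B := \sum_(k < N) (k`!%:R)^-1 *: x ^+ k.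

Let f x y i j : B := ((i`!%:R)^-1 * (j`!%:R)^-1 : K) *: (x ^+ i * y ^+ j).

(** By the binomial theorem the truncated series of x + y consists of the terms of total
    degree less than N in the product. What is left has positive coefficients, so that
    its norm is bounded by the same defect for the norms of x and y, which tends to
    zero. *)
Lemma exp_partial_defect N x y : GRing.comm x y ->
  exp_partial N x * exp_partial N y - exp_partial N (x + y) =
  \sum_(i < N) \sum_(j < N | (N <= i + j)%N)
     ((i`!%:R)^-1 * (j`!%:R)^-1 : K) *: (x ^+ i * y ^+ j).
Proof.
move=> xy.
have prodE : exp_partial N x * exp_partial N y = \sum_(i < N) \sum_(j < N) f x y i j.
  rewrite /exp_partial mulr_suml; apply: eq_bigr => i _; rewrite mulr_sumr.
  by apply: eq_bigr => j _; rewrite -scalerAl -scalerAr scalerA.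
have sumE : exp_partial N (x + y) = \sum_(i < N) \sum_(j < N | (i + j < N)%N) f x y i j.
  transitivity (\sum_(k < N) \sum_(j < N) \sum_(i < N | (i + j)%N == k) f x y i j).
    apply: eq_bigr => k _; rewrite exprDn_comm // scaler_sumr.
    transitivity (\sum_(j < k.+1) f x y (k - j)%N j).
      apply: eq_bigr => j _; rewrite /f -[_ *+ 'C(k, j)]scaler_nat scalerA; congr (_ *: _).
      have jk : (j <= k)%N by rewrite -ltnS.
      have := bin_fact jk; rewrite mulnC => <-.
      rewrite !natrM !invfM mulrAC [_ * _ * (_)%:R]mulrAC mulrC.
      have b0 : ('C(k, j)%:R : K) != 0 by rewrite pnatr_eq0 -lt0n bin_gt0.
      by field; rewrite b0 !pnatr_eq0 -!lt0n !fact_gt0.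
    rewrite (big_ord_widen N (fun j => f x y (k - j)%N j)) //.
    rewrite big_mkcond; apply: eq_bigr => j _; case: ifPn => jk.
      have kN : (k - j < N)%N by exact: leq_ltn_trans (leq_subr _ _) (ltn_ord k).
      rewrite (big_pred1 (Ordinal kN)) // => i /=.
      by rewrite -val_eqE /= -[RHS](eqn_add2r j) subnK.
    rewrite big_pred0 // => i; apply/negbTE; apply: contra jk => /eqP <-.
    by rewrite ltnS leq_addl.
  under eq_bigr => k _ do rewrite (exchange_big_dep xpredT) //=.
  rewrite exchange_big /=; apply: eq_bigr => i _.
  rewrite (exchange_big_dep (fun j : 'I_N => (i + j < N)%N)) /=; last first.
    by move=> k j _ /eqP ->.
  by apply: eq_bigr => j ij; rewrite (big_pred1 (Ordinal ij)).
rewrite prodE sumE -sumrB; apply: eq_bigr => i _.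
rewrite (bigID (fun j : 'I_N => (N <= i + j)%N)) /= -[RHS]addr0 -addrA; congr (_ + _).
by apply/eqP; rewrite subr_eq0; apply/eqP; apply: eq_bigl => j; rewrite -ltnNge.
Qed.

Lemma exp_partial_nilpotent N p x : x ^+ p = 0 -> (p <= N)%N ->
  exp_partial N x = exp_partial p x.
Proof.
move=> xp pN; rewrite /exp_partial [RHS](big_ord_widen N (fun k => (k`!%:R)^-1 *: x ^+ k)) //.
rewrite [RHS]big_mkcond; apply: eq_bigr => k _; case: ifPn => //; rewrite -leqNgt => pk.
by rewrite -(subnK pk) exprD xp mulr0 scaler0.
Qed.

Lemma exp_partial_scalar N (c : K) :
  exp_partial N (c%:A : B) = (\sum_(k < N) (k`!%:R)^-1 * c ^+ k)%:A.
Proof.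
rewrite scaler_suml; apply: eq_bigr => k _.
by rewrite exprZn expr1n scalerA.
Qed.
End ExpPartial.

Section CStarExp.
Variables (R : realType) (A : cstarAlgType R).
Implicit Types (x y m : A) (c : R[i]) (r s : R).

Definition exp_sum (N : nat) c : R[i] := \sum_(k < N) (k`!%:R)^-1 * c ^+ k.

Lemma exp_sum_real r : (fun N => exp_partial N (r : R^o)) @ \oo --> expR r.
Proof.
have -> : (fun N => exp_partial N (r : R^o)) = series (exp_coeff r).
  apply/funext => N; rewrite /series /= big_mkord; apply: eq_bigr => k _.
  by rewrite /exp_coeff /= [RHS]mulrC.
exact: is_cvg_series_exp_coeff.
Qed.

Lemma exp_defect_cvg0 r s : (fun N => exp_partial N (r : R^o) * exp_partial N (s : R^o) -
  exp_partial N (r + s : R^o) : R) @ \oo --> (0 : R).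
Proof.
rewrite -(subrr (expR (r + s))) {1}expRD.
by apply: cvgB; [apply: cvgM|]; exact: exp_sum_real.
Qed.

Lemma rn_exp x k : rn (x ^+ k) <= rn x ^+ k.
Proof.
elim: k => [|k IH]; first by rewrite !expr0 rn_one.
rewrite !exprS; apply: le_trans (rn_mul _ _) _; apply: ler_wpM2l => //; exact: rn_ge0.
Qed.

Lemma rn_exp_defect N x y : GRing.comm x y ->
  rn (exp_partial N x * exp_partial N y - exp_partial N (x + y)) <=
  exp_partial N (rn x : R^o) * exp_partial N (rn y : R^o) - exp_partial N (rn x + rn y : R^o).
Proof.
move=> xy; rewrite exp_partial_defect // exp_partial_defect; last exact: mulrC.
apply: le_trans (rn_sum _ _ _) _; apply: ler_sum => i _.
apply: le_trans (rn_sum _ _ _) _; apply: ler_sum => j _.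
rewrite rnZ rnM !rnV !rn_nat; apply: ler_wpM2l; first by rewrite mulr_ge0 // invr_ge0.
apply: le_trans (rn_mul _ _) _; apply: ler_pM; rewrite ?rn_ge0 //; exact: rn_exp.
Qed.

Lemma part_exp_sum_cvg (part : {additive R[i] -> R}) c :
  (forall z, `|part z| <= rn z) -> exists l : R, (fun N => part (exp_sum N c)) @ \oo --> l.
Proof.
move=> ple; pose u k := part ((k`!%:R)^-1 * c ^+ k).
have -> : (fun N => part (exp_sum N c)) = series u.
  by apply/funext => N; rewrite /series /= big_mkord raddf_sum.
suff : cvgn (series u) by move=> cu; exists (limn (series u)).
apply: (@normed_cvg R R^o); apply: (@series_le_cvg _ _ (exp_coeff (rn c))).
- by move=> k; exact: normr_ge0.
- by move=> k; apply: exp_coeff_ge0; exact: rn_ge0.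
- move=> k; rewrite /u; apply: le_trans (ple _) _.
  rewrite rnM rnV rn_nat /exp_coeff /= mulrC; apply: ler_wpM2r; first by rewrite invr_ge0.
  elim: k => [|k IH]; first by rewrite !expr0 rn1.
  by rewrite !exprS rnM; apply: ler_wpM2l => //; exact: rn_ge0.
- exact: is_cvg_series_exp_coeff.
Qed.

Lemma squeeze0 (p : nat) (f g : nat -> R) : (forall N, (p <= N)%N -> 0 <= f N <= g N) ->
  g @ \oo --> (0 : R) -> f @ \oo --> (0 : R).
Proof.
move=> fg g0; have near_fg : \forall N \near \oo, 0 <= f N <= g N.
  by near=> N; apply: fg; near: N; exact: nbhs_infty_ge.
exact: (squeeze_cvgr near_fg (cvg_cst (0 : R)) g0).
Unshelve. all: by end_near. Qed.

Lemma exp_sum_cvg c : exists e : R[i], (fun N => rn (exp_sum N c - e)) @ \oo --> (0 : R).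
Proof.
have [p hp] := part_exp_sum_cvg c (@rn_Re R).
have [q hq] := part_exp_sum_cvg c (@rn_Im R).
exists (p +i* q)%C.
have dist0 (u : nat -> R) (l : R) : u @ \oo --> l -> (fun N => `|u N - l|) @ \oo --> (0 : R).
  move=> ul; rewrite -(normr0 R); apply: cvg_norm; rewrite -(subrr l).
  by apply: cvgB => //; exact: cvg_cst.
have h0 : (fun N => `|complex.Re (exp_sum N c) - p| + `|complex.Im (exp_sum N c) - q|)
    @ \oo --> (0 : R).
  by rewrite -(addr0 (0 : R)); exact: cvgD (dist0 _ _ hp) (dist0 _ _ hq).
apply: (squeeze0 (p := 0) _ h0) => N _; rewrite rn_ge0 /=; apply: le_trans (rn_ReIm _) _.
by case: (exp_sum N c) => a b /=.
Qed.

Lemma rn_limn (u : nat -> A) (l : A) : (fun N => rn (u N - l)) @ \oo --> (0 : R) -> limn u = l.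
Proof.
move=> ul; apply: cvg_lim; first exact: norm_hausdorff.
apply/cvgrPdist_lt => e e0.
have [e' e'0 ->] : exists2 e' : R, 0 < e' & e = e'%:C%C.
  by case: e e0 => p q; rewrite ltcE /= => /andP[/eqP -> p0]; exists p.
move/cvgrPdist_lt: ul => /(_ e' e'0); apply: filterS => N.
by rewrite sub0r normrN ger0_norm ?rn_ge0 // rn_ltP rnC.
Qed.

Lemma comm_scalar c m : GRing.comm (c%:A) m.
Proof. by rewrite /GRing.comm -scalerAl -scalerAr mul1r mulr1. Qed.

(** The partial sums of the series at c and at - c have products tending to 1. *)
Lemma exp_limit_neq0 c e : (1 : A) != 0 ->
  (fun N => rn (exp_sum N c - e)) @ \oo --> (0 : R) -> e != 0.
Proof.
move=> A1 he; apply/eqP => e0; rewrite e0 in he.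
have [e' he'] := exp_sum_cvg (- c).
pose D N : R := exp_partial N (rn (c%:A : A) : R^o) * exp_partial N (rn ((- c)%:A : A) : R^o) -
  exp_partial N (rn (c%:A : A) + rn ((- c)%:A : A) : R^o).
have hD : D @ \oo --> (0 : R) by exact: exp_defect_cvg0.
pose g N : R := D N + rn (exp_sum N c - 0) * (rn (exp_sum N (- c) - e') + rn e') * rn (1 : A).
have hg : g @ \oo --> (0 : R).
  rewrite -[X in _ --> X](addr0 (0 : R)); apply: cvgD => //.
  rewrite -[X in _ --> X](mul0r (rn (1 : A))); apply: cvgM; last exact: cvg_cst.
  rewrite -[X in _ --> X](mul0r (0 + rn e')); apply: cvgM => //.
  by apply: cvgD => //; exact: cvg_cst.
have h1 : (fun _ : nat => rn (1 : A)) @ \oo --> (0 : R).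
  apply: (squeeze0 (p := 1) _ hg) => N N1; rewrite rn_ge0 /=.
  have := rn_exp_defect N (comm_scalar c ((- c)%:A)).
  rewrite -scalerDl subrr scale0r (@exp_partial_nilpotent _ _ N 1 0) ?expr1 //.
  rewrite {3}/exp_partial big_ord_recl big_ord0 addr0 fact0 invr1 scale1r expr0.
  rewrite !exp_partial_scalar -scalerAl mul1r scalerA -/(exp_sum N c) -/(exp_sum N (- c)) => h.
  have := rnB ((exp_sum N c * exp_sum N (- c))%:A : A) ((exp_sum N c * exp_sum N (- c))%:A - 1).
  rewrite opprB addrCA subrr addr0 => h2; apply: le_trans h2 _; rewrite addrC /g.
  apply: lerD; first exact: h.
  rewrite rnZ rnM subr0; apply: ler_wpM2r; first exact: rn_ge0.
  apply: ler_wpM2l; first exact: rn_ge0.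
  by apply: le_trans (rnD _ _); rewrite subrK.
have e1 : rn (1 : A) = 0.
  rewrite -(cvg_lim (@norm_hausdorff R R^o) h1); apply/esym/cvg_lim => //; exact: cvg_cst.
by move/eqP: A1; apply; exact: rn_eq0.
Qed.

(** The partial sums are multiplicative up to a defect that tends to zero, and those of
    the nilpotent term are eventually constant; e is the exponential of c. *)
Lemma cstar_exp_nilpotent c : (1 : A) != 0 -> exists2 e : R[i], e != 0 &
  forall m p, m ^+ p = 0 -> cstar_exp (c%:A + m) = e *: exp_partial p m.
Proof.
move=> A1; have [e he] := exp_sum_cvg c; exists e; first exact: exp_limit_neq0 he.
move=> m p mp; apply: rn_limn; set M := exp_partial p m.
pose D N : R := exp_partial N (rn (c%:A : A) : R^o) * exp_partial N (rn m : R^o) -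
  exp_partial N (rn (c%:A : A) + rn m : R^o).
have hD : D @ \oo --> (0 : R) by exact: exp_defect_cvg0.
pose g N : R := rn (exp_sum N c - e) * rn M + D N.
have hg : g @ \oo --> (0 : R).
  rewrite -[X in _ --> X](addr0 (0 : R)); apply: cvgD => //.
  rewrite -[X in _ --> X](mul0r (rn M)); apply: cvgM => //; exact: cvg_cst.
apply: (squeeze0 (p := p) _ hg) => N pN; rewrite rn_ge0 /=.
have -> : series (fun k => (k`!%:R : R[i])^-1 *: (c%:A + m) ^+ k) N = exp_partial N (c%:A + m).
  by rewrite /series /= big_mkord.
have := rn_exp_defect N (comm_scalar c m).
rewrite (exp_partial_nilpotent mp pN) -/M exp_partial_scalar -/(exp_sum N c) => h.
rewrite rnC; set S := exp_partial N (c%:A + m) in h *.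
have -> : e *: M - S = - ((exp_sum N c - e) *: M) + ((exp_sum N c)%:A * M - S).
  by rewrite scalerBl -scalerAl mul1r opprB addrA subrK.
by apply: le_trans (rnD _ _) _; rewrite rnN rnZ; apply: lerD.
Qed.
End CStarExp.

(** * The clock of the covariance *)

Section Clock.
Variables (R : realType) (I : finType) (T : R) (f : I -> R -> R).
Local Notation mu := (@lebesgue_measure R).
Hypothesis f_int : forall i, mu.-integrable `[0, T] (EFin \o f i).
Hypothesis f_ge0 : forall i r, 0 <= f i r.

(** Total variation of the covariance as a measure of time, with the factor 2 of
    pettis_estimate. Its rate is integrable but need not be bounded; steps that are
    equal on this clock make the errors of a discretisation uniform. *)
Definition clock (r : R) : R := 2 * Rintegral mu `[0, r] (fun u => \sum_i f i u).

Lemma sum_Rintegral (J : Type) (s : seq J) (g : J -> R -> R) (a b : R) :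
  (forall i, mu.-integrable `[a, b] (EFin \o g i)) ->
  mu.-integrable `[a, b] (EFin \o (fun u => \sum_(i <- s) g i u)) /\
  \sum_(i <- s) Rintegral mu `[a, b] (g i) =
  Rintegral mu `[a, b] (fun u => \sum_(i <- s) g i u).
Proof.
move=> ig; elim: s => [|i s [IHi IH]].
  have e : (fun u => \sum_(i <- [::]) g i u) = cst 0.
    by apply/funext => u; rewrite big_nil.
  rewrite e big_nil Rintegral_cst ?mul0r; last exact: mitv.
  split=> //; exact: integrable0.
have e : (fun u => \sum_(j <- i :: s) g j u) = (fun u => g i u + \sum_(j <- s) g j u).
  by apply/funext => u; rewrite big_cons.
rewrite e big_cons IH RintegralD; [|exact: mitv|exact: ig|exact: IHi].
split=> //; exact: (integrableD (mitv _) (ig i) IHi).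
Qed.

Lemma clock_integrable u w : 0 <= u -> w <= T -> 
  mu.-integrable `[u, w] (EFin \o (fun r => \sum_i f i r)).
Proof.
move=> u0 wT.
have [|+ _] := @sum_Rintegral _ (index_enum I) f u w; last by [].
move=> i.
apply: (integrableS (mitv _) (mitv _) _ (f_int i)).
by apply: subset_itv; rewrite bnd_simp.
Qed.

Lemma clock_incr u w : 0 <= u -> u <= w -> w <= T ->
  clock w - clock u = \sum_i 2 * Rintegral mu `[u, w] (f i).
Proof.
move=> u0 uw wT; rewrite /clock -mulrBr Rintegral_tail //; last exact: clock_integrable.
rewrite -mulr_sumr; congr (2 * _); apply/esym.
have [|_ +] := @sum_Rintegral _ (index_enum I) f u w; last by [].
move=> i.
apply: (integrableS (mitv _) (mitv _) _ (f_int i)).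
by apply: subset_itv; rewrite bnd_simp.
Qed.

Lemma clock_mono u w : 0 <= u -> u <= w -> w <= T -> clock u <= clock w.
Proof.
move=> u0 uw wT; rewrite -subr_ge0 clock_incr //; apply: sumr_ge0 => i _.
by rewrite mulr_ge0 // Rintegral_ge0.
Qed.

(** Intermediate value theorem for the clock, which is continuous. *)
Lemma clock_split (k : nat) (e u w : R) : 0 <= u -> u <= w -> w <= T -> 0 <= e ->
  clock w - clock u <= k.+1%:R * e ->
  exists r, [/\ u <= r <= w, clock r - clock u <= e & clock w - clock r <= k%:R * e].
Proof.
move=> u0 uw wT e0 h; have uT := le_trans uw wT.
have cuw := clock_mono u0 uw wT.
have [ew|ew] := leP (clock w - clock u) e.
  exists w; split; [by rewrite uw lexx | exact: ew |].
  by rewrite subrr mulr_ge0.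
have cont : {within `[u, w], continuous clock}.
  have T0 := le_trans u0 uT.
  have c0 := parameterized_integral_continuous T0 (clock_integrable (lexx 0) (lexx T)).
  have : {within `[u, w], continuous (fun x => Rintegral mu `[0, x] (fun u => \sum_i f i u))}.
    apply: continuous_subspaceW c0; by apply: subset_itv; rewrite bnd_simp.
  by move=> h2 x; apply: cvgM; [exact: cvg_cst | exact: h2].
have [|r] := IVT uw cont (v := clock u + e).
  rewrite (min_idPl cuw) (max_idPr cuw) lerDl e0 /=; lra.
rewrite in_itv /= => /andP[ur rw] cr; exists r; split; first by rewrite ur.
  by rewrite cr addrAC subrr add0r.
rewrite cr; move: h; rewrite -natr1 mulrDl mul1r; lra.
Qed.

End Clock.

(** * The solution: anticommutation, adaptedness, bounds *)

Section AntiCommuting.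
Variable U : nzRingType.
Implicit Types a b c : U.
Definition anticommute a b := a * b + b * a = 0.
Lemma anticommute_sym a b : anticommute a b -> anticommute b a.
Proof. by rewrite /anticommute addrC. Qed.
Lemma anticommuteDr a b c : anticommute a b -> anticommute a c -> anticommute a (b + c).
Proof. by rewrite /anticommute mulrDl mulrDr addrACA => -> ->; rewrite addr0. Qed.
Lemma anticommuteBr a b c : anticommute a b -> anticommute a c -> anticommute a (b - c).
Proof.
by rewrite /anticommute mulrBl mulrBr addrACA -opprD => -> ->; rewrite subr0.
Qed.
Lemma anticommuteDl a b c : anticommute b a -> anticommute c a -> anticommute (b + c) a.
Proof. by move=> /anticommute_sym ? /anticommute_sym ?; apply/anticommute_sym/anticommuteDr. Qed.
Lemma anticommuteBl a b c : anticommute b a -> anticommute c a -> anticommute (b - c) a.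
Proof. by move=> /anticommute_sym ? /anticommute_sym ?; apply/anticommute_sym/anticommuteBr. Qed.
End AntiCommuting.

Lemma quotient_cancel (K : fieldType) (e p z : K) : e != 0 -> p / z = e * p * (e * z)^-1.
Proof. by move=> e0; rewrite invfM mulrACA mulfV // mul1r. Qed.

Lemma geometric_bound_eq0 (R : realType) (A : cstarAlgType R) (c : A) (q : R) : 0 <= q -> (forall m : nat, rn c <= q * 2^-1 ^+ m) -> c = 0.
Proof.
move=> q0 cq; apply: (@rn_arbitrarily_small _ _ _ q) => e e0.
pose m := (Num.truncn e^-1).+1; apply: le_trans (cq m) _; apply: ler_wpM2l => //.
rewrite -[leRHS]invrK exprVn lef_pV2 ?posrE ?exprn_gt0 ?invr_gt0 //.
have lt_m : e^-1 < m%:R by exact: truncnS_gt.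
apply: le_trans (ltW lt_m) _; rewrite -natrX ler_nat; exact: ltnW (ltn_expl _ _).
Qed.

Section FBSDETheory.
Variables (R : realType) (A : fnps R) (h : hilbertType R) (n : nat).
Variables (v : 'I_n -> h) (Theta : h -> h) (G Gdot : R -> {linear h -> h}).
Variables (X Psi : R -> {linear h -> A}) (t T : R) (V : extalg R[i] n).
Hypothesis tT : 0 <= t <= T.
Hypothesis v_onb : orthonormal_basis v.
Hypothesis V_even : ext_even V.
Hypothesis X_gbm : is_gbm Theta G X.
Hypothesis G_diff : forall r : R, 0 <= r -> has_derivative G (Gdot r) r.
Hypothesis X_norm : norm_compatible Theta Gdot X.
Hypothesis Psi_sol : fbsde_solution v Theta Gdot X V t T Psi.
Local Notation mu := (@lebesgue_measure R).
Local Notation omega := (nc_state A).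
Local Notation K := R[i].
Implicit Types (F H P Q : extalg K n) (r s u w : R) (i j k : 'I_n).

Let t0 : 0 <= t. Proof. by case/andP: tT. Qed.
Let le_tT : t <= T. Proof. by case/andP: tT. Qed.
Let T0 : 0 <= T. Proof. exact: le_trans t0 le_tT. Qed.

Lemma time_ge0 r : t <= r <= T -> 0 <= r.
Proof. by case/andP=> tr _; exact: le_trans tr. Qed.

Definition solution_gen r i : A := Psi r (v i).
Local Notation psi := solution_gen.
Definition gbm_increment u w i : A := incr X u w (v i).
Local Notation xi := gbm_increment.
(** By the equation this is the integral of the drift over [u, w]. *)
Definition drift_part u w i : A := psi w i - psi u i - xi u w i.
Local Notation dpsi := drift_part.
Definition increment_cov u w i j : K := cov_form Theta G (v i) (v j) w - cov_form Theta G (v i) (v j) u.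
Local Notation Cov := increment_cov.
Definition covariance_speed (p : 'I_n * 'I_n) : R -> R := abs1 (cov_rate Theta Gdot (v p.1) (v p.2)).
Local Notation rate := covariance_speed.
Definition variance_clock := clock rate.
Local Notation clk := variance_clock.

Lemma solution_split u w i : psi w i = psi u i + xi u w i + dpsi u w i.
Proof. by rewrite /dpsi -[_ - psi u i - _]addrA -opprD [RHS]addrC subrK. Qed.

Lemma increment_split u r w i : xi u w i = xi u r i + xi r w i.
Proof. by rewrite /xi /incr [RHS]addrC addrA subrK. Qed.

Lemma gbm_anti r s f g : 0 <= r -> 0 <= s -> anticommute (X r f) (X s g).
Proof. by move=> r0 s0; apply: (gbm_process X_gbm).2. Qed.

Lemma solution_anti r s f g : t <= r <= T -> t <= s <= T -> anticommute (Psi r f) (Psi s g).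
Proof. by move=> r0 s0; apply: (sol_process Psi_sol).2; rewrite /= in_itv. Qed.

Lemma solution_gbm_anti r s f g : t <= r <= T -> 0 <= s -> anticommute (Psi r f) (X s g).
Proof. by move=> r0 s0; apply: (sol_compatible Psi_sol). Qed.

Lemma increment_anti u w u' w' i j : 0 <= u -> 0 <= w -> 0 <= u' -> 0 <= w' ->
  anticommute (xi u w i) (xi u' w' j).
Proof. by move=> *; apply: anticommuteBr; apply: anticommuteBl; apply: gbm_anti. Qed.

Lemma solution_increment_anti r u w i j : t <= r <= T -> 0 <= u -> 0 <= w -> anticommute (psi r i) (xi u w j).
Proof. by move=> *; apply: anticommuteBr; apply: solution_gbm_anti. Qed.

Lemma solution_drift_anti r u w i j : t <= r <= T -> t <= u <= T -> t <= w <= T ->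
  anticommute (psi r i) (dpsi u w j).
Proof.
move=> rT uT wT; have [u0 w0] := (time_ge0 uT, time_ge0 wT).
by apply: anticommuteBr; [apply: anticommuteBr; apply: solution_anti | apply: solution_increment_anti].
Qed.

Lemma increment_drift_anti p r u w i j : 0 <= p -> 0 <= r -> t <= u <= T -> t <= w <= T ->
  anticommute (xi p r i) (dpsi u w j).
Proof.
move=> p0 r0 uT wT; have [u0 w0] := (time_ge0 uT, time_ge0 wT).
apply: anticommuteBr; last exact: increment_anti.
by apply: anticommuteBr; apply/anticommute_sym/solution_increment_anti.
Qed.

Lemma solution_filt r i : t <= r <= T -> filt r (psi r i).
Proof. by move=> r0; apply: (sol_adapted Psi_sol); rewrite /= in_itv. Qed.

Lemma filtD r (b c : A) : 0 <= r -> filt r b -> filt r c -> filt r (b + c).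
Proof.
by move=> r0 fb fc; have [_ + _ _ _] := filt_sub A r0 => /(_ 1 b c fb fc); rewrite scale1r.
Qed.

Lemma filtB r (b c : A) : 0 <= r -> filt r b -> filt r c -> filt r (b - c).
Proof.
move=> r0 fb fc; have [_ + _ _ _] := filt_sub A r0 => /(_ (-1) c b fc fb).
by rewrite scaleN1r addrC.
Qed.

Lemma filt_eval r (y : 'I_n -> A) F : 0 <= r -> (forall i, filt r (y i)) -> filt r (ext_eval y F).
Proof. by move=> r0 fy; have [f1 f2 f3 _ _] := filt_sub A r0; exact: ext_eval_closed. Qed.

Lemma increment_filt u w i : 0 <= u -> u <= w -> filt w (xi u w i).
Proof.
move=> u0 uw; have w0 := le_trans u0 uw; apply: filtB => //.
  exact: (gbm_adapted X_gbm).
by apply: (@filt_mono _ A u); [rewrite u0 uw | exact: (gbm_adapted X_gbm)].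
Qed.

Lemma increment_letter u w i : 0 <= u -> 0 <= w -> gaussian_letter X (xi u w i).
Proof. by move=> u0 w0; apply: GaussianSub; exact: GaussianValue. Qed.

Lemma increment_future u w i : 0 <= u -> u <= w -> future X u (xi u w i).
Proof.
move=> u0; rewrite le_eqVlt => /orP[/eqP<-|uw] B sB gB.
  have [B1 + _ _ _] := sB => /(_ (-1) 1 1 B1 B1).
  by rewrite scaleN1r addNr /xi /incr subrr.
by apply: gB; exists w => //; exists (v i).
Qed.

Lemma omega_increment u w i j : 0 <= u -> u <= w -> omega (xi u w i * xi u w j) = Cov u w i j.
Proof.
move=> u0 uw; have w0 := le_trans u0 uw.
rewrite /xi /incr mulrBl !mulrBr !omegaB !(gbm_cov X_gbm) //.
by rewrite minxx (min_idPr uw) (min_idPl uw) minxx subrr subr0.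
Qed.

Lemma increment_cov_antisym u w : 0 <= u -> u <= w -> antisym (Cov u w).
Proof.
move=> u0 uw i j; rewrite -!omega_increment //; have w0 := le_trans u0 uw.
apply/eqP; rewrite -addr_eq0 -omegaD; apply/eqP.
by have -> := increment_anti i j u0 w0 u0 w0; rewrite linear0.
Qed.

Lemma increment_covD u r w i j : Cov u r i j + Cov r w i j = Cov u w i j.
Proof. by rewrite /Cov [LHS]addrC addrA subrK. Qed.

Lemma heat_comp u r w F : 0 <= u -> u <= r -> r <= w ->
  ext_heat (Cov u r) (ext_heat (Cov r w) F) = ext_heat (Cov u w) F.
Proof.
move=> u0 ur rw; rewrite ext_heat_comp; first last.
- exact: increment_cov_antisym (le_trans u0 ur) rw.
- exact: increment_cov_antisym.
by congr (ext_heat _ F); apply/funext => i; apply/funext => j; exact: increment_covD.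
Qed.

Lemma heat_id u F : ext_heat (Cov u u) F = F.
Proof.
rewrite (_ : Cov u u = fun _ _ => 0) ?ext_heat0 //.
by apply/funext => i; apply/funext => j; exact: subrr.
Qed.

Lemma cexp_increment u w (y : 'I_n -> A) F : 0 <= u -> u <= w -> (forall i, filt u (y i)) -> anticomm y ->
  (forall i j, anticommute (y i) (xi u w j)) ->
  cexp A u (ext_eval (fun i => y i + xi u w i) F) = ext_eval y (ext_heat (Cov u w) F).
Proof.
move=> u0 uw fy ay yx; have w0 := le_trans u0 uw.
have -> : Cov u w = fun i j => omega (xi u w i * xi u w j).
  by apply/funext => i; apply/funext => j; rewrite omega_increment.
apply: (cexp_heat X_gbm u0) => //.
- by move=> i; exact: increment_letter.
- by move=> i j; exact: increment_anti.
- by move=> i; exact: increment_future.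
Qed.

(** The equation reads d psi_i = \sum_k <<v_i, Gdot_r v_k>> b_k(r) dr + d X(v_i), with
    this coefficient b. *)
Definition cond_gradient k r : A := cexp A r (ext_eval (psi T) (ext_deriv k V)).
Local Notation b := cond_gradient.

Lemma cov_rate_integrable f g : cintegrable 0 T (cov_rate Theta Gdot f g).
Proof. by have [ic _] := norm_compatible_bounds G_diff v_onb X_norm T0. Qed.

Lemma speed_integrable p : mu.-integrable `[0, T] (EFin \o rate p).
Proof. exact/cintegrable_abs1/cov_rate_integrable. Qed.

Lemma speed_ge0 p r : 0 <= rate p r.
Proof. exact: addr_ge0. Qed.

Lemma variance_clock_mono u w : 0 <= u -> u <= w -> w <= T -> clk u <= clk w.
Proof. exact: (clock_mono speed_integrable speed_ge0). Qed.

Lemma speed_row u w i : 0 <= u -> u <= w -> w <= T ->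
  \sum_j 2 * Rintegral mu `[u, w] (rate (i, j)) <= clk w - clk u.
Proof.
move=> u0 uw wT; rewrite (clock_incr speed_integrable) // -(pair_bigA _ (fun i j => 2 * Rintegral mu `[u, w] (rate (i, j)))) /=.
rewrite [leRHS](bigD1 i) //= lerDl; apply: sumr_ge0 => k _; apply: sumr_ge0 => j _.
by rewrite mulr_ge0 // Rintegral_ge0 // => r _; exact: speed_ge0.
Qed.

Lemma cov_rn_increment u w : 0 <= u -> u <= w -> w <= T -> cov_rn (Cov u w) <= clk w - clk u.
Proof.
move=> u0 uw wT; rewrite (clock_incr speed_integrable) // -(pair_bigA _ (fun i j => 2 * Rintegral mu `[u, w] (rate (i, j)))) /=.
apply: ler_sum => i _; apply: ler_sum => j _.
have ic : cintegrable 0 w (cov_rate Theta Gdot (v i) (v j)).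
  by apply: cintegrableS (cov_rate_integrable _ _).
rewrite /Cov -(cintegral_cov_rate G_diff u0 uw ic).
have ic' := cintegrableS u0 (lexx w) ic.
apply: rn_cintegral_le => //; first exact: cintegrable_abs1.
by move=> r _; exact: rn_ReIm.
Qed.

(** Replacing b j by a constant Q j turns the weak integral of the drift into Q j times
    the integral of the covariance rate, which is an increment of the covariance. *)
Lemma drift_part_estimate (Phi : {linear A -> A}) (N e : R) u w (Q : 'I_n -> A) i :
  t <= u -> u <= w -> w <= T -> 0 <= e -> (forall c, rn (Phi c) <= N * rn c) ->
  (forall r j, u <= r <= w -> rn (Phi (b j r) - Q j) <= e) ->
  rn (Phi (dpsi u w i) - \sum_j Cov u w i j *: Q j) <= e * (clk w - clk u).
Proof.
move=> tu uw wT e0 PN PQ; have u0 := le_trans t0 tu; have tw := le_trans tu uw.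
have uT := le_trans uw wT.
have [|I iI eI] := sol_eq Psi_sol (s := u) (v i); first by rewrite tu.
have [|J iJ eJ] := sol_eq Psi_sol (s := w) (v i); first by rewrite tw.
have -> : dpsi u w i = \sum_j (J j - I j).
  have e4 (p q y z : A) : y + (p + q) - (z + p) - q = y - z.
    by rewrite -addrA -opprD -[z + p + q]addrA opprD addrACA subrr addr0.
  rewrite /dpsi /psi eI eJ sumrB -[incr X t w _]/(xi t w i) (increment_split t u w).
  exact: e4.
rewrite raddf_sum -sumrB; apply: le_trans (rn_sum _ _ _) _.
apply: (@le_trans _ _ (\sum_j e * (2 * Rintegral mu `[u, w] (rate (i, j))))); last first.
  by rewrite -mulr_sumr ler_wpM2l // speed_row.
apply: ler_sum => j _.
have ic : cintegrable 0 w (cov_rate Theta Gdot (v i) (v j)).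
  by apply: cintegrableS (cov_rate_integrable _ _).
rewrite /Cov -(cintegral_cov_rate G_diff u0 uw ic).
have := pettis_estimate PN tu uw e0 (iI j) (iJ j) (cintegrableS t0 (lexx w) ic).
move=> /(_ (Q j) (fun r ur => PQ r j ur)); rewrite mulrCA mulrA; exact.
Qed.

Definition cond_gradient_max : R := \sum_k rn (ext_eval (psi T) (ext_deriv k V)).
Local Notation b_max := cond_gradient_max.

Lemma cond_gradient_max_ge0 : 0 <= b_max.
Proof. by apply: sumr_ge0 => k _; exact: rn_ge0. Qed.

Lemma rn_cond_gradient k r : 0 <= r -> rn (b k r) <= b_max.
Proof.
move=> r0; apply: le_trans (rn_cexp r0 _) _.
by rewrite /b_max (bigD1 k) //= lerDl; apply: sumr_ge0 => j _; exact: rn_ge0.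
Qed.

Lemma rn_drift_part u w i : t <= u -> u <= w -> w <= T ->
  rn (dpsi u w i) <= b_max * (clk w - clk u).
Proof.
move=> tu uw wT; have := @drift_part_estimate idfun 1 b_max u w (fun=> 0) i tu uw wT cond_gradient_max_ge0.
rewrite [X in rn (_ - X)]big1 ?subr0; last by move=> j _; rewrite scaler0.
apply=> [c|r j /andP[ur _]]; first by rewrite mul1r.
by rewrite subr0; apply: rn_cond_gradient; exact: le_trans t0 (le_trans tu ur).
Qed.

(** The increments of X are bounded by norm compatibility, and the drift by the clock. *)
Lemma field_bound : exists2 M : R, 1 <= M & forall u w i, t <= u -> u <= w -> w <= T ->
  [/\ rn (psi u i) <= M, rn (xi u w i) <= M & rn (psi u i + xi u w i) <= M].
Proof.
have [N HN] : exists N : 'I_n -> R, forall i r, 0 <= r <= T -> rn (X r (v i)) <= N i.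
  have [_ bX] := norm_compatible_bounds G_diff v_onb X_norm T0.
  have /boolp.choice[N HN] : forall i, exists N, forall r, 0 <= r <= T -> rn (X r (v i)) <= N.
    by move=> i; have [N _ HN] := bX (v i); exists N.
  by exists N.
pose m i := rn (psi t i) + 4 * N i + b_max * (clk T - clk t).
have N0 i : 0 <= N i by apply: le_trans (HN i 0 _); rewrite ?rn_ge0 ?lexx.
have D0 : 0 <= b_max * (clk T - clk t).
  by rewrite mulr_ge0 ?cond_gradient_max_ge0 // subr_ge0 variance_clock_mono.
have m0 i : 0 <= m i by rewrite addr_ge0 // addr_ge0 ?rn_ge0 // mulr_ge0.
exists (1 + \sum_i m i); first by rewrite lerDl sumr_ge0.
move=> u w i tu uw wT; have u0 := le_trans t0 tu; have w0 := le_trans u0 uw.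
have uT := le_trans uw wT.
have mi : m i <= 1 + \sum_i m i.
  by rewrite (bigD1 i) //= addrCA lerDl addr_ge0 // sumr_ge0.
have xb p q : 0 <= p <= T -> 0 <= q <= T -> rn (xi p q i) <= 2 * N i.
  move=> pT qT; apply: le_trans (rnB _ _) _; rewrite mulr_natl mulr2n.
  by apply: lerD; exact: HN.
have x1 := xb u w; rewrite u0 w0 uT wT in x1.
have x2 := xb t u; rewrite t0 u0 le_tT uT in x2.
have pb : rn (psi u i) <= rn (psi t i) + 2 * N i + b_max * (clk T - clk t).
  rewrite (solution_split t u); apply: le_trans (rnD _ _) _; apply: lerD.
    by apply: le_trans (rnD _ _) _; apply: lerD => //; exact: x2.
  apply: le_trans (rn_drift_part _ (lexx t) tu uT) _.
  by rewrite ler_wpM2l ?cond_gradient_max_ge0 // lerD2r variance_clock_mono.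
have pb' : rn (psi u i) <= m i by apply: le_trans pb _; rewrite /m; have := N0 i; lra.
split; first exact: le_trans mi.
  apply: le_trans mi; apply: le_trans (x1 isT isT) _; rewrite /m.
  by have := N0 i; have := rn_ge0 (psi t i); lra.
apply: le_trans mi; apply: le_trans (rnD _ _) _.
by have := x1 isT isT; rewrite /m; lra.
Qed.

(** The exponential of V up to a scalar factor, normalised to have scalar part 1. *)
Definition gibbs_weight : extalg K n := ext_exp (V - (V finset.set0)%:A).
Local Notation E := gibbs_weight.
(** The conditional expectation at time r of E (y + xi r T), as a function of y. *)
Definition tail_weight r : extalg K n := ext_heat (Cov r T) E.
Local Notation Z := tail_weight.

Lemma potential_par : ext_par V = V. Proof. exact: ext_even_par. Qed.

Lemma centred_potential_par : ext_par (V - (V finset.set0)%:A) = V - (V finset.set0)%:A.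
Proof. by rewrite raddfB /= linearZ /= ext_par1 potential_par. Qed.

Lemma weight_par : ext_par E = E. Proof. exact/ext_exp_even/centred_potential_par. Qed.

Lemma weight_scalar : E finset.set0 = 1. Proof. exact/ext_exp_scalar/(ext_sub_scalar V). Qed.

Lemma weight_deriv k : ext_deriv k E = ext_deriv k V * E.
Proof.
rewrite (ext_deriv_exp _ centred_potential_par (ext_sub_scalar V)); congr (_ * _).
by rewrite raddfB /= ext_derivZ ext_deriv1 scaler0 subr0.
Qed.

Lemma tail_weight_par r : ext_par (Z r) = Z r. Proof. exact/ext_heat_even/weight_par. Qed.

Lemma heat_tail_weight u w : 0 <= u -> u <= w -> w <= T -> ext_heat (Cov u w) (Z w) = Z u.
Proof. exact: heat_comp. Qed.

Lemma tail_weight_bound : exists2 zb : R, 0 <= zb & forall r, t <= r <= T -> ext_rn (Z r) <= zb.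
Proof.
have c0 : 0 <= clk T - clk t by rewrite subr_ge0 variance_clock_mono.
have e0 : 0 <= ext_rn E by exact: ext_rn_ge0.
exists (n.+1%:R * (1 + (clk T - clk t)) ^+ n * ext_rn E).
  by do ![done | apply: mulr_ge0 | apply: exprn_ge0 | apply: addr_ge0].
move=> r /andP[tr rT]; apply: ext_rn_heat.
apply: le_trans (cov_rn_increment _ rT (lexx T)) _; first exact: le_trans tr.
by rewrite lerD2l lerN2 variance_clock_mono.
Qed.

Definition cexp_mulr u (y : A) (c : A) : A := cexp A u (c * y).
Lemma cexp_mulr_is_linear u y : linear (cexp_mulr u y).
Proof. by move=> z p q; rewrite /cexp_mulr mulrDl -scalerAl linearP. Qed.
HB.instance Definition _ u y := GRing.isLinear.Build K A A *:%R
  (cexp_mulr u y) (cexp_mulr_is_linear u y).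

Lemma rn_cexp_mulr u y c : 0 <= u -> rn (cexp_mulr u y c) <= rn c * rn y.
Proof. by move=> u0; apply: le_trans (rn_cexp u0 _) _; exact: rn_mul. Qed.

Lemma solution_anticomm r : t <= r <= T -> anticomm (psi r).
Proof. by move=> rT i j; exact: solution_anti. Qed.

Lemma shifted_solution_anticomm u w : t <= u -> u <= w -> w <= T -> anticomm (fun i => psi u i + xi u w i).
Proof.
move=> tu uw wT; have u0 := le_trans t0 tu; have w0 := le_trans u0 uw.
have uT : t <= u <= T by rewrite tu (le_trans uw).
move=> i j; apply: anticommuteDl; apply: anticommuteDr; try exact: increment_anti.
- exact: solution_anti.
- exact: solution_increment_anti.
- exact/anticommute_sym/solution_increment_anti.
Qed.

Lemma telescope3 u (p q y z w : A) : cexp A u (p * z) - w =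
  cexp A u ((p - q) * z) + cexp A u ((q - y) * z) + (cexp A u (y * z) - w).
Proof. by rewrite addrA -linearD -mulrDl addrA subrK -linearD -mulrDl subrK. Qed.

Definition log_gradient k r : extalg K n := log_deriv (Z r) k.
Local Notation beta := log_gradient.

(** Conditioning b_r first at r, and then at u, replaces psi_r by psi_u + xi_{u,r} up to
    an error of the order of the drift, and then integrates xi out by Wick's rule. The
    result is close to the value at psi_u by log_deriv_transport. *)
Lemma conditioned_drift (k : R) : 0 < k -> exists2 L : R, 0 <= L &
  forall F j u r w (e eta : R), t <= u -> u <= r -> r <= w -> w <= T ->
    clk w - clk u <= e -> e <= 1 -> b_max * e <= 1 -> 0 <= eta ->
    k <= rn (Z r finset.set0 : K) -> k <= rn (Z w finset.set0 : K) ->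
    rn (b j r - ext_eval (psi r) (beta j r)) <= eta ->
    rn (cexp A u (b j r * ext_eval (fun i => psi u i + xi u w i) F) -
        ext_eval (psi u) (beta j w * F)) <= ext_rn F * (L * (e + eta)).
Proof.
move=> k0; have [M M1 HM] := field_bound; have [zb zb0 Zb] := tail_weight_bound.
have [L1 L10 HL1] := rn_ext_diff_taylor n A M1.
have [L2 L20 HL2] := log_deriv_transport n k0 zb0.
have M0 : 0 <= M by exact: le_trans M1.
pose q := zb * inv_bound n k zb; pose m := M ^+ n.
have q0 : 0 <= q by rewrite mulr_ge0 ?inv_bound_ge0.
have m0 : 0 <= m by exact: exprn_ge0.
have B0 := cond_gradient_max_ge0.
exists (m + q * (L1 * b_max) * m + L2 * m).
  by do ![done | apply: addr_ge0 | apply: mulr_ge0].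
move=> F j u r w e eta tu ur rw wT ce e1 Be eta0 kr kw beta_r.
have u0 := le_trans t0 tu; have r0 := le_trans u0 ur; have w0 := le_trans r0 rw.
have uw := le_trans ur rw; have tr := le_trans tu ur; have tw := le_trans tr rw.
have rT := le_trans rw wT; have uT := le_trans ur rT.
have crw : clk r <= clk w by exact: variance_clock_mono.
have cur : clk u <= clk r by exact: variance_clock_mono.
have cure : clk r - clk u <= e by apply: le_trans ce; rewrite lerD2r.
have crwe : clk w - clk r <= e by apply: le_trans ce; rewrite lerD2l lerN2.
have e0 : 0 <= e by apply: le_trans ce; rewrite subr_ge0 (le_trans cur).
pose Y i := psi u i + xi u w i; pose Yr i := psi u i + xi u r i.
have YE : Y = fun i => Yr i + xi r w i.
  by apply/funext => i; rewrite /Y /Yr (increment_split u r) addrA.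
have rY F' : rn (ext_eval Y F') <= ext_rn F' * m.
  by apply: rn_eval => // i; have [] := HM u w i tu uw wT.
have aYr : anticomm Yr by exact: shifted_solution_anticomm.
have fYr i : filt r (Yr i).
  apply: filtD => //; last exact: increment_filt.
  by apply: (@filt_mono _ A u); rewrite ?u0 //; apply: solution_filt; rewrite tu.
have bZr : ext_rn (beta j r) <= q.
  have ZrB : ext_rn (Z r) <= zb by apply: Zb; rewrite tr.
  exact: (ext_rn_log_deriv j k0 kr ZrB).
(* p1: b r is not exactly the logarithmic gradient; p2: psi r is replaced by Yr;
   p4: the logarithmic gradient is moved from r to w *)
have p1 : rn (cexp A u ((b j r - ext_eval (psi r) (beta j r)) * ext_eval Y F)) <= eta * (ext_rn F * m).
  by apply: le_trans (rn_cexp_mulr _ _ u0) _; apply: ler_pM; rewrite ?rn_ge0.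
have p2 : rn (cexp A u ((ext_eval (psi r) (beta j r) - ext_eval Yr (beta j r)) * ext_eval Y F))
    <= q * (L1 * (b_max * e)) * (ext_rn F * m).
  apply: le_trans (rn_cexp_mulr _ _ u0) _; apply: ler_pM; rewrite ?rn_ge0 //.
  have -> : psi r = fun i => Yr i + dpsi u r i by apply/funext => i; exact: solution_split.
  have be01 : 0 <= b_max * e <= 1 by rewrite Be mulr_ge0.
  have [||||ht _] := HL1 Yr (dpsi u r) (b_max * e) be01 aYr _ _ _ _ (beta j r).
  - have -> : (fun i => Yr i + dpsi u r i) = psi r.
      by apply/funext => i; rewrite (solution_split u r).
    by apply: solution_anticomm; rewrite tr.
  - by move=> i l; apply: anticommuteDl; [apply: solution_drift_anti | apply: increment_drift_anti]; rewrite ?tu ?tr.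
  - by move=> i; have [] := HM u r i tu ur rT.
  - move=> i; apply: le_trans (rn_drift_part _ tu ur rT) _; exact: ler_wpM2l.
  - apply: le_trans ht _; apply: ler_wpM2r => //.
    by do ![done | apply: mulr_ge0].
have p3 : cexp A u (ext_eval Yr (beta j r) * ext_eval Y F) =
    ext_eval (psi u) (ext_heat (Cov u r) (beta j r * ext_heat (Cov r w) F)).
  rewrite -(@cexp_tower _ A u r) ?u0 // cexp_filtM //; last exact: filt_eval.
  rewrite YE cexp_increment //; last first.
    by move=> i l; apply: anticommuteDl; [apply: solution_increment_anti; rewrite ?tu | apply: increment_anti].
  rewrite -ext_evalM // cexp_increment //.
  - by move=> i; apply: solution_filt; rewrite tu.
  - by apply: solution_anticomm; rewrite tu.
  - by move=> i l; apply: solution_increment_anti; rewrite ?tu.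
have p4 : rn (ext_eval (psi u) (ext_heat (Cov u r) (beta j r * ext_heat (Cov r w) F) - beta j w * F))
    <= ext_rn F * (L2 * e) * m.
  apply: le_trans (rn_eval _ M1 _) _.
    by move=> i; have [] := HM u w i tu uw wT.
  apply: ler_wpM2r; first exact: m0.
  have eZr : ext_heat (Cov r w) (Z w) = Z r by exact: heat_tail_weight.
  have := HL2 (Cov u r) (Cov r w) (Z w) F j e; rewrite eZr; apply.
  - exact: le_trans (cov_rn_increment u0 ur rT) _.
  - exact: le_trans (cov_rn_increment r0 rw wT) _.
  - exact: e1.
  - exact: tail_weight_par.
  - by apply: Zb; rewrite tw.
  - exact: kw.
  - exact: kr.
have -> : cexp A u (b j r * ext_eval Y F) - ext_eval (psi u) (beta j w * F) =
    cexp A u ((b j r - ext_eval (psi r) (beta j r)) * ext_eval Y F) +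
    cexp A u ((ext_eval (psi r) (beta j r) - ext_eval Yr (beta j r)) * ext_eval Y F) +
    ext_eval (psi u) (ext_heat (Cov u r) (beta j r * ext_heat (Cov r w) F) - beta j w * F).
  have e5 := @ext_eval_is_linear K n A (psi u) (-1) (beta j w * F)
    (ext_heat (Cov u r) (beta j r * ext_heat (Cov r w) F)).
  by move: e5; rewrite !scaleN1r ![- _ + _]addrC => ->; rewrite -p3; exact: telescope3.
apply: le_trans (rnD _ _) _.
apply: (@le_trans _ _ (eta * (ext_rn F * m) + q * (L1 * (b_max * e)) * (ext_rn F * m) +
    ext_rn F * (L2 * e) * m)).
  by apply: lerD => //; apply: le_trans (rnD _ _) _; exact: lerD.
rewrite -subr_ge0; have -> : ext_rn F * ((m + q * (L1 * b_max) * m + L2 * m) * (e + eta)) -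
  (eta * (ext_rn F * m) + q * (L1 * (b_max * e)) * (ext_rn F * m) + ext_rn F * (L2 * e) * m) =
  ext_rn F * (m * e + (q * (L1 * b_max) * m + L2 * m) * eta) by ring.
by do ![done | exact: ext_rn_ge0 | apply: addr_ge0 | apply: mulr_ge0].
Qed.

(** * The Euler scheme *)

(** The Doob transform by Z of the heat flow from w to u: the candidate for the transition
    operator of the solution. *)
Definition tilt u w H : extalg K n := ext_heat (Cov u w) (H * Z w) * ext_inv (Z u).

Lemma split_taylor u (p q r y w : A) : cexp A u p - w =
  cexp A u (p - q - r) + (cexp A u r - y) + (cexp A u q + y - w).
Proof.
have e (c f g : A) : c - w = c - f - g + (g - y) + (f + y - w).
  by rewrite [c - f - g + _]addrA subrK -[c - f - y]addrA -opprD addrA subrK.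
by rewrite (e _ (cexp A u q) (cexp A u r)) -!linearB.
Qed.

(** Write psi_w = Y + dpsi with Y = psi_u + xi_{u,w}, and expand around Y. Wick's rule
    for the term of order zero and conditioned_drift for that of order one give the heat
    flow of H plus drift (Cov u w) (Z w) H, which tilted_heat_step compares with the
    tilted flow. *)
Lemma one_step (k : R) : 0 < k -> exists2 L : R, 0 <= L &
  forall H u w (e eta : R), t <= u -> u <= w -> w <= T ->
    clk w - clk u <= e -> e <= 1 -> b_max * e <= 1 -> 0 <= eta ->
    (forall r, u <= r <= w -> k <= rn (Z r finset.set0 : K)) ->
    (forall r j, u <= r <= w -> rn (b j r - ext_eval (psi r) (beta j r)) <= eta) ->
    rn (cexp A u (ext_eval (psi w) H) - ext_eval (psi u) (tilt u w H)) <=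
      ext_rn H * (L * (e ^+ 2 + e * eta)).
Proof.
move=> k0; have [M M1 HM] := field_bound; have [zb zb0 Zb] := tail_weight_bound.
have [L1 L10 HL1] := rn_ext_diff_taylor n A M1.
have [L2 L20 HL2] := conditioned_drift k0.
have [L3 L30 HL3] := tilted_heat_step n k0 zb0.
pose m := M ^+ n; have m0 : 0 <= m by apply: exprn_ge0; exact: le_trans M1.
have B0 := cond_gradient_max_ge0.
exists (L1 * b_max ^+ 2 + n%:R * L2 + L3 * m).
  by do ![done | apply: addr_ge0 | apply: mulr_ge0 | apply: exprn_ge0].
move=> H u w e eta tu uw wT ce e1 Be eta0 kz beta_r.
have u0 := le_trans t0 tu; have w0 := le_trans u0 uw; have tw := le_trans tu uw.
have uT := le_trans uw wT.
have e0 : 0 <= e by apply: le_trans ce; rewrite subr_ge0 variance_clock_mono.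
have hH := ext_rn_ge0 H.
have kw : k <= rn (Z w finset.set0 : K) by apply: kz; rewrite uw lexx.
have ku : k <= rn (Z u finset.set0 : K) by apply: kz; rewrite uw lexx.
pose Y i := psi u i + xi u w i.
have aY : anticomm Y by exact: shifted_solution_anticomm.
have psiw : psi w = fun i => Y i + dpsi u w i by apply/funext => i; exact: solution_split.
have apsiw : anticomm (fun i => Y i + dpsi u w i).
  by rewrite -psiw; apply: solution_anticomm; rewrite tw.
have be01 : 0 <= b_max * e <= 1 by rewrite Be mulr_ge0.
have p1 : rn (ext_taylor Y (dpsi u w) H) <= ext_rn H * (L1 * (b_max * e) ^+ 2).
  have [||| _ ht] := HL1 Y (dpsi u w) (b_max * e) be01 aY apsiw _ _ _ H.
  - by move=> i l; apply: anticommuteDl; [apply: solution_drift_anti | apply: increment_drift_anti]; rewrite ?tu ?tw.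
  - by move=> i; have [] := HM u w i tu uw wT.
  - by move=> i; apply: le_trans (rn_drift_part _ tu uw wT) _; exact: ler_wpM2l.
  - exact: ht.
pose D := drift (Cov u w) (Z w) H.
have eD : ext_eval (psi u) D =
    \sum_i \sum_j Cov u w i j *: ext_eval (psi u) (beta j w * ext_deriv i H).
  rewrite /D /drift raddf_sum; apply: eq_bigr => i _.
  by rewrite raddf_sum; apply: eq_bigr => j _; exact: linearZ.
have p2 i : rn (cexp A u (dpsi u w i * ext_eval Y (ext_deriv i H)) -
    \sum_j Cov u w i j *: ext_eval (psi u) (beta j w * ext_deriv i H)) <=
    ext_rn H * (L2 * (e + eta)) * e.
  have q0 : 0 <= ext_rn H * (L2 * (e + eta)).
    by do ![done | apply: mulr_ge0 | apply: addr_ge0].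
  apply: (@le_trans _ _ (ext_rn H * (L2 * (e + eta)) * (clk w - clk u))); last first.
    exact: ler_wpM2l.
  apply: (@drift_part_estimate (cexp_mulr u (ext_eval Y (ext_deriv i H)))
    (rn (ext_eval Y (ext_deriv i H))) _ u w _ i tu uw wT q0).
    by move=> c; rewrite mulrC; exact: rn_cexp_mulr.
  move=> r j /andP[ur rw].
  apply: le_trans (HL2 (ext_deriv i H) j u r w e eta tu ur rw wT ce e1 Be eta0 _ kw _) _.
  - by apply: kz; rewrite ur.
  - by apply: beta_r; rewrite ur.
  - apply: ler_wpM2r (ext_rn_deriv _ _).
    by do ![done | apply: mulr_ge0 | apply: addr_ge0].
have p3 : rn (ext_eval (psi u) (ext_heat (Cov u w) H + D - tilt u w H)) <=
    ext_rn H * (L3 * e ^+ 2) * m.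
  apply: le_trans (rn_eval _ M1 _) _; first by move=> i; have [] := HM u w i tu uw wT.
  apply: ler_wpM2r; first exact: m0.
  have := HL3 (Cov u w) (Z w) H e; rewrite heat_tail_weight //; apply.
  - exact: increment_cov_antisym.
  - exact: le_trans (cov_rn_increment u0 uw wT) _.
  - exact: e1.
  - exact: tail_weight_par.
  - by apply: Zb; rewrite tw.
  - exact: kw.
  - exact: ku.
have p4 : cexp A u (ext_eval Y H) = ext_eval (psi u) (ext_heat (Cov u w) H).
  apply: cexp_increment => //.
  - by move=> i; apply: solution_filt; rewrite tu.
  - by apply: solution_anticomm; rewrite tu.
  - by move=> i l; apply: solution_increment_anti; rewrite ?tu.
have split4 : cexp A u (ext_eval (psi w) H) - ext_eval (psi u) (tilt u w H) =
    cexp A u (ext_taylor Y (dpsi u w) H) +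
    \sum_i (cexp A u (dpsi u w i * ext_eval Y (ext_deriv i H)) -
      \sum_j Cov u w i j *: ext_eval (psi u) (beta j w * ext_deriv i H)) +
    ext_eval (psi u) (ext_heat (Cov u w) H + D - tilt u w H).
  have e5 := @ext_eval_is_linear K n A (psi u) (-1) (tilt u w H) (ext_heat (Cov u w) H + D).
  have e6 := @ext_eval_is_linear K n A (psi u) 1 (ext_heat (Cov u w) H) D.
  move: e5; rewrite !scaleN1r ![- _ + _]addrC => ->.
  move: e6; rewrite !scale1r => ->; rewrite sumrB -eD -p4 -raddf_sum psiw.
  exact: split_taylor.
rewrite split4.
apply: le_trans (rnD _ _) _.
apply: (@le_trans _ _ (ext_rn H * (L1 * (b_max * e) ^+ 2) +
   \sum_(i < n) ext_rn H * (L2 * (e + eta)) * e + ext_rn H * (L3 * e ^+ 2) * m)).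
  apply: lerD => //; apply: le_trans (rnD _ _) _; apply: lerD.
    by apply: le_trans (rn_cexp u0 _) _.
  by apply: le_trans (rn_sum _ _ _) _; apply: ler_sum => i _.
rewrite sumr_const card_ord -[_ *+ n]mulr_natl -subr_ge0.
have -> : ext_rn H * ((L1 * b_max ^+ 2 + n%:R * L2 + L3 * m) * (e ^+ 2 + e * eta)) -
  (ext_rn H * (L1 * (b_max * e) ^+ 2) + n%:R * (ext_rn H * (L2 * (e + eta)) * e) +
    ext_rn H * (L3 * e ^+ 2) * m) =
  ext_rn H * ((L1 * b_max ^+ 2 + L3 * m) * (e * eta)) by ring.
by do ![done | apply: addr_ge0 | apply: mulr_ge0 | apply: exprn_ge0].
Qed.

Lemma tilt_comp u w s P : 0 <= u -> u <= w -> w <= s -> Z w finset.set0 != 0 ->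
  tilt u w (tilt w s P) = tilt u s P.
Proof.
move=> u0 uw ws zw.
have e1 : tilt w s P * Z w = ext_heat (Cov w s) (P * Z s).
  rewrite /tilt -mulrA (_ : ext_inv (Z w) * Z w = 1) ?mulr1 //.
  by rewrite (ext_evenC _ (tail_weight_par w)) ext_mulVr.
have e2 := heat_comp (P * Z s) u0 uw ws.
exact: (congr1 (fun F => F * ext_inv (Z u)) (etrans (congr1 (ext_heat (Cov u w)) e1) e2)).
Qed.

Lemma tail_weight_neq0 (k : R) r : 0 < k -> k <= rn (Z r finset.set0 : K) -> Z r finset.set0 != 0.
Proof. by move=> k0 kz; apply: contraTneq kz => ->; rewrite rn0 -ltNge. Qed.

Lemma ext_rn_tilt (k : R) : 0 < k -> exists2 L : R, 0 <= L &
  forall u s P, t <= u -> u <= s -> s <= T -> k <= rn (Z u finset.set0 : K) ->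
    ext_rn (tilt u s P) <= ext_rn P * L.
Proof.
move=> k0; have [zb zb0 Zb] := tail_weight_bound.
pose c0 := clk T - clk t; have c00 : 0 <= c0 by rewrite subr_ge0 variance_clock_mono.
exists (n.+1%:R * (1 + c0) ^+ n * zb * inv_bound n k zb).
  apply: mulr_ge0; last exact: inv_bound_ge0.
  by do ![done | apply: addr_ge0 | apply: mulr_ge0 | apply: exprn_ge0].
move=> u s P tu us sT ku; have uT := le_trans us sT; have ts := le_trans tu us.
have u0 := le_trans t0 tu.
have cus : cov_rn (Cov u s) <= c0.
  apply: le_trans (cov_rn_increment u0 us sT) _; apply: lerB; apply: variance_clock_mono => //.
  exact: le_trans us.
apply: le_trans (ext_rnM _ _) _; rewrite mulrA; apply: ler_pM; rewrite ?ext_rn_ge0 //; last first.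
  by apply: ext_rn_inv => //; apply: Zb; rewrite tu.
apply: le_trans (ext_rn_heat _ cus) _; rewrite [leRHS]mulrCA; apply: ler_wpM2l.
  by do ![done | apply: addr_ge0 | apply: mulr_ge0 | apply: exprn_ge0].
apply: le_trans (ext_rnM _ _) _; apply: ler_wpM2l; first exact: ext_rn_ge0.
by apply: Zb; rewrite ts.
Qed.

(** Conditional expectations are contractions and tilts compose (tilt_comp), so that the
    errors of the steps add up. *)
Lemma iterated_steps (k : R) : 0 < k -> exists2 L : R, 0 <= L &
  forall (N : nat) P u s (e eta : R), t <= u -> u <= s -> s <= T ->
    clk s - clk u <= N%:R * e -> 0 <= e -> e <= 1 -> b_max * e <= 1 -> 0 <= eta ->
    (forall r, u <= r <= s -> k <= rn (Z r finset.set0 : K)) ->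
    (forall r j, u <= r <= s -> rn (b j r - ext_eval (psi r) (beta j r)) <= eta) ->
    rn (cexp A u (ext_eval (psi s) P) - ext_eval (psi u) (tilt u s P)) <=
      N.+1%:R * (ext_rn P * (L * (e ^+ 2 + e * eta))).
Proof.
move=> k0; have [L1 L10 H1] := one_step k0; have [L2 L20 H2] := ext_rn_tilt k0.
exists ((1 + L2) * L1); first by rewrite mulr_ge0 // addr_ge0.
elim=> [|N IH] P u s e eta tu us sT ce e0 e1 Be eta0 kz bz.
  have ce' : clk s - clk u <= e by apply: le_trans ce _; rewrite mul0r.
  apply: le_trans (H1 P u s e eta tu us sT ce' e1 Be eta0 kz bz) _.
  rewrite mul1r; apply: ler_wpM2l; first exact: ext_rn_ge0.
  apply: ler_wpM2r; last by rewrite ler_peMl // lerDl.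
  by do ![done | apply: addr_ge0 | apply: mulr_ge0 | apply: exprn_ge0].
have u0 := le_trans t0 tu.
have [w [/andP[uw ws] cw1 cw2]] := clock_split speed_integrable speed_ge0 u0 us sT e0 ce.
have tw := le_trans tu uw; have w0 := le_trans t0 tw; have wT := le_trans ws sT.
have kz1 r : u <= r <= w -> k <= rn (Z r finset.set0 : K).
  by case/andP=> ur rw; apply: kz; rewrite ur (le_trans rw).
have kz2 r : w <= r <= s -> k <= rn (Z r finset.set0 : K).
  by case/andP=> wr rs; apply: kz; rewrite rs (le_trans uw).
have bz1 r j : u <= r <= w -> rn (b j r - ext_eval (psi r) (beta j r)) <= eta.
  by case/andP=> ur rw; apply: bz; rewrite ur (le_trans rw).
have bz2 r j : w <= r <= s -> rn (b j r - ext_eval (psi r) (beta j r)) <= eta.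
  by case/andP=> wr rs; apply: bz; rewrite rs (le_trans uw).
have h1 := IH P w s e eta tw ws sT cw2 e0 e1 Be eta0 kz2 bz2.
have h2 := H1 (tilt w s P) u w e eta tu uw wT cw1 e1 Be eta0 kz1 bz1.
have kw : k <= rn (Z w finset.set0 : K) by apply: kz2; rewrite ws lexx.
have -> : cexp A u (ext_eval (psi s) P) - ext_eval (psi u) (tilt u s P) =
    cexp A u (cexp A w (ext_eval (psi s) P) - ext_eval (psi w) (tilt w s P)) +
    (cexp A u (ext_eval (psi w) (tilt w s P)) - ext_eval (psi u) (tilt u w (tilt w s P))).
  rewrite tilt_comp //; last exact: tail_weight_neq0 kw.
  by rewrite linearB /= cexp_tower ?u0 // addrA subrK.
apply: le_trans (rnD _ _) _.
rewrite -[N.+2]addn1 natrD mulrDl mul1r; apply: lerD.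
  by apply: le_trans (rn_cexp u0 _) _; exact: h1.
apply: le_trans h2 _.
have x0 : 0 <= e ^+ 2 + e * eta.
  by do ![done | apply: addr_ge0 | apply: mulr_ge0 | apply: exprn_ge0].
have -> : ext_rn P * ((1 + L2) * L1 * (e ^+ 2 + e * eta)) =
  ext_rn P * (1 + L2) * (L1 * (e ^+ 2 + e * eta)) by ring.
apply: ler_wpM2r; first exact: mulr_ge0.
apply: le_trans (H2 w s P tw ws sT kw) _; apply: ler_wpM2l; first exact: ext_rn_ge0.
by rewrite lerDr.
Qed.

(** As the mesh of the clock goes to zero only the error of the drift survives. *)
Lemma transport_error (k : R) : 0 < k -> exists2 L : R, 0 <= L &
  forall P u s (eta : R), t <= u -> u <= s -> s <= T -> 0 <= eta ->
    (forall r, u <= r <= s -> k <= rn (Z r finset.set0 : K)) ->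
    (forall r j, u <= r <= s -> rn (b j r - ext_eval (psi r) (beta j r)) <= eta) ->
    rn (cexp A u (ext_eval (psi s) P) - ext_eval (psi u) (tilt u s P)) <=
      ext_rn P * (L * (clk s - clk u) * eta).
Proof.
move=> k0; have [L L0 HL] := iterated_steps k0; exists (2 * L); first exact: mulr_ge0.
move=> P u s eta tu us sT eta0 kz bz; have u0 := le_trans t0 tu.
set rho := clk s - clk u; have rho0 : 0 <= rho by rewrite subr_ge0 variance_clock_mono.
have p0 := ext_rn_ge0 P; have B0 := cond_gradient_max_ge0.
set lhs := rn _; set Q := ext_rn P * _.
have bound (N : nat) : (0 < N)%N -> rho / N%:R <= 1 -> b_max * (rho / N%:R) <= 1 ->
    lhs <= Q + ext_rn P * (2 * L) * rho * (rho / N%:R).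
  move=> N0 h1 h2; have nN : N%:R != 0 :> R by rewrite pnatr_eq0 -lt0n.
  have e0 : 0 <= rho / N%:R by rewrite divr_ge0.
  have ce : clk s - clk u <= N%:R * (rho / N%:R) by rewrite mulrC divfK.
  apply: le_trans (HL N P u s _ eta tu us sT ce e0 h1 h2 eta0 kz bz) _.
  set e := rho / N%:R in e0 ce h1 h2 *.
  have x0 : 0 <= ext_rn P * (L * (e ^+ 2 + e * eta)).
    by do ![done | apply: addr_ge0 | apply: mulr_ge0 | apply: exprn_ge0].
  apply: (@le_trans _ _ (2 * N%:R * (ext_rn P * (L * (e ^+ 2 + e * eta))))).
    by apply: ler_wpM2r => //; rewrite -natrM ler_nat mul2n -addnn -addn1 leq_add2l.
  have -> : 2 * N%:R * (ext_rn P * (L * (e ^+ 2 + e * eta))) =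
      ext_rn P * (2 * L) * (N%:R * e) * (e + eta) by ring.
  have -> : N%:R * e = rho by rewrite /e mulrC divfK.
  by rewrite /Q mulrDr addrC !mulrA.
have [//|lt] := leP lhs Q; exfalso.
pose c := ext_rn P * (2 * L) * rho; have c0 : 0 <= c by do ![done | apply: mulr_ge0].
(* with N steps the bound exceeds Q by c * (rho / N), and N > x1 makes this too small *)
pose x1 := rho * (1 + b_max + c / (lhs - Q)).
have dl : 0 < lhs - Q by rewrite subr_gt0.
pose N := (Num.truncn x1).+1; have xN : x1 < N%:R by exact: truncnS_gt.
have N0 : 0 < N%:R :> R by rewrite ltr0n.
have cd : 0 <= c / (lhs - Q) by rewrite divr_ge0 // ltW.
have le1 : rho <= N%:R.
  apply: le_trans (ltW xN); rewrite /x1 -[leLHS]mulr1; apply: ler_wpM2l => //.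
  by rewrite -addrA lerDl addr_ge0.
have le2 : b_max * rho <= N%:R.
  apply: le_trans (ltW xN); rewrite /x1 mulrC; apply: ler_wpM2l => //.
  by rewrite addrAC lerDr addr_ge0.
have := bound N isT; rewrite mulrA !ler_pdivrMr // !mul1r => /(_ le1 le2).
apply/negP; rewrite -ltNge -ltrBrDl mulrA ltr_pdivrMr // -/c.
have -> : c * rho = (lhs - Q) * (rho * (c / (lhs - Q))) by field; rewrite gt_eqF.
rewrite ltr_pM2l //; apply: le_lt_trans xN; apply: ler_wpM2l => //.
by rewrite lerDr addr_ge0.
Qed.

(** * Identification of the drift *)

Definition inv_weight : A := ext_eval (psi T) (ext_inv E).

(** The second clause says that the drift is the logarithmic gradient of Z along the
    solution. The last one propagates with it, and keeps the scalar part of Z away from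
    zero (scalar_lower_bound). *)
Definition drift_matched r := [/\ Z r finset.set0 != 0,
  forall j, b j r = ext_eval (psi r) (beta j r) &
  cexp A r inv_weight = ext_eval (psi r) (ext_inv (Z r))].

Lemma tail_weight_end : Z T = E. Proof. exact: heat_id. Qed.

Lemma cexp_id r (c : A) : 0 <= r -> filt r c -> cexp A r c = c.
Proof. by move=> r0 fc; rewrite -[in LHS](mulr1 c) cexp_filtM // cexp1 // mulr1. Qed.

Lemma solution_eval_filt r F : t <= r <= T -> filt r (ext_eval (psi r) F).
Proof. by move=> rT; apply: filt_eval; [exact: time_ge0 rT | move=> i; exact: solution_filt]. Qed.

Lemma drift_matched_end : drift_matched T.
Proof.
have TT : t <= T <= T by rewrite le_tT lexx.
have E0 : E finset.set0 != 0 by rewrite weight_scalar oner_neq0.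
split; rewrite ?tail_weight_end //.
  move=> j; rewrite /beta /log_deriv tail_weight_end weight_deriv -mulrA ext_mulVr // mulr1.
  exact: cexp_id T0 (solution_eval_filt _ TT).
exact: cexp_id T0 (solution_eval_filt _ TT).
Qed.

Lemma alg_one_neq0 : (1 : A) != 0.
Proof.
apply/eqP => e; have := nc_state1 A; rewrite e linear0 => /esym/eqP.
by rewrite oner_eq0.
Qed.

(** Z_r(psi_r) differs from its scalar part by a nilpotent m, so that the inverse of
    Z_r(psi_r) acts on the last non-zero power of m as the inverse of that scalar. *)
Lemma scalar_lower_bound r : t <= r <= T -> drift_matched r ->
  1 <= rn (Z r finset.set0 : K) * rn inv_weight.
Proof.
move=> rT [z0 _ Nr]; have r0 := time_ge0 rT; have apsi := solution_anticomm rT.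
set z := Z r finset.set0 in z0 *.
pose m := ext_eval (psi r) (Z r - z%:A).
have mE : ext_eval (psi r) (Z r) = z *: 1 + m.
  have e := @ext_eval_is_linear K n A (psi r) z 1 (Z r - z%:A).
  by move: e; rewrite [z *: 1 + (_ - _)]addrC subrK ext_eval1.
have nil : exists p, m ^+ p == 0.
  exists n.+1; rewrite -ext_evalX // ext_nilp; last exact: ext_sub_scalar.
  by apply/eqP; exact: raddf0.
case: (ex_minnP nil) => [[|p]]; first by rewrite expr0 (negPf alg_one_neq0).
move=> /eqP mp mmin; have mp0 : m ^+ p != 0.
  by apply/negP => /mmin; rewrite ltnn.
have N1 : cexp A r inv_weight * ext_eval (psi r) (Z r) = 1.
  rewrite Nr -ext_evalM // (ext_evenC _ (tail_weight_par r)) ext_mulVr //; exact: ext_eval1.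
have e1 : m ^+ p = z *: (cexp A r inv_weight * m ^+ p).
  rewrite -[LHS]mul1r -N1 -mulrA mE mulrDl -scalerAl mul1r -exprS mp addr0.
  by rewrite scalerAr.
have le1 : rn (m ^+ p) <= rn z * (rn inv_weight * rn (m ^+ p)).
  rewrite {1}e1 rnZ; apply: ler_wpM2l; first exact: rn_ge0.
  apply: le_trans (rn_mul _ _) _; apply: ler_wpM2r; first exact: rn_ge0.
  exact: rn_cexp.
have pos : 0 < rn (m ^+ p).
  rewrite lt_neqAle rn_ge0 andbT; apply: contra mp0 => /eqP e.
  by apply/eqP/rn_eq0.
by move: le1; rewrite mulrA -[leLHS]mul1r ler_pM2r.
Qed.

Lemma tilt_log_gradient j u s : 0 <= u -> u <= s -> s <= T -> Z s finset.set0 != 0 ->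
  tilt u s (beta j s) = beta j u.
Proof.
move=> u0 us sT zs; have e1 : beta j s * Z s = ext_deriv j (Z s).
  exact: log_derivM zs (tail_weight_par s).
have e2 : ext_heat (Cov u s) (ext_deriv j (Z s)) = ext_deriv j (Z u).
  exact: etrans (esym (ext_heat_deriv _ _ _)) (congr1 (ext_deriv j) (heat_tail_weight u0 us sT)).
exact: (congr1 (fun F => F * ext_inv (Z u)) (etrans (congr1 (ext_heat (Cov u s)) e1) e2)).
Qed.

Lemma tilt_inv u s : Z s finset.set0 != 0 -> tilt u s (ext_inv (Z s)) = ext_inv (Z u).
Proof.
move=> zs; have e1 : ext_inv (Z s) * Z s = 1.
  by rewrite (ext_evenC _ (tail_weight_par s)) ext_mulVr.
rewrite -[RHS]mul1r -(ext_heat1 (Cov u s)).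
exact: (congr1 (fun F => ext_heat (Cov u s) F * ext_inv (Z u)) e1).
Qed.

(** Suppose that on [u, s] the drift deviates from the logarithmic gradient by at most
    eta. There is no deviation at s; transporting the logarithmic gradient from s
    backwards, which again gives the logarithmic gradient, shows that the deviation is
    at most eta / 2 when the interval is short. So it vanishes, the transport is exact,
    and applied to the inverse of Z_s it yields the last clause at u. The length allowed
    is the same for all s, because of scalar_lower_bound. *)
Lemma drift_matched_step : exists2 e : R, 0 < e & forall u s, t <= u -> u <= s -> s <= T ->
  clk s - clk u <= e -> drift_matched s -> drift_matched u.
Proof.
have [M M1 HM] := field_bound; have [zb zb0 Zb] := tail_weight_bound.
pose k0 : R := (rn inv_weight + 1)^-1; pose k : R := k0 / 2.
have k00 : 0 < k0 by rewrite invr_gt0 ltr_wpDl ?rn_ge0.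
have kp : 0 < k by rewrite divr_gt0.
have [L L0 HL] := transport_error kp.
pose q := zb * inv_bound n k zb; have q0 : 0 <= q by rewrite mulr_ge0 ?inv_bound_ge0.
(* y1 e <= 1 keeps the scalar part of Z above k on the interval, half of its lower bound
   at s, and y2 e <= 1 makes the deviation of the drift shrink by half *)
pose y1 := n%:R * zb / k; pose y2 := 2 * (q * L).
have y10 : 0 <= y1 by rewrite divr_ge0 ?mulr_ge0 // ltW.
have y20 : 0 <= y2 by do ![done | apply: mulr_ge0].
pose e := (1 + y1 + y2)^-1.
have den : 0 < 1 + y1 + y2 by rewrite ltr_wpDr // ltr_wpDr.
have e0 : 0 < e by rewrite invr_gt0.
have ee y : y <= 1 + y1 + y2 -> y * e <= 1 by move=> yy; rewrite ler_pdivrMr // mul1r.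
exists e; first exact: e0.
move=> u s tu us sT ce [zs bs Ns].
have ts := le_trans tu us; have u0 := le_trans t0 tu; have s0 := le_trans u0 us.
have sTT : t <= s <= T by rewrite ts.
have k0s : k0 <= rn (Z s finset.set0 : K).
  have := scalar_lower_bound sTT (And3 zs bs Ns); rewrite /k0 => h1.
  rewrite -[_^-1]mul1r ler_pdivrMr; last by rewrite ltr_wpDl ?rn_ge0.
  by apply: le_trans h1 _; apply: ler_wpM2l; rewrite ?rn_ge0 // lerDl.
have ce' r : u <= r -> r <= s -> clk s - clk r <= e.
  move=> ur rs; apply: le_trans ce; rewrite lerD2l lerN2; apply: variance_clock_mono => //.
  exact: le_trans sT.
have kz r : u <= r <= s -> k <= rn (Z r finset.set0 : K).
  case/andP=> ur rs; have r0 := le_trans u0 ur.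
  have d1 : ext_rn (ext_heat (Cov r s) (Z s) - Z s) <= k.
    apply: le_trans (ext_rn_heat1 _ (le_trans (cov_rn_increment r0 rs sT) (ce' r ur rs)) _) _.
      by rewrite -[e]mul1r; apply: ee; rewrite -addrA lerDl addr_ge0.
    apply: (@le_trans _ _ (n%:R * e * zb)).
      by apply: ler_wpM2l; [rewrite mulr_ge0 // ltW | exact: Zb].
    have : y1 * e <= 1 by apply: ee; rewrite addrAC lerDr addr_ge0.
    have -> : y1 * e = (n%:R * e * zb) / k by rewrite /y1; ring.
    by rewrite ler_pdivrMr // mul1r.
  have eZ : ext_heat (Cov r s) (Z s) = Z r by exact: heat_tail_weight.
  have := le_trans (ext_rn_scalar _) d1; rewrite eZ ext_scalarB rnC => d2.
  have := rnD (Z s finset.set0 - Z r finset.set0 : K) (Z r finset.set0); rewrite subrK => d3.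
  have kk : k0 = k + k by rewrite /k; field.
  rewrite -(lerD2l k) -kk; apply: le_trans k0s _; apply: le_trans d3 _.
  by rewrite lerD2r.
have zu r : u <= r <= s -> Z r finset.set0 != 0 by move=> /kz; exact: tail_weight_neq0.
pose eta0 := b_max + q * M ^+ n.
have eta00 : 0 <= eta0.
  rewrite addr_ge0 ?cond_gradient_max_ge0 // mulr_ge0 // exprn_ge0 //; exact: le_trans M1.
have bbeta r j : u <= r <= s -> ext_rn (beta j r) <= q.
  move=> rus; have /andP[ur rs] := rus; have ZrB : ext_rn (Z r) <= zb.
    by apply: Zb; rewrite (le_trans tu ur) (le_trans rs).
  exact: (ext_rn_log_deriv j kp (kz r rus) ZrB).
have decay (m : nat) r j : u <= r <= s ->
    rn (b j r - ext_eval (psi r) (beta j r)) <= eta0 * 2^-1 ^+ m.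
  elim: m r j => [|m IH] r j rus; have /andP[ur rs] := rus; have r0 := le_trans u0 ur.
    have tr := le_trans tu ur; have rT := le_trans rs sT.
    rewrite expr0 mulr1; apply: le_trans (rnB _ _) _; apply: lerD; first exact: rn_cond_gradient.
    apply: le_trans (rn_eval _ M1 _) _; first by move=> i; have [] := HM r r i tr (lexx r) rT.
    apply: ler_wpM2r; last exact: bbeta.
    by rewrite exprn_ge0 //; exact: le_trans M1.
  have h1 : 0 <= eta0 * 2^-1 ^+ m by rewrite mulr_ge0 // exprn_ge0.
  have kz' p : r <= p <= s -> k <= rn (Z p finset.set0 : K).
    by case/andP=> rp ps; apply: kz; rewrite ps (le_trans ur).
  have IH' p l : r <= p <= s -> rn (b l p - ext_eval (psi p) (beta l p)) <= eta0 * 2^-1 ^+ m.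
    by case/andP=> rp ps; apply: IH; rewrite ps (le_trans ur).
  have := HL (beta j s) r s _ (le_trans tu ur) rs sT h1 kz' IH'.
  rewrite tilt_log_gradient // -bs cexp_tower ?r0 // => h2; apply: le_trans h2 _.
  have h3 : ext_rn (beta j s) * (L * (clk s - clk r)) <= 2^-1.
    apply: (@le_trans _ _ (q * (L * e))).
      apply: ler_pM; rewrite ?ext_rn_ge0 //.
      - by rewrite mulr_ge0 // subr_ge0 variance_clock_mono.
      - by apply: bbeta; rewrite us lexx.
      - by apply: ler_wpM2l => //; exact: ce'.
    have : y2 * e <= 1 by apply: ee; rewrite lerDr addr_ge0.
    have -> : y2 * e = 2 * (q * (L * e)) by rewrite /y2; ring.
    by rewrite -ler_pdivlMl // mulr1.
  have -> : eta0 * 2^-1 ^+ m.+1 = 2^-1 * (eta0 * 2^-1 ^+ m) by rewrite exprS mulrCA.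
  by rewrite mulrA; exact: ler_wpM2r.
have bu r j : u <= r <= s -> b j r = ext_eval (psi r) (beta j r).
  move=> rus; apply/eqP; rewrite -subr_eq0; apply/eqP.
  by apply: (@geometric_bound_eq0 _ _ _ eta0) => // m; exact: decay.
have uus : u <= u <= s by rewrite lexx.
split; [exact: zu | by move=> j; exact: bu |].
have bz0 r j : u <= r <= s -> rn (b j r - ext_eval (psi r) (beta j r)) <= 0.
  by move=> rus; rewrite bu // subrr rn0.
have le0 : rn (cexp A u (ext_eval (psi s) (ext_inv (Z s))) -
    ext_eval (psi u) (ext_inv (Z u))) <= 0.
  have := HL (ext_inv (Z s)) u s 0 tu us sT (lexx 0) kz bz0.
  rewrite (tilt_inv u zs) => le0; apply: le_trans le0 _.
  by rewrite mulr0 mulr0.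
have us' : 0 <= u <= s by rewrite u0.
rewrite -(cexp_tower inv_weight us') Ns.
by apply/eqP; rewrite -subr_eq0; apply/eqP; exact: rn_le0 le0.
Qed.

Lemma drift_matched_all u : t <= u <= T -> drift_matched u.
Proof.
have [e e0 step] := drift_matched_step => /andP[tu uT]; have u0 := le_trans t0 tu.
have : clk T - clk u <= (Num.truncn ((clk T - clk u) / e)).+1%:R * e.
  by rewrite -ler_pdivrMr //; apply/ltW; exact: truncnS_gt.
move: (Num.truncn _).+1 => N.
elim: N u tu uT u0 => [|N IH] u tu uT u0 ce.
  apply: (step u T) => //; last exact: drift_matched_end.
  by apply: le_trans ce _; rewrite mul0r ltW.
have [w [/andP[uw wT] c1 c2]] := clock_split speed_integrable speed_ge0 u0 uT (lexx T) (ltW e0) ce.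
have tw := le_trans tu uw; have w0 := le_trans u0 uw.
by apply: (step u w) => //; exact: IH.
Qed.

(** The drift being exact, transport_error leaves no error. *)
Lemma cexp_solution P u s : t <= u -> u <= s -> s <= T ->
  cexp A u (ext_eval (psi s) P) = ext_eval (psi u) (tilt u s P).
Proof.
move=> tu us sT; pose k : R := (rn inv_weight + 1)^-1.
have k0 : 0 < k by rewrite invr_gt0 ltr_wpDl ?rn_ge0.
have [L L0 HL] := transport_error k0.
have in_tT r : u <= r <= s -> t <= r <= T.
  by case/andP=> ur rs; rewrite (le_trans tu) // (le_trans rs).
apply/eqP; rewrite -subr_eq0; apply/eqP/rn_le0.
apply: le_trans (HL P u s 0 tu us sT (lexx 0) _ _) _; last by rewrite !mulr0.
  move=> r /in_tT rT; have h1 := scalar_lower_bound rT (drift_matched_all rT).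
  rewrite /k -[_^-1]mul1r ler_pdivrMr; last by rewrite ltr_wpDl ?rn_ge0.
  by apply: le_trans h1 _; apply: ler_wpM2l; rewrite ?rn_ge0 // lerDl.
by move=> r j /in_tT rT; have [_ bj _] := drift_matched_all rT; rewrite bj subrr rn0.
Qed.

(** * The law of the solution *)

Lemma solution_start i : psi t i = 0.
Proof.
have [|I iI eI] := sol_eq Psi_sol (s := t) (v i); first by rewrite lexx.
rewrite /psi eI /incr subrr addr0 big1 // => j _.
have fun0 x y : vector_functional idfun x y (I j) = 0.
  have cf : continuous (vector_functional (A := A) idfun x y : A -> K^o).
    by apply: (vector_functional_continuous (K := 1)) => c; rewrite mul1r.
  have [_ ->] := iI j (vector_functional idfun x y) cf.
  by rewrite /cintegral set_itv1 !Rintegral_set1.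
apply: rn_le0; apply: (rn_rep_le (rho := nc_rep A)) => // y.
rewrite mul0r -[leRHS](rn0 (nc_hilbert A)); set w := rep _ _ _.
suff -> : w = 0 by rewrite rn0.
apply: rn_eq0; apply/eqP; have := fun0 w y.
rewrite /vector_functional /= -/w ipE => /eqP.
by rewrite -[0]/(0%:C%C) (inj_eq (@complexI R)) sqrf_eq0.
Qed.

Lemma cexp_solution_start P s : t <= s <= T ->
  cexp A t (ext_eval (psi s) P) =
  (ext_heat (Cov t s) (P * Z s) finset.set0 / Z t finset.set0)%:A.
Proof.
move=> /andP[ts sT]; rewrite cexp_solution //.
have -> : psi t = fun=> 0 by apply/funext => i; exact: solution_start.
have tTT : t <= t <= T by rewrite lexx.
have [zt _ _] := drift_matched_all tTT.
by rewrite ext_eval_zero /tilt ext_mul0E ext_inv_scalar.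
Qed.

(** Conditioning at s turns the weight into Z s. *)
Lemma cexp_gaussian P s : t <= s <= T ->
  cexp A t (ext_eval (xi t s) P * ext_eval (xi t T) E) =
  (ext_heat (Cov t s) (P * Z s) finset.set0)%:A.
Proof.
move=> /andP[ts sT]; have s0 := le_trans t0 ts.
have ax : anticomm (xi t s) by move=> i j; exact: increment_anti.
have xE : xi t T = fun i => xi t s i + xi s T i by apply/funext => i; exact: increment_split.
have fx i : filt s (xi t s i) by exact: increment_filt.
have ts' : 0 <= t <= s by rewrite t0.
rewrite -(cexp_tower _ ts') cexp_filtM //; last exact: filt_eval.
rewrite xE (cexp_increment _ s0 sT) //; last by move=> i j; exact: increment_anti.
rewrite -ext_evalM //.
have x0 : xi t s = fun i => 0 + xi t s i by apply/funext => i; rewrite add0r.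
have filt0 : filt t (0 : A).
  have [B1 + _ _ _] := filt_sub A t0 => /(_ (-1) 1 1 B1 B1).
  by rewrite scaleN1r addNr.
have := @cexp_increment t s (fun=> 0) (P * Z s) t0 ts (fun=> filt0).
rewrite -x0 => ->.
- exact: ext_eval_zero.
- by move=> i j; rewrite mulr0 addr0.
- by move=> i j; rewrite /anticommute mulr0 mul0r addr0.
Qed.

(** V is the sum of its scalar part and an element whose value at an anticommuting
    family is nilpotent. *)
Lemma exp_potential : exists2 e : K, e != 0 &
  cstar_exp (ext_eval (xi t T) V) = e *: ext_eval (xi t T) E.
Proof.
have [e e0 he] := cstar_exp_nilpotent (V finset.set0) alg_one_neq0; exists e => //.
have ax : anticomm (xi t T) by move=> i j; exact: increment_anti.
pose m := ext_eval (xi t T) (V - (V finset.set0)%:A).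
have mp : m ^+ n.+2 = 0.
  by rewrite -ext_evalX // exprS (ext_nilp (ext_sub_scalar V)) mulr0; exact: raddf0.
have -> : ext_eval (xi t T) V = (V finset.set0)%:A + m.
  have := @ext_eval_is_linear K n A (xi t T) (V finset.set0) 1 (V - (V finset.set0)%:A).
  by rewrite [_ *: 1 + (_ - _)]addrC subrK ext_eval1.
rewrite (he m n.+2 mp); congr (e *: _).
rewrite /exp_partial /E /ext_exp raddf_sum; apply: eq_bigr => k _.
by rewrite -ext_evalX //; apply/esym; exact: linearZ.
Qed.

(** Both conditional expectations are scalars, in which the exponential of the scalar
    part of V is a common factor. *)
Lemma solution_law P s : t <= s <= T ->
  let expV := cstar_exp (grassmann_eval v V (incr X t T)) in
  exists Zinv : A,
    [/\ cexp A t expV * Zinv = 1, Zinv * cexp A t expV = 1 &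
        cexp A t (grassmann_eval v P (Psi s)) =
        cexp A t (grassmann_eval v P (incr X t s) * expV) * Zinv].
Proof.
move=> tsT expV; have [e e0 expVE] := exp_potential.
have tTT : t <= t <= T by rewrite lexx.
have TT : t <= T <= T by rewrite lexx le_tT.
have [zt _ _] := drift_matched_all tTT.
have ez : e * Z t finset.set0 != 0 by rewrite mulf_neq0.
have cV : cexp A t expV = (e * Z t finset.set0)%:A.
  have eV : expV = e *: ext_eval (xi t T) E by exact: expVE.
  have := cexp_gaussian 1 TT; rewrite ext_eval1 !mul1r tail_weight_end => h1.
  by rewrite eV linearZ /= h1 scalerA.
exists ((e * Z t finset.set0)^-1)%:A; rewrite cV.
split; [by rewrite -scalerAl mul1r scalerA mulfV // scale1r |
        by rewrite -scalerAl mul1r scalerA mulVf // scale1r |].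
have -> : cexp A t (grassmann_eval v P (Psi s)) =
    (ext_heat (Cov t s) (P * Z s) finset.set0 / Z t finset.set0)%:A.
  exact: cexp_solution_start.
have -> : cexp A t (grassmann_eval v P (incr X t s) * expV) =
    e *: (ext_heat (Cov t s) (P * Z s) finset.set0)%:A.
  rewrite -(cexp_gaussian P tsT) -linearZ /= scalerAr -expVE.
  by [].
rewrite -scalerAl -scalerAl mul1r !scalerA; congr (_ *: _).
exact: quotient_cancel.
Qed.
End FBSDETheory.

Theorem theorem3p12 (R : realType) (A : fnps R) (h : hilbertType R) (n : nat)
    (v : 'I_n -> h) (Theta : h -> h) (G Gdot : R -> {linear h -> h})
    (X Psi : R -> {linear h -> A}) (t T : R) (V : extalg R[i] n)
    (tT : 0 <= t <= T)
    (v_onb : orthonormal_basis v)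
    (Theta_conj : conjugation Theta)
    (V_even : ext_even V)
    (X_gbm : is_gbm Theta G X)
    (G_diff : forall r : R, 0 <= r -> has_derivative G (Gdot r) r)
    (X_norm : norm_compatible Theta Gdot X)
    (Psi_sol : fbsde_solution v Theta Gdot X V t T Psi) :
  forall (P : extalg R[i] n) (s : R), t <= s <= T ->
    let expV := cstar_exp (grassmann_eval v V (incr X t T)) in
    exists Zinv : A,
      [/\ cexp A t expV * Zinv = 1, Zinv * cexp A t expV = 1 &
          cexp A t (grassmann_eval v P (Psi s)) =
          cexp A t (grassmann_eval v P (incr X t s) * expV) * Zinv].
Proof.
exact: (solution_law tT v_onb V_even X_gbm G_diff X_norm Psi_sol).
Qed.
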